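(* Suppose $\mathscr H_{r,n}$ is semisimple. Let $\boldsymbol\lambda\in\mathscr P_{r,n}$, $\mathfrak t\in\mathrm{Std}(\boldsymbol\lambda)$ and $l\in\mathbb Z/p_{\boldsymbol\lambda}\mathbb Z$. Then the explicitly defined element $h_{\mathfrak t}^{\langle l\rangle}$ (defined in the context) is an invertible element of $K$ and $$\frac{\gamma_{\mathfrak t\langle lo_{\boldsymbol\lambda}\rangle}}{\gamma_{\mathfrak t}}=\bigl(h_{\mathfrak t}^{\langle l\rangle}\bigr)^2 .$$
   Context: Setting. $r,p,d\ge1$ and $n\ge2$ are integers with $r=pd$; $K$ is a field containing a primitive $p$-th root of unity $\varepsilon$; $q\in K^\times$, $q\ne1$; $Q_1,\dots,Q_d\in K^\times$. $\mathscr H_{r,n}$ is the unital associative $K$-algebra with generators $T_0,\dots,T_{n-1}$ and relations $(T_0^p-Q_1^p)\cdots(T_0^p-Q_d^p)=0$; $T_0T_1T_0T_1=T_1T_0T_1T_0$; $(T_i-q)(T_i+1)=0$ for $1\le i\le n-1$; $T_iT_j=T_jT_i$ for $0\le i<j-1<n-1$; $T_iT_{i+1}T_i=T_{i+1}T_iT_{i+1}$ for $1\le i<n-1$. Its cyclotomic parameters, in order, are $\mathsf Q_{c+(t-1)d}=\varepsilon^tQ_c$ ($1\le c\le d$, $1\le t\le p$). It is (split) semisimple iff $\prod_{i=1}^n(1+q+\cdots+q^{i-1})\prod_{-n<k<n}\bigl(\prod_{1\le i<j\le d}\prod_{0\le t<p}(Q_i-\varepsilon^tq^kQ_j)\bigr)\bigl(\prod_{1\le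 i\le d}\prod_{1\le t<p}Q_i(1-\varepsilon^tq^k)\bigr)\ne0$. Combinatorics. $\mathscr P_{r,n}$ is the set of $r$-multipartitions $\boldsymbol\lambda=(\lambda^{(1)},\dots,\lambda^{(r)})$ of $n$. $\mathrm{Std}(\boldsymbol\lambda)$ is the set of standard $\boldsymbol\lambda$-tableaux $\mathfrak t=(\mathfrak t^{(1)},\dots,\mathfrak t^{(r)})$ (bijective fillings by $1,\dots,n$, increasing along rows and columns of each component). $\mathfrak S_n$ acts on tableaux from the right by permuting entries. $\mathfrak t^{\boldsymbol\lambda}$ is the tableau with $1,\dots,n$ entered in order along successive rows of $\lambda^{(1)}$, then $\lambda^{(2)}$, etc.; $d(\mathfrak t)\in\mathfrak S_n$ is defined by $\mathfrak t=\mathfrak t^{\boldsymbol\lambda}d(\mathfrak t)$. Put $\boldsymbol\lambda^{[t]}=(\lambda^{(dt-d+1)},\dots,\lambda^{(dt)})$, $\mathfrak t^{[t]}=(\mathfrak t^{(dt-d+1)},\dots,\mathfrak t^{(dt)})$ for $1\le t\le p$, with superscripts $[t]$ read modulo $p$. For $z\in\mathbb Z$: $\boldsymbol\lambda\langle z\rangle=(\boldsymbol\lambda^{[z+1]},\dots,\boldsymbol\lambda^{[z+p]})$ and $\mathfrak t\langle z\rangle=(\mathfrak t^{[z+1]},\dots,\mathfrak t^{[z+p]})\in\mathrm{Std}(\boldsymbol\lambda\langle z\rangle)$. $o_{\boldsymbol\lambda}=\min\{k\ge1:\boldsymbol\lambda^{[k+t]}=\boldsymbol\lambda^{[t]}\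 \forall t\in\mathbb Z\}$ (it divides $p$), $p_{\boldsymbol\lambda}=p/o_{\boldsymbol\lambda}$. The residue is $\mathrm{res}_{\mathfrak t}(k)=\varepsilon^tq^{b-a}Q_c$ if $k$ lies in row $a$, column $b$ of $\mathfrak t^{(c+(t-1)d)}$, $1\le c\le d$, $1\le t\le p$. Say $\boldsymbol\lambda\sim_\sigma\boldsymbol\mu$ if $\boldsymbol\mu=\boldsymbol\lambda\langle k\rangle$ for some $k$; $\mathscr P^\sigma_{r,n}$ denotes a fixed set of representatives of the $\sim_\sigma$-classes. Seminormal basis. $L_1=T_0$, $L_{k+1}=q^{-1}T_kL_kT_k$; $*$ is the anti-automorphism fixing all $T_i$; $m_{\boldsymbol\lambda}=\bigl(\prod_{s=2}^r\prod_{k=1}^{|\lambda^{(1)}|+\cdots+|\lambda^{(s-1)}|}(L_k-\mathsf Q_s)\bigr)\sum_{w\in\mathfrak S_{\boldsymbol\lambda}}T_w$ with $\mathfrak S_{\boldsymbol\lambda}$ the row stabilizer of $\mathfrak t^{\boldsymbol\lambda}$; $R(k)=\{\mathrm{res}_{\mathfrak s}(k):\mathfrak s\in\mathrm{Std}(\boldsymbol\mu),\boldsymbol\mu\in\mathscr P_{r,n}\}$; $F_{\mathfrak t}=\prod_{k=1}^n\prod_{c\in R(k),c\ne\mathrm{res}_{\mathfrak t}(k)}\frac{L_k-c}{\mathrm{res}_{\mathfrak t}(k)-c}$; $f_{\mathfrak s\mathfrak t}=F_{\mathfrak s}T_{d(\mathfrak s)}^*m_{\boldsymbol\lambda}T_{d(\mathfrak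 t)}F_{\mathfrak t}$. In the semisimple case $\{f_{\mathfrak s\mathfrak t}\}$ is a $K$-basis of $\mathscr H_{r,n}$ and there are unique $\gamma_{\mathfrak t}\in K^\times$ with $f_{\mathfrak u\mathfrak v}f_{\mathfrak s\mathfrak t}=\delta_{\mathfrak v\mathfrak s}\gamma_{\mathfrak s}f_{\mathfrak u\mathfrak t}$. Equivalently: $\gamma_{\mathfrak t^{\boldsymbol\lambda}}=\prod_{c,i}[\lambda^{(c)}_i]_q^!\prod_{1\le b<c\le r}\prod_{(i,j)\in\lambda^{(b)}}(q^{j-i}\mathsf Q_b-\mathsf Q_c)$, where $[m]_q^!=\prod_{i=1}^m\frac{q^i-1}{q-1}$, and if $\mathfrak s$ and $\mathfrak t=\mathfrak s(i,i+1)$ are standard with $\ell(d(\mathfrak t))=\ell(d(\mathfrak s))+1$ then $\gamma_{\mathfrak t}=\frac{(qx-y)(x-qy)}{(x-y)^2}\gamma_{\mathfrak s}$ with $x=\mathrm{res}_{\mathfrak s}(i)$, $y=\mathrm{res}_{\mathfrak s}(i+1)$. The tableaux $\mathrm{mid}_k(\mathfrak t)$. For $\mathfrak t\in\mathrm{Std}(\boldsymbol\lambda)$ and $1\le k\le p$ let $a_k=\sum_{i=1}^k|\boldsymbol\lambda^{[i]}|$ and write uniquely $d(\mathfrak t)=x_kd_k$ with $x_k\in\mathfrak S_{(a_k,n-a_k)}=\mathfrak S_{\{1,\dots,a_k\}}\times\mathfrak S_{\{a_k+1,\dots,n\}}$ and $d_k$ a minimal length right coset representative of $\mathfrak S_{(a_k,n-a_k)}$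 in $\mathfrak S_n$. Put $\mathrm{mid}_k(\mathfrak t)=\mathfrak t^{\boldsymbol\lambda}x_k$, $\mathrm{mid}_0(\mathfrak t)=\mathfrak t=\mathrm{mid}_p(\mathfrak t)$, and extend to $k\in\mathbb Z$ periodically modulo $p$. The element $h_{\boldsymbol\lambda}$. Put $a=\sum_{i=1}^{o_{\boldsymbol\lambda}}|\boldsymbol\lambda^{[i]}|$, $\rho_i=\mathrm{res}_{\mathfrak t^{\boldsymbol\lambda}}(i)$ ($1\le i\le a$), and $P_k=\prod_{i=1}^a\prod_{j=1}^a\frac{(q\rho_j-\varepsilon^{ko_{\boldsymbol\lambda}}\rho_i)(\rho_j-q\varepsilon^{ko_{\boldsymbol\lambda}}\rho_i)}{(\rho_j-\varepsilon^{ko_{\boldsymbol\lambda}}\rho_i)^2}$. Then $h_{\boldsymbol\lambda}=\prod_{k=1}^{(p_{\boldsymbol\lambda}-1)/2}P_k$ if $p_{\boldsymbol\lambda}$ is odd, and $h_{\boldsymbol\lambda}=\prod_{k=1}^{p_{\boldsymbol\lambda}/2-1}P_k\cdot\frac{(q+1)^a}{2^a}\prod_{1\le j<i\le a}\frac{(q\rho_j+\rho_i)(\rho_j+q\rho_i)}{(\rho_j+\rho_i)^2}$ if $p_{\boldsymbol\lambda}$ is even. For $l\ge0$ put $h_{\boldsymbol\lambda,0,0}=1$ and, for $l\ge1$, $h_{\boldsymbol\lambda,0,l}=h_{\boldsymbol\lambda}^l\prod_{k=0}^{l-1}\frac{\gamma_{\mathrm{mid}_{o_{\boldsymbol\lambda}}(\mathfrak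 t^{\boldsymbol\lambda}\langle ko_{\boldsymbol\lambda}\rangle)}}{\gamma_{\mathfrak t^{\boldsymbol\lambda}\langle ko_{\boldsymbol\lambda}\rangle}}$. The elements $h_{\mathfrak t}^{\langle l\rangle}$. Let $\boldsymbol\lambda\in\mathscr P^\sigma_{r,n}$, let $\mathfrak t\in\mathrm{Std}(\boldsymbol\lambda)$ be such that $1$ occurs in $(\mathfrak t^{[1]},\dots,\mathfrak t^{[o_{\boldsymbol\lambda}]})$, and let $l\in\mathbb Z/p_{\boldsymbol\lambda}\mathbb Z$, represented by $l\in\{0,\dots,p_{\boldsymbol\lambda}-1\}$. Put $h_{\mathfrak t}^{\langle l\rangle}=h_{\boldsymbol\lambda,0,l}\,\gamma_{\mathrm{mid}_{lo_{\boldsymbol\lambda}}(\mathfrak t)}/\gamma_{\mathfrak t}$ and, for $x\in\mathbb Z/p\mathbb Z$, $h_{\mathfrak t,x}^{\langle l\rangle}=h_{\mathfrak t}^{\langle l\rangle}\frac{\gamma_{\mathfrak t}\,\gamma_{\mathrm{mid}_x(\mathfrak t\langle lo_{\boldsymbol\lambda}\rangle)}}{\gamma_{\mathrm{mid}_x(\mathfrak t)}\,\gamma_{\mathfrak t\langle lo_{\boldsymbol\lambda}\rangle}}$. Every standard tableau $\mathfrak s$ (of any shape in $\mathscr P_{r,n}$) can be written uniquely as $\mathfrak s=\mathfrak t\langle x\rangle$ with such $\boldsymbol\lambda,\mathfrak t$ and $x\in\mathbb Z/p\mathbb Z$; one sets $h_{\mathfrak s}^{\langle l\rangle}=h_{\mathfrak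 t,x}^{\langle l\rangle}$. *)

(* Defs.v *)
From HB Require Import structures.
From mathcomp Require Import all_boot all_order all_fingroup all_algebra.

Set Implicit Arguments.
Unset Strict Implicit.
Unset Printing Implicit Defensive.

Import GRing.Theory.
Local Open Scope ring_scope.

(* Conventions.  The numbers p >= 1 and d >= 1 are written p'.+1 and d'.+1.
   Entries of tableaux, generators L_k, components of multipartitions, blocks
   of d consecutive components, rows and columns are all numbered from 0; the
   generators T_0, ..., T_(n-1) keep their usual numbers. *)

Definition left_ideal (A : nzRingType) (I : A -> Prop) : Prop :=
  [/\ I 0, (forall x y, I x -> I y -> I (x + y))
    & (forall a x, I x -> I (a * x))].

(* The left regular module is semisimple: every left ideal is a direct
   summand. *)
Definition semisimple_ring (A : nzRingType) : Prop :=
  forall I : A -> Prop, left_ideal I ->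
  exists J : A -> Prop,
    [/\ left_ideal J, (forall x, I x -> J x -> x = 0)
      & (forall x, exists y z, [/\ I y, J z & x = y + z])].

(* Permutations act from the right: (v * w) i = w (v i). *)
Section SymmetricGroup.

Variable n : nat.

(* The transposition of the entries i - 1 and i, for 0 < i. *)
Definition simple_refl (i : 'I_n) : 'S_n := tperm (ord_pred i) i.

Definition perm_length (w : 'S_n) : nat :=
  #|[set ij : 'I_n * 'I_n | (ij.1 < ij.2)%N && (w ij.2 < w ij.1)%N]|.

Definition is_reduced_word (w : 'S_n) (s : seq 'I_n) : bool :=
  [&& all (fun i : 'I_n => 0 < i)%N s, size s == perm_length w
    & (\prod_(i <- s) simple_refl i)%g == w].

(* Some reduced word of w; the elements T_w below do not depend on it. *)
Definition reduced_word (w : 'S_n) : seq 'I_n :=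
  oapp val [::]
    [pick s : (perm_length w).-tuple 'I_n | is_reduced_word w (val s)].

(* The Young subgroup of type (a, n - a). *)
Definition young2 (a : nat) (w : 'S_n) : bool :=
  [forall i : 'I_n, (w i < a)%N == (i < a)%N].

(* The factor x of w = x * y, where x lies in the Young subgroup of type
   (a, n - a) and y has minimal length in its right coset. *)
Definition young2_part (a : nat) (w : 'S_n) : 'S_n :=
  odflt 1%g [pick x : 'S_n | young2 a x &&
    [forall z : 'S_n, young2 a z ==>
      (perm_length (x^-1 * w)%g <= perm_length (z * (x^-1 * w))%g)%N]].

End SymmetricGroup.

Section Combinatorics.

Variables p' d' n : nat.
Local Notation p := p'.+1.
Local Notation d := d'.+1.
Local Notation r := (p'.+1 * d'.+1)%N.

(* (component, (row, column)) *)
Definition node := ('I_r * ('I_n * 'I_n))%type.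

(* la s i is the length of row i of component s, padded by zeros to n rows. *)
Definition mpart := {ffun 'I_r -> {ffun 'I_n -> 'I_n.+1}}.

Definition comp_size (la : mpart) (s : 'I_r) : nat := (\sum_(i < n) la s i)%N.

Definition is_mpart (la : mpart) : bool :=
  [forall s, forall i : 'I_n, forall j : 'I_n,
     (i <= j)%N ==> (la s j <= la s i)%N]
  && (\sum_s comp_size la s == n)%N.

Definition diagram (la : mpart) : {set node} :=
  [set x : node | (x.2.2 < la x.1 x.2.1)%N].

(* t k is the node occupied by the entry k. *)
Definition tableau := {ffun 'I_n -> node}.

Definition is_std (la : mpart) (t : tableau) : bool :=
  [&& injectiveb t, [set t k | k : 'I_n] == diagram la,
      [forall k : 'I_n, forall l : 'I_n,
        [&& (t k).1 == (t l).1, (t k).2.1 == (t l).2.1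
          & ((t k).2.2 < (t l).2.2)%N] ==> (k < l)%N]
    & [forall k : 'I_n, forall l : 'I_n,
        [&& (t k).1 == (t l).1, (t k).2.2 == (t l).2.2
          & ((t k).2.1 < (t l).2.1)%N] ==> (k < l)%N]].

(* t w, the right action: the entry j is replaced by w j. *)
Definition tab_act (t : tableau) (w : 'S_n) : tableau :=
  [ffun k => t ((w^-1)%g k)].

(* The number of nodes that precede x when the diagram is read along
   successive rows, one component after the other. *)
Definition row_reading (la : mpart) (x : node) : nat :=
  (\sum_(s < r | s < x.1) comp_size la s
   + \sum_(i < n | i < x.2.1) la x.1 i + x.2.2)%N.

(* The tableau t^la. *)
Definition init_tab (la : mpart) : tableau :=
  [ffun k : 'I_n => odflt (ord0, (k, k))
     [pick x : node | (x \in diagram la) && (row_reading la x == k)]].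

(* The permutation d(t). *)
Definition tab_perm (la : mpart) (t : tableau) : 'S_n :=
  odflt 1%g [pick w : 'S_n | tab_act (init_tab la) w == t].

(* Addition of z blocks to the index of a component, modulo r. *)
Definition shift_comp (z : nat) (s : 'I_r) : 'I_r :=
  insubd s ((s + d * z) %% r)%N.

(* la<z> and t<z>.  These depend only on z modulo p, so natural numbers z
   suffice.  Component s of la<z> (resp. t<z>) is component
   shift_comp z s of la (resp. t). *)
Definition mpart_shift (z : nat) (la : mpart) : mpart :=
  [ffun s => la (shift_comp z s)].

Definition tab_shift (z : nat) (t : tableau) : tableau :=
  [ffun k => (shift_comp (p - z %% p) (t k).1, (t k).2)].

(* The number of nodes in the first k blocks of la. *)
Definition blocks_size (la : mpart) (k : nat) : nat :=
  (\sum_(s < r | s < k * d) comp_size la s)%N.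

Lemma shift_period (la : mpart) :
  exists k, (0 < k)%N && (mpart_shift k la == la).
Proof.
exists p; apply/andP; split => //.
apply/eqP/ffunP => s; rewrite ffunE; congr (la _).
apply: val_inj; rewrite val_insubd ltn_pmod //.
by rewrite [(d * _)%N]mulnC modnDr modn_small.
Qed.

(* o_la and p_la *)
Definition o_ (la : mpart) : nat := ex_minn (shift_period la).
Definition p_ (la : mpart) : nat := (p %/ o_ la)%N.

(* mid_k(t), for t of shape la *)
Definition mid (la : mpart) (k : nat) (t : tableau) : tableau :=
  if (k %% p == 0)%N then t
  else tab_act (init_tab la)
         (young2_part (blocks_size la (k %% p)) (tab_perm la t)).

Definition shift_equiv (la mu : mpart) : Prop :=
  exists k, mu = mpart_shift k la.

Definition shift_transversal (P : {set mpart}) : Prop :=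
  (forall la, la \in P -> is_mpart la) /\
  (forall la, is_mpart la -> exists! mu, mu \in P /\ shift_equiv la mu).

(* The smallest entry of t occurs in one of the first o_la blocks. *)
Definition starts_early (la : mpart) (t : tableau) : bool :=
  [forall k : 'I_n, (k == 0 :> nat)%N ==> ((t k).1 < o_ la * d)%N].

Section Residues.

Variables (K : fieldType) (eps q : K) (Q : 'I_d -> K).

(* Component s = c + t * d, with c < d, has the parameter eps^(t+1) Q_c; the
   exponent is t + 1 because blocks are numbered from 0. *)
Definition cyc_param (s : 'I_r) : K :=
  eps ^+ (s %/ d).+1 * Q (inord (s %% d)).

Definition res (t : tableau) (k : 'I_n) : K :=
  q ^ ((t k).2.2%:Z - (t k).2.1%:Z) * cyc_param (t k).1.

(* R(k), without repetitions *)
Definition residues (k : 'I_n) : seq K :=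
  undup [seq res s k |
    s <- enum [pred s : tableau | [exists mu, is_mpart mu && is_std mu s]]].

(* Only the values T i with i < n matter. *)
Definition hecke_relations (A : algType K) (T : nat -> A) : Prop :=
  [/\ \prod_(c < d) (T 0%N ^+ p - (Q c ^+ p)%:A) = 0,
      T 0%N * T 1%N * T 0%N * T 1%N = T 1%N * T 0%N * T 1%N * T 0%N,
      (forall i, (0 < i < n)%N -> (T i - q%:A) * (T i + 1) = 0),
      (forall i j, (i.+1 < j < n)%N -> T i * T j = T j * T i)
    & (forall i, (0 < i)%N -> (i.+1 < n)%N ->
         T i * T i.+1 * T i = T i.+1 * T i * T i.+1)].

(* A, with the elements T_0, ..., T_(n-1), is the K-algebra presented by
   these generators and relations. *)
Definition is_hecke_algebra (A : algType K) (T : nat -> A) : Prop :=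
  [/\ hecke_relations T,
      (forall (B : algType K) (S : nat -> B), hecke_relations S ->
         exists phi : {lrmorphism A -> B},
           forall i, (i < n)%N -> phi (T i) = S i)
    & (forall (B : algType K) (phi psi : {lrmorphism A -> B}),
         (forall i, (i < n)%N -> phi (T i) = psi (T i)) -> phi =1 psi)].

Section SeminormalBasis.

Variables (A : algType K) (T : nat -> A) (star : {linear A -> A}).

(* star is the anti-automorphism * that fixes the generators. *)
Definition is_star : Prop :=
  [/\ star 1 = 1, (forall x y, star (x * y) = star y * star x)
    & (forall i, (i < n)%N -> star (T i) = T i)].

(* L k is the Jucys-Murphy element usually called L_(k+1). *)
Fixpoint L (k : nat) : A :=
  if k is j.+1 then q^-1 *: (T j.+1 * L j * T j.+1) else T 0%N.

Definition T_perm (w : 'S_n) : A := \prod_(i <- reduced_word w) T i.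

Definition row_stabilizer (la : mpart) : {set 'S_n} :=
  [set w : 'S_n | [forall k : 'I_n,
     (((init_tab la (w k)).1 == (init_tab la k).1)
      && ((init_tab la (w k)).2.1 == (init_tab la k).2.1))]].

Definition m_ (la : mpart) : A :=
  (\prod_(s < r | (0 < s)%N)
     \prod_(k < (\sum_(s' < r | s' < s) comp_size la s')%N)
        (L k - (cyc_param s)%:A))
  * \sum_(w in row_stabilizer la) T_perm w.

Definition F_ (t : tableau) : A :=
  \prod_(k < n) \prod_(c <- residues k | c != res t k)
     ((res t k - c)^-1 *: (L k - c%:A)).

(* f_(s,t), for s and t standard of shape la *)
Definition f_ (la : mpart) (s t : tableau) : A :=
  F_ s * star (T_perm (tab_perm la s)) * m_ la * T_perm (tab_perm la t) * F_ t.

(* gamma gives the structure constants of the seminormal basis. *)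
Definition is_gamma (gamma : tableau -> K) : Prop :=
  (forall la t, is_mpart la -> is_std la t -> gamma t != 0) /\
  (forall la mu u v s t, is_mpart la -> is_mpart mu ->
     is_std la u -> is_std la v -> is_std mu s -> is_std mu t ->
     f_ la u v * f_ mu s t = if v == s then gamma s *: f_ la u t else 0).

End SeminormalBasis.

Definition P_factor (la : mpart) (k : nat) : K :=
  let a := blocks_size la (o_ la) in
  let rho := res (init_tab la) in
  let e := eps ^+ (k * o_ la) in
  \prod_(i < n | (i < a)%N) \prod_(j < n | (j < a)%N)
    ((q * rho j - e * rho i) * (rho j - q * e * rho i)
     / (rho j - e * rho i) ^+ 2).

Definition h_shape (la : mpart) : K :=
  let a := blocks_size la (o_ la) in
  let rho := res (init_tab la) in
  if odd (p_ la) then \prod_(1 <= k < ((p_ la).-1 %/ 2).+1) P_factor la k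
  else (\prod_(1 <= k < p_ la %/ 2) P_factor la k)
       * ((q + 1) ^+ a / 2%:R ^+ a)
       * \prod_(i < n | (i < a)%N) \prod_(j < n | (j < i)%N)
           ((q * rho j + rho i) * (rho j + q * rho i) / (rho j + rho i) ^+ 2).

Variable gamma : tableau -> K.

(* h_(la,0,l) *)
Definition h_zero (la : mpart) (l : nat) : K :=
  h_shape la ^+ l *
  \prod_(k < l)
    let u := tab_shift (k * o_ la) (init_tab la) in
    gamma (mid (mpart_shift (k * o_ la) la) (o_ la) u) / gamma u.

(* h_t^<l> and h_(t,x)^<l>, for t of shape la in the chosen transversal such
   that the smallest entry of t lies in the first o_la blocks *)
Definition h_rep (la : mpart) (t : tableau) (l : nat) : K :=
  h_zero la l * gamma (mid la (l * o_ la) t) / gamma t.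

Definition h_rep_shift (la : mpart) (t : tableau) (l x : nat) : K :=
  let u := tab_shift (l * o_ la) t in
  h_rep la t l * ((gamma t * gamma (mid (mpart_shift (l * o_ la) la) x u))
                  / (gamma (mid la x t) * gamma u)).

(* h_s^<l> for an arbitrary standard tableau s: write s = t<x> as above. *)
Definition h_tab (P : {set mpart}) (s : tableau) (l : nat) : K :=
  if [pick y : mpart * tableau * 'I_p |
        [&& y.1.1 \in P, is_std y.1.1 y.1.2, starts_early y.1.1 y.1.2
          & tab_shift y.2 y.1.2 == s]] is Some (la, t, x)
  then h_rep_shift la t l x else 0.

End Residues.

End Combinatorics.

(* Main.v *)
Require Import Defs.
From HB Require Import structures.
From mathcomp Require Import all_boot all_order all_fingroup all_algebra.
From mathcomp Require Import boolp.
From mathcomp Require Import zify ring.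

Set Implicit Arguments.
Unset Strict Implicit.
Unset Printing Implicit Defensive.

Import GRing.Theory.

(** The idea is to write gamma_t as a product over pairs of entries and to follow
    what a cyclic shift of the blocks does to the factors.

    Put g(x, y) = (q x - y) (x - q y) / (x - y)^2.  For a fixed shape la there
    is a nonzero kappa such that, for every standard t = t^la w, gamma_t is
    kappa times the product of g over the residues of the pairs inverted by w
    (gamma_formula).  This is read off from Young's seminormal form: a matrix
    representation in which every L_k acts on a standard permutation by the
    residue of the entry k (sn_rep), so that F_t becomes a projection and the
    (w, w) entry of f_tt ^ 2 = gamma_t f_tt can be computed.  It requires that
    q is not a root of unity of small order and that the parameters are
    separated.  Semisimplicity forces both: otherwise some module contains a
    nonzero vector m = z v that spans a submodule killed by z, and a
    semisimple algebra has no such module (semisimple_no_radical_vector,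
    poincare_neq0, parameter_prod_neq0).

    Now g is symmetric and homogeneous of degree 0, and a shift by z blocks
    multiplies the residues by a power of eps, hence preserves each factor.
    Split the inverted pairs of t into those with both entries on the same side
    of the block boundary z, with product S, and the others, with product C.
    Passing to mid_z(t) removes C.  Passing to t<z> keeps S and replaces C by
    the product D over the complementary set of pairs, and C D = N depends only
    on the shape (mid_std, Ginv_shift, CD_prod).  If la<z> = la, the quotient
    gamma_(t<z>) / gamma_t is therefore D / C = N / C ^ 2, and the claim for t
    amounts to N being the square of h_(la,0,l) when z = l o_la.

    For that, cut the blocks into p_la groups of o_la consecutive ones.
    Periodicity makes the product of g between the groups i < k equal to
    P_(k - i), and P_(p_la - k) = P_k.  The elements h_la were made so that
    h_la ^ 2 is the product of all P_k with 0 < k < p_la (h_shape_sq).  As N is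
    the product of the P_(k - i) with i < l <= k, counting differences gives
    h_la ^ (2 l) = N (prod_(i < k < l) P_(k - i)) ^ 2 (prod_triangle), and the
    quotients of gammas in h_(la,0,l) divide out exactly the last product
    (h_zero_sq).

    Finally, replacing t by t<x> changes both sides by the same square, which
    comes from C D = N for the boundary x (rep_ratio). *)

(** * Reduced words in the symmetric group *)

Arguments ord_pred : simpl never.

Section Perms.
Local Open Scope group_scope.
Variable n : nat.
Implicit Types (w : 'S_n) (i j k : 'I_n) (s : seq 'I_n).

Lemma val_ord_pred i : (0 < i)%N -> (ord_pred i : nat) = i.-1.
Proof.
case: i => k /= kn k0; have -> : ((k + n).-1 = k.-1 + n)%N by lia.
by rewrite modnDr modn_small //; lia.
Qed.

Lemma eq_ord_pred i k : (0 < i)%N -> (k == ord_pred i) = (k == i.-1 :> nat).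
Proof. by move=> i0; rewrite -(inj_eq val_inj) [X in _ == X]val_ord_pred. Qed.

Lemma simple_reflE i k : (0 < i)%N ->
  (simple_refl i k : nat) =
  (if k == i.-1 :> nat then i : nat else if k == i :> nat then i.-1 else k).
Proof.
move=> i0; rewrite /simple_refl; case: tpermP => [->|->|].
- by rewrite val_ord_pred // eqxx.
- by rewrite eqxx [LHS]val_ord_pred //; case: eqP => //; lia.
move=> /eqP; rewrite eq_ord_pred // => /negbTE->.
by move=> /eqP; rewrite -(inj_eq val_inj) => /negbTE->.
Qed.

Lemma simple_refl_cases i k : (0 < i)%N ->
  (k = i.-1 :> nat) /\ (simple_refl i k = i :> nat) \/
  (k = i :> nat) /\ (simple_refl i k = i.-1 :> nat) \/
  (k <> i.-1 :> nat) /\ (k <> i :> nat) /\ (simple_refl i k = k :> nat).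
Proof.
move=> i0; rewrite simple_reflE //; case: eqP => [h1|h1]; first by left.
by case: eqP => h2; right; [left|right].
Qed.

Lemma simple_refl_pred i : simple_refl i (ord_pred i) = i.
Proof. exact: tpermL. Qed.

Lemma simple_refl_self i : simple_refl i i = ord_pred i.
Proof. exact: tpermR. Qed.

Lemma simple_reflV i : (simple_refl i)^-1 = simple_refl i.
Proof. exact: tpermV. Qed.

Lemma simple_reflK i w : w * simple_refl i * simple_refl i = w.
Proof. by rewrite -mulgA tperm2 mulg1. Qed.

(** Its cardinal is the length of w. *)
Definition invset w : {set 'I_n * 'I_n} :=
  [set ij : 'I_n * 'I_n | (ij.1 < ij.2)%N && (w ij.2 < w ij.1)%N].

(** The exchange of the values i - 1 and i, that is, multiplication on the right by
    the reflection, lengthens w. *)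
Definition ascent w i : bool := (w^-1 (ord_pred i) < w^-1 i)%N.

Lemma in_invset w i j : ((i, j) \in invset w) = (i < j)%N && (w j < w i)%N.
Proof. by rewrite inE. Qed.

Lemma ascent_mul w i : (0 < i)%N -> ascent (w * simple_refl i) i = ~~ ascent w i.
Proof.
move=> i0; rewrite /ascent invMg simple_reflV !permM simple_refl_pred simple_refl_self.
rewrite -leqNgt [in RHS]leq_eqVlt; case: eqP => [E|//].
have {}E := perm_inj (val_inj E).
by have := val_ord_pred i0; rewrite -E; lia.
Qed.

(** The reflection permutes two adjacent values, so only the pair of positions where
    these values sit changes its status. *)
Lemma invset_ascent w i : (0 < i)%N -> ascent w i ->
  invset (w * simple_refl i) = (w^-1 (ord_pred i), w^-1 i) |: invset w.
Proof.
move=> i0 asc; apply/setP => -[a b]; rewrite in_setU1 !in_invset !permM.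
set A := w^-1 (ord_pred i); set B := w^-1 i.
have wA : w A = ord_pred i by rewrite permKV.
have wB : w B = i by rewrite permKV.
have HA c : (w c == i.-1 :> nat) = (c == A).
  by rewrite -(inj_eq (@perm_inj _ w)) wA eq_ord_pred.
have HB c : (w c == i :> nat) = (c == B).
  by rewrite -(inj_eq (@perm_inj _ w)) wB -(inj_eq val_inj).
rewrite !simple_reflE // xpair_eqE -/A -/B !HA !HB.
have AB : (A < B)%N by [].
have vA : (w A : nat) = i.-1 by rewrite wA val_ord_pred.
have vB : (w B : nat) = i by rewrite wB.
have nAB : (A == B) = false by apply/negbTE; rewrite -(inj_eq val_inj) ltn_eqF.
have HC c : c != A -> c != B -> (w c <> i.-1 :> nat) /\ (w c <> i :> nat).
  by rewrite -HA -HB => /eqP ? /eqP ?.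
have [->|bA] := eqVneq b A; have [->|aA] := eqVneq a A.
- by rewrite !ltnn nAB.
- rewrite vA; have [->|aB] := eqVneq a B; first by rewrite ltnNge ltnW.
  by have [] := HC a aA aB; rewrite /=; lia.
- rewrite vA; have [->|bB] := eqVneq b B; first by rewrite AB; lia.
  by have [] := HC b bA bB; rewrite /=; lia.
have [->|aB] := eqVneq a B; have [->|bB] := eqVneq b B; rewrite ?vB /=.
- by rewrite !ltnn.
- by have [] := HC b bA bB; lia.
- by have [] := HC a aA aB; lia.
by [].
Qed.

Lemma invset_notin w i : (0 < i)%N ->
  (w^-1 (ord_pred i), w^-1 i) \notin invset w.
Proof.
by move=> i0; rewrite in_invset !permKV val_ord_pred //; lia.
Qed.

Lemma perm_length_ascent w i : (0 < i)%N -> ascent w i ->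
  perm_length (w * simple_refl i) = (perm_length w).+1.
Proof.
move=> i0 asc; rewrite /perm_length -!/(invset _) invset_ascent //.
by rewrite cardsU1 invset_notin.
Qed.

Lemma perm_length_descent w i : (0 < i)%N -> ~~ ascent w i ->
  perm_length w = (perm_length (w * simple_refl i)).+1.
Proof.
move=> i0 dsc; rewrite -{1}(simple_reflK i w) perm_length_ascent //.
by rewrite ascent_mul.
Qed.

Lemma perm_length1 : perm_length (1 : 'S_n) = 0%N.
Proof.
apply/eqP; rewrite cards_eq0; apply/eqP/setP => -[i j]; rewrite !inE !perm1 /=.
by case: ltngtP.
Qed.

Lemma perm_lengthV w : perm_length w^-1 = perm_length w.
Proof.
rewrite /perm_length -!/(invset _).
have inj (v : 'S_n) : injective (fun ij : 'I_n * 'I_n => (v ij.2, v ij.1)).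
  by move=> [a b] [c e] /= [/perm_inj -> /perm_inj ->].
rewrite -(card_imset _ (inj w^-1)); congr #|pred_of_set _|.
apply/setP => -[a b]; apply/imsetP/idP.
  case=> -[c e]; rewrite !in_invset => /andP[h1 h2] [-> ->] /=.
  by rewrite !permKV h1 h2.
rewrite in_invset => /andP[h1 h2]; exists (w b, w a); rewrite ?in_invset /= ?permK ?h1 ?h2 //.
Qed.

Lemma perm_length_mulL_asc w i : (0 < i)%N -> (w (ord_pred i) < w i)%N ->
  perm_length (simple_refl i * w) = (perm_length w).+1.
Proof.
move=> i0 asc; rewrite -perm_lengthV invMg simple_reflV perm_length_ascent ?perm_lengthV //.
by rewrite /ascent invgK.
Qed.

Lemma perm_length_mulL_desc w i : (0 < i)%N -> (w i < w (ord_pred i))%N ->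
  perm_length w = (perm_length (simple_refl i * w)).+1.
Proof.
move=> i0 asc; rewrite -perm_lengthV (@perm_length_descent _ i) //.
  by rewrite -[in RHS]perm_lengthV invMg simple_reflV.
by rewrite /ascent invgK -leqNgt ltnW.
Qed.

Definition word_perm s : 'S_n := \prod_(i <- s) simple_refl i.

Lemma word_perm_rcons s i : word_perm (rcons s i) = word_perm s * simple_refl i.
Proof. by rewrite /word_perm -cats1 big_cat big_seq1. Qed.

Lemma perm_length_word s : all (fun i : 'I_n => 0 < i)%N s ->
  (perm_length (word_perm s) <= size s)%N.
Proof.
elim/last_ind: s => [|s i IH]; first by rewrite /word_perm big_nil perm_length1.
rewrite all_rcons size_rcons word_perm_rcons => /andP[i0 /IH le].
case: (boolP (ascent (word_perm s) i)) => h; first by rewrite perm_length_ascent.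
by have := perm_length_descent i0 h; lia.
Qed.

(** The length of a permutation is at most that of any word for it, so the last letter
    of a reduced word must be a descent. *)
Lemma reduced_rcons w s i : is_reduced_word w (rcons s i) ->
  [/\ (0 < i)%N, ~~ ascent w i & is_reduced_word (w * simple_refl i) s].
Proof.
case/and3P; rewrite all_rcons size_rcons => /andP[i0 s0] /eqP sz.
rewrite -/(word_perm _) word_perm_rcons => /eqP E.
have Ew : word_perm s = w * simple_refl i by rewrite -E simple_reflK.
have le := perm_length_word s0.
have na : ~~ ascent w i.
  by apply/negP => a; have := perm_length_ascent i0 a; rewrite -Ew; lia.
split=> //; apply/and3P; split=> //; last exact/eqP.
by have := perm_length_descent i0 na; lia.
Qed.

Lemma reduced_rconsI w s i : (0 < i)%N -> ~~ ascent w i ->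
  is_reduced_word (w * simple_refl i) s -> is_reduced_word w (rcons s i).
Proof.
move=> i0 na /and3P[s0 /eqP sz /eqP E]; apply/and3P; split.
- by rewrite all_rcons i0.
- by rewrite size_rcons sz -perm_length_descent.
by rewrite -/(word_perm _) word_perm_rcons /word_perm E simple_reflK.
Qed.

(** Then w^-1 is strictly increasing, so it lies above the identity pointwise, and
    both have the same sum of values. *)
Lemma all_ascents_id w : (forall i, (0 < i)%N -> ascent w i) -> w = 1.
Proof.
move=> asc; apply: invg_inj; rewrite invg1; set v := w^-1 in asc *.
have mono m : forall i, (i : nat) = m -> (m <= v i)%N.
  elim: m => [|m IH] i Ei //.
  have i0 : (0 < i)%N by rewrite Ei.
  have := asc _ i0; rewrite /ascent -/v.
  have /IH : (ord_pred i : nat) = m by rewrite [LHS]val_ord_pred // Ei.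
  exact: leq_ltn_trans.
have sum_eq : (\sum_i v i = \sum_(i < n) i)%N.
  by rewrite [RHS](reindex_inj (@perm_inj _ v)).
have lev i : (i <= v i)%N by exact: mono.
apply/permP => i; rewrite perm1; apply/val_inj/eqP; rewrite eq_sym.
have := leqif_sum (fun (k : 'I_n) (_ : true) => leqif_eq (lev k)).
by move=> [_]; rewrite sum_eq eqxx => /esym/forallP /(_ i).
Qed.

Lemma reduced_exists w : exists s, is_reduced_word w s.
Proof.
have [m] := ubnP (perm_length w); elim: m w => // m IH w; rewrite ltnS => le.
case: (boolP [forall i : 'I_n, (0 < i)%N ==> ascent w i]).
  move=> /forallP H; have -> : w = 1.
    by apply: all_ascents_id => i i0; exact: (implyP (H i)).
  exists [::]; apply/and3P; split; rewrite ?big_nil //=.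
  by rewrite perm_length1.
rewrite negb_forall => /existsP[i]; rewrite negb_imply => /andP[i0 na].
have := perm_length_descent i0 na => E.
have [s hs] : exists s, is_reduced_word (w * simple_refl i) s by apply: IH; lia.
by exists (rcons s i); apply: reduced_rconsI.
Qed.

Lemma reduced_wordP w : is_reduced_word w (reduced_word w).
Proof.
rewrite /reduced_word; case: pickP => [s //|no].
have [s hs] := reduced_exists w.
have /and3P[_ sz _] := hs.
by have := no (Tuple sz); rewrite /= hs.
Qed.

End Perms.

(** * Matsumoto's theorem *)

Section Matsumoto.
Variables (n : nat) (R : pzRingType) (T : nat -> R).
Local Open Scope ring_scope.
Hypothesis Tcomm : forall i j, (0 < i)%N -> (i.+1 < j < n)%N -> T i * T j = T j * T i.
Hypothesis Tbraid : forall i, (0 < i)%N -> (i.+1 < n)%N ->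
         T i * T i.+1 * T i = T i.+1 * T i * T i.+1.

Definition Tword (s : seq 'I_n) : R := \prod_(i <- s) T i.

Lemma Tword_rcons s i : Tword (rcons s i) = Tword s * T i.
Proof. by rewrite /Tword -cats1 big_cat big_seq1. Qed.

Lemma simple_refl_fix (i k : 'I_n) : (0 < i)%N ->
  (k <> i.-1 :> nat) -> (k <> i :> nat) -> simple_refl i k = k.
Proof. by move=> i0 h1 h2; apply/val_inj; have := simple_refl_cases k i0; rewrite /=; lia. Qed.

Lemma simple_refl_far (i j : 'I_n) : (0 < i)%N -> (i.+1 < j)%N ->
  (simple_refl i * simple_refl j = simple_refl j * simple_refl i)%g.
Proof.
move=> i0 ij; have j0 : (0 < j)%N by lia.
have vj := val_ord_pred j0.
rewrite [RHS]conjgC; congr (_ * _)%g.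
by rewrite [in RHS]/simple_refl tpermJ -!/(simple_refl _) !simple_refl_fix //; lia.
Qed.

Lemma simple_refl_braid (i j : 'I_n) : (0 < i)%N -> i.+1 = j ->
  (simple_refl i * simple_refl j * simple_refl i
   = simple_refl j * simple_refl i * simple_refl j)%g.
Proof.
move=> i0 ij; have j0 : (0 < j)%N by lia.
have vi : ord_pred j = i by apply/val_inj; rewrite [LHS]val_ord_pred // -ij.
have vp := val_ord_pred i0.
have conjE (a b : 'I_n) : (simple_refl a * simple_refl b * simple_refl a
    = tperm (simple_refl a (ord_pred b)) (simple_refl a b))%g.
  by rewrite -tpermJ /conjg simple_reflV mulgA.
rewrite !conjE vi simple_refl_self [simple_refl i j]simple_refl_fix //; try lia.
rewrite [simple_refl j (ord_pred i)]simple_refl_fix //; try lia.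
by have -> : simple_refl j i = j by rewrite -vi simple_refl_pred.
Qed.

Lemma ascent_mul_other (w : 'S_n) (i j : 'I_n) : (0 < i)%N -> (i.+1 < j)%N ->
  (ascent (w * simple_refl i)%g j = ascent w j) *
  (ascent (w * simple_refl j)%g i = ascent w i).
Proof.
move=> i0 ij; have j0 : (0 < j)%N by lia.
have vi := val_ord_pred i0; have vj := val_ord_pred j0.
by split; rewrite /ascent invMg simple_reflV !permM !simple_refl_fix //; lia.
Qed.

(** Induction on the length.  If the last letters i and j differ, both are descents
    of w, and w ends with the longest element of the subgroup that they generate;
    the two words are compared through two reduced words of w that share a prefix
    and end with the two sides of the defining relation of T_i and T_j. *)
Lemma matsumoto (w : 'S_n) s1 s2 : is_reduced_word w s1 -> is_reduced_word w s2 ->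
  Tword s1 = Tword s2.
Proof.
have [m] := ubnP (perm_length w); elim: m w s1 s2 => // m IH w s1 s2; rewrite ltnS => le.
have key (i j : 'I_n) t1 t2 : (i <= j)%N -> is_reduced_word w (rcons t1 i) ->
    is_reduced_word w (rcons t2 j) -> Tword (rcons t1 i) = Tword (rcons t2 j).
  move=> ij r1 r2.
  have [i0 ai r1'] := reduced_rcons r1; have [j0 aj r2'] := reduced_rcons r2.
  have Li := perm_length_descent i0 ai; have Lj := perm_length_descent j0 aj.
  have Mi : (perm_length (w * simple_refl i)%g < m)%N by rewrite -Li.
  have Mj : (perm_length (w * simple_refl j)%g < m)%N by rewrite -Lj.
  rewrite !Tword_rcons.
  have [Eij|nij] := eqVneq i j.
    by rewrite -Eij in r2' *; rewrite (IH _ t1 t2 Mi r1' r2').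
  have lij : (i < j)%N by rewrite ltn_neqAle ij andbT -val_eqE in nij *.
  have [far|near] := ltnP i.+1 j.
    set c := (w * simple_refl i * simple_refl j)%g.
    have [u hu] := reduced_exists c.
    have aij := ascent_mul_other w i0 far.
    have ru : is_reduced_word (w * simple_refl i)%g (rcons u j).
      by apply: reduced_rconsI => //; rewrite aij.
    have rv : is_reduced_word (w * simple_refl j)%g (rcons u i).
      by apply: reduced_rconsI => //; rewrite ?aij // -mulgA -simple_refl_far // mulgA.
    rewrite (IH _ _ _ Mi r1' ru).
    rewrite (IH _ _ _ Mj r2' rv).
    by rewrite !Tword_rcons -!mulrA (@Tcomm i j) // far ltn_ord.
  have Ej : i.+1 = j by lia.
  have vi : ord_pred j = i by apply/val_inj; rewrite [LHS]val_ord_pred // -Ej.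
  have [c1 c2 c3] : [/\ ~~ ascent (w * simple_refl i)%g j,
     ~~ ascent (w * simple_refl j)%g i & 
     ~~ ascent (w * simple_refl i * simple_refl j)%g i
     /\ ~~ ascent (w * simple_refl j * simple_refl i)%g j].
    move: ai aj; rewrite /ascent !invMg !simple_reflV !permM vi.
    have sij : simple_refl i j = j.
      by apply: simple_refl_fix => //; lia.
    have sji : simple_refl j (ord_pred i) = ord_pred i.
      by have := val_ord_pred i0 => vp; apply: simple_refl_fix => //; lia.
    have sj1 : simple_refl j i = j by rewrite -vi simple_refl_pred.
    have sj2 : simple_refl j j = i by rewrite simple_refl_self vi.
    rewrite !(sij, sji, sj1, sj2, simple_refl_pred, simple_refl_self) -!leqNgt => h1 h2.
    by split; [apply: leq_trans h2 h1|apply: leq_trans h2 h1|rewrite vi].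
  case: c3 => c3 c4.
  set c := (w * simple_refl i * simple_refl j * simple_refl i)%g.
  have Ec : c = (w * simple_refl j * simple_refl i * simple_refl j)%g.
    by have := simple_refl_braid i0 Ej => /(congr1 (mulg w)); rewrite !mulgA.
  have [u hu] := reduced_exists c.
  have ru : is_reduced_word (w * simple_refl i)%g (rcons (rcons u i) j).
    by do 2!apply: reduced_rconsI => //.
  have rv : is_reduced_word (w * simple_refl j)%g (rcons (rcons u j) i).
    by do 2!apply: reduced_rconsI => //; rewrite -Ec.
  rewrite (IH _ _ _ Mi r1' ru).
  rewrite (IH _ _ _ Mj r2' rv).
  rewrite !Tword_rcons -!mulrA; congr (_ * _).
  by rewrite !mulrA -Ej Tbraid // Ej.
move=> r1 r2; have [L0|L0] := eqVneq (perm_length w) 0%N.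
  have nil s : is_reduced_word w s -> s = [::].
    by case/and3P => _; rewrite L0 => /nilP.
  by rewrite (nil _ r1) (nil _ r2).
case/lastP: s1 r1 => [|t1 i] r1; first by case/and3P: r1 => _ /eqP /=; lia.
case/lastP: s2 r2 => [|t2 j] r2; first by case/and3P: r2 => _ /eqP /=; lia.
have [ij|ji] := leqP i j; first exact: key.
by apply/esym; apply: key => //; apply: ltnW.
Qed.

End Matsumoto.

(** * The elements T_w and Poincare polynomials of Young subgroups *)

Local Open Scope ring_scope.

Section HeckeTypeA.
Variables (n : nat) (K : fieldType) (q : K) (A : algType K) (T : nat -> A).
Hypothesis Tquad : forall i, (0 < i < n)%N -> (T i - q%:A) * (T i + 1) = 0.
Hypothesis Tcomm : forall i j, (0 < i)%N -> (i.+1 < j < n)%N -> T i * T j = T j * T i.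
Hypothesis Tbraid : forall i, (0 < i)%N -> (i.+1 < n)%N ->
         T i * T i.+1 * T i = T i.+1 * T i * T i.+1.

Lemma T_perm_reduced (w : 'S_n) s : is_reduced_word w s -> Tword T s = T_perm T w.
Proof. by move=> h; apply: (matsumoto Tcomm Tbraid h); apply: reduced_wordP. Qed.

(** Prefixing i to a reduced word of w gives a reduced word, and by the theorem of
    Matsumoto any reduced word may be used to compute T_w. *)
Lemma T_permL (w : 'S_n) (i : 'I_n) : (0 < i)%N -> (w (ord_pred i) < w i)%N ->
  T i * T_perm T w = T_perm T (simple_refl i * w)%g.
Proof.
move=> i0 up; have /and3P[s0 /eqP sz /eqP E] := reduced_wordP w.
have H : is_reduced_word (simple_refl i * w)%g (i :: reduced_word w).
  apply/and3P; split; rewrite /= ?i0 //; first by rewrite perm_length_mulL_asc // sz.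
  by rewrite big_cons E.
by rewrite -(T_perm_reduced H) /Tword big_cons.
Qed.

Lemma Tsq (i : nat) : (0 < i < n)%N -> T i * T i = (q - 1) *: T i + q%:A.
Proof.
move=> /Tquad; rewrite mulrBl !mulrDr !mulr1 mulr_algl => /eqP.
rewrite subr_eq0 => /eqP E; apply: (addIr (T i)).
by rewrite E scalerBl scale1r; rewrite addrAC subrK.
Qed.

(** The permutations of J come in pairs w, s_i w with w the shorter one, and
    T_i (T_w + T_(s_i w)) = q (T_w + T_(s_i w)) by the quadratic relation. *)
Lemma T_mul_sum (J : {set 'S_n}) (i : 'I_n) : (0 < i)%N ->
  (forall w, (simple_refl i * w)%g \in J = (w \in J)) ->
  T i * (\sum_(w in J) T_perm T w) = q *: \sum_(w in J) T_perm T w.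
Proof.
move=> i0 HJ; pose up (w : 'S_n) := (w (ord_pred i) < w i)%N.
have sK : involutive (fun v : 'S_n => simple_refl i * v)%g.
  by move=> v /=; rewrite mulgA tperm2 mul1g.
have upC w : up (simple_refl i * w)%g = ~~ up w.
  rewrite /up !permM simple_refl_pred simple_refl_self -leqNgt [in RHS]leq_eqVlt.
  case: (w i =P w (ord_pred i) :> nat) => [/val_inj /perm_inj E|//].
  by have := val_ord_pred i0; rewrite -E; lia.
have dn (F : 'S_n -> A) : \sum_(w in J | ~~ up w) F w
    = \sum_(w in J | up w) F (simple_refl i * w)%g.
  rewrite (reindex_inj (inv_inj sK)) /=; apply: eq_bigl => v.
  by rewrite HJ upC negbK.
rewrite mulr_sumr (bigID up) /= dn [in RHS](bigID up) /= dn -!big_split /=.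
rewrite scaler_sumr; apply: eq_bigr => w /andP[_ upw].
rewrite -(T_permL i0 upw) mulrA Tsq ?i0 ?ltn_ord //.
by rewrite mulrDl mulr_algl scalerDr -scalerAl scalerBl scale1r addrA addrCA subrr addr0 addrC.
Qed.

End HeckeTypeA.

Section Poincare.
Variables (K : fieldType) (q : K).

(** The quantum integer [m]_q. *)
Definition qint m : K := \sum_(j < m) q ^+ j.

(** A Young subgroup: c labels the blocks of the composition. *)
Definition young (n : nat) (c : 'I_n -> nat) : {set 'S_n} :=
  [set w : 'S_n | [forall k, c (w k) == c k]].

Definition poincare (n : nat) (J : {set 'S_n}) : K := \sum_(w in J) q ^+ perm_length w.

Lemma perm_length_sum n (w : 'S_n) :
  perm_length w = (\sum_(i < n) \sum_(k < n) ((i < k)%N && (w k < w i)%N))%N.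
Proof.
rewrite /perm_length -sum1_card pair_big /= big_mkcond /=.
by apply: eq_bigr => -[i k] _; rewrite inE /=; case: ifP.
Qed.

Lemma card_ord_lt n m : (m <= n)%N -> #|[pred k : 'I_n | (k < m)%N]| = m.
Proof. by move=> mn; rewrite -sum1_card (big_ord_narrow mn) sum1_card card_ord. Qed.

Lemma lift_lt n (j : 'I_n.+1) (a b : 'I_n) : (lift j a < lift j b)%N = (a < b)%N.
Proof. by rewrite !ltnNge leq_bump2. Qed.

(** The first value contributes j inversions, and the other positions those of s. *)
Lemma perm_length_lift n (j : 'I_n.+1) (s : 'S_n) :
  perm_length (lift_perm ord0 j s) = (j + perm_length s)%N.
Proof.
rewrite !perm_length_sum big_ord_recl; congr (_ + _)%N.
  rewrite big_ord_recl ltnn add0n lift_perm_id.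
  transitivity (\sum_(k < n) (s k < j))%N.
    apply: eq_bigr => k _; rewrite lift_perm_lift lift0 /=.
    by rewrite /bump; case: leqP => h; congr nat_of_bool; lia.
  rewrite -(reindex_inj (@perm_inj _ s) (op := addn) (P := predT)
    (F := fun k : 'I_n => nat_of_bool (k < j)%N)).
  rewrite -big_mkcond /= sum1_card.
  by apply: card_ord_lt; rewrite -ltnS.
apply: eq_bigr => i _; rewrite big_ord_recl /= add0n.
apply: eq_bigr => k _; rewrite !lift_perm_lift !lift_lt.
by [].
Qed.

Lemma lift_perm_bij n :
  bijective (fun js : 'I_n.+1 * 'S_n => lift_perm ord0 js.1 js.2).
Proof.
apply: inj_card_bij; last by rewrite card_prod card_ord !card_Sn factS.
move=> [j s] [j' s'] /= E.
have Ej : j = j' by have := lift_perm_id ord0 j s; rewrite E lift_perm_id.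
congr pair => //; apply/permP => k; apply: (@lift_inj _ j).
by rewrite -(lift_perm_lift ord0 j s) E Ej lift_perm_lift.
Qed.

(** A permutation is its first value j together with a permutation of the remaining
    positions; it preserves the blocks if and only if j lies in the first block, of
    size m, and the rest preserves the shortened blocks.  The sum over j of q ^ j
    is [m]_q. *)
Lemma poincare_young_rec n (c : 'I_n.+1 -> nat) :
  (forall i j : 'I_n.+1, (i <= j)%N -> (c i <= c j)%N) ->
  exists m, [/\ (0 < m <= n.+1)%N, (forall i : 'I_n.+1, (c i == c ord0) = (i < m)%N) &
  poincare (young c) = qint m * poincare (young (fun i => c (lift ord0 i)))].
Proof.
move=> cm; pose m := #|[pred i | c i == c ord0]|.
have m0 : (0 < m)%N by apply/card_gt0P; exists ord0; rewrite inE.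
have mn : (m <= n.+1)%N by rewrite -[X in (_ <= X)%N]card_ord max_card.
have Hm (i : 'I_n.+1) : (c i == c ord0) = (i < m)%N.
  apply/idP/idP => [/eqP ci|im].
    rewrite -(card_ord_lt (ltn_ord i)); apply: subset_leq_card.
    apply/subsetP => k; rewrite !inE ltnS => ki.
    by rewrite eqn_leq -{1}ci (cm _ _ ki) cm.
  apply/negPn/negP => nci; have : (m <= i)%N; last by lia.
  rewrite -(@card_ord_lt n.+1 i); last by apply: ltnW.
  apply: subset_leq_card; apply/subsetP => k; rewrite !inE => /eqP ck.
  rewrite ltnNge; apply/negP => ik; move/eqP: nci; apply.
  by apply/eqP; rewrite eqn_leq -{1}ck (cm _ _ ik) cm.
exists m; split=> //; first by rewrite m0.
rewrite /poincare (reindex _ (onW_bij _ (lift_perm_bij n))) /=.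
have cl (j : 'I_n.+1) (x : 'I_n) : (j < m)%N -> c (lift j x) = c (lift ord0 x).
  move=> jm; have [xj|jx] := ltnP x j; last first.
    by congr c; apply/val_inj; rewrite /= /bump jx.
  have [-> ->] // : c (lift j x) = c ord0 /\ c (lift ord0 x) = c ord0.
  by split; apply/eqP; rewrite Hm /= /bump; lia.
rewrite (eq_bigl (fun js : 'I_n.+1 * 'S_n =>
   (js.1 < m)%N && (js.2 \in young (fun i => c (lift ord0 i))))); last first.
  case=> j s /=; rewrite !inE.
  apply/forallP/andP => [H|[jm /forallP H] k].
    have cj : c j == c ord0 by have := H ord0; rewrite lift_perm_id.
    rewrite -Hm; split=> //; apply/forallP => k.
    by have := H (lift ord0 k); rewrite lift_perm_lift cl // -Hm.
  case: (unliftP ord0 k) => [k'|] ->; last by rewrite lift_perm_id Hm.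
  by rewrite lift_perm_lift cl.
rewrite -(pair_big (fun j : 'I_n.+1 => (j < m)%N)
  (fun s : 'S_n => s \in young (fun i => c (lift ord0 i)))
  (fun j s => q ^+ perm_length (lift_perm ord0 j s))) /=.
rewrite big_ord_narrow mulr_suml; apply: eq_bigr => j _.
by rewrite mulr_sumr; apply: eq_bigr => s _; rewrite perm_length_lift exprD.
Qed.

(** The Poincare polynomial of a Young subgroup is a product of quantum integers [k]
    with 0 < k <= n. *)
Lemma poincare_young_neq0 n (c : 'I_n -> nat) :
  (forall i j : 'I_n, (i <= j)%N -> (c i <= c j)%N) ->
  (forall m, (0 < m <= n)%N -> qint m != 0) -> poincare (young c) != 0.
Proof.
elim: n c => [|n IH] c cm qi.
  have E (w : 'S_0) : w = 1%g by apply/permP => -[].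
  rewrite /poincare (eq_bigl (pred1 1%g)) ?big_pred1_eq ?perm_length1 ?oner_eq0 //.
  by move=> w; rewrite (E w) !inE eqxx; apply/forallP => -[].
have [m [mn _ ->]] := poincare_young_rec cm.
rewrite mulf_neq0 //; first exact: qi.
apply: IH => [i j ij|k kn]; first by apply: cm; rewrite !lift0.
by apply: qi; lia.
Qed.

Lemma poincare_full n : poincare [set: 'S_n] = \prod_(m < n) qint m.+1.
Proof.
have young0 m : young (fun _ : 'I_m => 0%N) = [set: 'S_m].
  by apply/setP => w; rewrite !inE; apply/forallP.
elim: n => [|n IH].
  rewrite big_ord0 /poincare (eq_bigl (pred1 1%g)) ?big_pred1_eq ?perm_length1 //.
  by move=> w; rewrite inE; apply/esym/eqP/permP => -[].
rewrite big_ord_recr /= -IH -!young0.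
have [//|m [mn Hm ->]] := @poincare_young_rec n (fun _ => 0%N).
have nm : (n < m)%N by rewrite -(Hm ord_max).
have -> : m = n.+1 by lia.
by rewrite mulrC.
Qed.

End Poincare.

(** * Induction over the generators of the Hecke algebra *)

Section SubalgebraInduction.
Variables (K : fieldType) (A : algType K).

(** Bundled with its closure properties, so that the subtype below can depend on
    them in its algebra structure. *)
Record subalg_pred := SubalgPred {
  subalg_of :> A -> Prop;
  _ : subalg_of 1;
  _ : forall x y, subalg_of x -> subalg_of y -> subalg_of (x * y);
  _ : forall (a : K) x y, subalg_of x -> subalg_of y -> subalg_of (a *: x + y) }.

Variable P : subalg_pred.

Definition in_subalg : {pred A} := fun x => `[< P x >].

Lemma in_subalg_closed : subalg_closed in_subalg.
Proof.
split; first by apply/asboolP; case: P.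
  by move=> a u v /asboolP hu /asboolP hv; apply/asboolP; case: P hu hv => /= ? _ _; apply.
by move=> u v /asboolP hu /asboolP hv; apply/asboolP; case: P hu hv => /= ? _ + _; apply.
Qed.

HB.instance Definition _ := GRing.isSubalgClosed.Build K A in_subalg in_subalg_closed.

Record subalg := Subalg { subalg_val :> A; _ : in_subalg subalg_val }.
HB.instance Definition _ := [isSub for subalg_val].
HB.instance Definition _ := [Choice of subalg by <:].
HB.instance Definition _ := [SubChoice_isSubAlgebra of subalg by <:].

Definition subalg_incl (x : subalg) : A := val x.
Fact subalg_incl_linear : linear subalg_incl.
Proof. by []. Qed.
Fact subalg_incl_monoid : monoid_morphism subalg_incl.
Proof. by []. Qed.
HB.instance Definition _ := GRing.isLinear.Build K subalg A *:%R subalg_incl subalg_incl_linear.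
HB.instance Definition _ := GRing.isMonoidMorphism.Build subalg A subalg_incl subalg_incl_monoid.

Lemma subalg_inclP x : P (subalg_incl x).
Proof. by apply/asboolP; apply: (valP x). Qed.

End SubalgebraInduction.

(** The elements with property P form a subalgebra B that contains the generators.
    The universal property gives a morphism to B; composed with the inclusion it
    agrees with the identity on the generators, so B is everything. *)
Lemma hecke_ind p' d' n (K : fieldType) (q : K) (Q : 'I_d'.+1 -> K)
  (H : algType K) (T : nat -> H) (P : H -> Prop) : (1 < n)%N ->
  is_hecke_algebra p' n q Q T ->
  P 1 -> (forall x y, P x -> P y -> P (x * y)) ->
  (forall (a : K) x y, P x -> P y -> P (a *: x + y)) ->
  (forall i, (i < n)%N -> P (T i)) -> forall x, P x.
Proof.
move=> n1 [[R0 R01 Rq Rc Rb] ex un] P1 PM PL PT x.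
pose PP := SubalgPred P1 PM PL.
pose B : algType K := subalg PP.
pose iota : {lrmorphism B -> H} := @subalg_incl _ _ PP.
have inj : injective iota by exact: val_inj.
have [S iS] : exists S : nat -> B, forall i, (i < n)%N -> iota (S i) = T i.
  exists (fun i => if insub i is Some j then
   Subalg (introT (asboolP _) (PT (val (j : {i | (i < n)%N})) (valP j)) : in_subalg PP _) else 0).
  by move=> i lt_in; rewrite insubT.
have [phi phiT] : exists phi : {lrmorphism H -> B}, forall i, (i < n)%N -> phi (T i) = S i.
  apply: ex; split.
  - apply: inj; rewrite rmorph_prod rmorph0 -[RHS]R0; apply: eq_bigr => c _.
    by rewrite rmorphB rmorphXn /= iS ?(ltnW n1) // linearZ /= ?rmorph1.
  - by apply: inj; rewrite !rmorphM /= !iS ?(ltnW n1).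
  - move=> i hi; have /andP[_ lt_i] := hi; apply: inj.
    rewrite rmorphM rmorphB rmorphD rmorph1 rmorph0 linearZ /= ?rmorph1 iS //.
    by rewrite scalerN; exact: Rq.
  - move=> i j hij; apply: inj; rewrite !rmorphM /= !iS; [exact: Rc|lia..].
  - by move=> i i0 hi; apply: inj; rewrite !rmorphM /= !iS; [exact: Rb|lia..].
have E : iota \o phi =1 (idfun : H -> H).
  by apply: un => i hi; rewrite /= phiT // iS.
by have := subalg_inclP (phi x); rewrite -[subalg_incl _]/((iota \o phi) x) E.
Qed.

(** * Representations by local operators *)

Section IndexedMatrices.
Variables (K : fieldType) (X : finType) (x0 : X).

(** Only matrices of size k.+1 form a nontrivial ring. *)
Definition mxdim : nat := #|X|.-1.

Lemma mxdimE : #|X| = mxdim.+1.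
Proof. by rewrite /mxdim prednK //; apply/card_gt0P; exists x0. Qed.

Definition enc (x : X) : 'I_mxdim.+1 := cast_ord mxdimE (enum_rank x).
Definition dec (i : 'I_mxdim.+1) : X := enum_val (cast_ord (esym mxdimE) i).

Lemma encK : cancel enc dec.
Proof. by move=> x; rewrite /dec /enc cast_ordK enum_rankK. Qed.

Lemma decK : cancel dec enc.
Proof. by move=> i; rewrite /dec /enc enum_valK cast_ordKV. Qed.

Lemma mxX_ext p (A B : 'M[K]_(mxdim.+1, p)) :
  (forall x j, A (enc x) j = B (enc x) j) -> A = B.
Proof. by move=> E; apply/matrixP => i j; rewrite -(decK i). Qed.

Lemma sum_enc (F : 'I_mxdim.+1 -> K) : \sum_i F i = \sum_x F (enc x).
Proof. by rewrite (reindex enc) //; exists dec => ? _; rewrite ?encK ?decK. Qed.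

Variables (a b : X -> K) (s : X -> X).

(** The matrix of a local operator, which computes the new value at x from the values
    at x and s x only; op is the same operator on functions. *)
Definition opmx : 'M[K]_mxdim.+1 :=
  \matrix_(i, j) (a (dec i) *+ (i == j) + b (dec i) *+ (enc (s (dec i)) == j)).

Definition op (f : X -> K) (x : X) : K := a x * f x + b x * f (s x).

Lemma opmxM p (A : 'M[K]_(mxdim.+1, p)) x j :
  (opmx *m A) (enc x) j = op (fun y => A (enc y) j) x.
Proof.
rewrite mxE /op; under eq_bigr => k _ do rewrite mxE encK mulrDl !mulrnAl.
rewrite big_split /=; congr (_ + _).
  rewrite (bigD1 (enc x)) //= eqxx big1 ?addr0 // => k /negbTE.
  by rewrite eq_sym => ->.
rewrite (bigD1 (enc (s x))) //= eqxx big1 ?addr0 // => k /negbTE.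
by rewrite eq_sym => ->.
Qed.

Lemma opmxE x y : opmx (enc x) (enc y) = a x *+ (x == y) + b x *+ (s x == y).
Proof. by rewrite mxE encK !(inj_eq (can_inj encK)). Qed.

Lemma Mopmx p (A : 'M[K]_(p, mxdim.+1)) i y : involutive s ->
  (A *m opmx) i (enc y) = A i (enc y) * a y + A i (enc (s y)) * b (s y).
Proof.
move=> sK; rewrite mxE sum_enc.
under eq_bigr => x _ do rewrite opmxE mulrDr !mulrnAr.
rewrite big_split /=; congr (_ + _).
  by rewrite (bigD1 y) //= eqxx big1 ?addr0 // => k /negbTE ->.
rewrite (bigD1 (s y)) //= sK eqxx big1 ?addr0 // => k /negbTE.
by rewrite (canF_eq sK) => ->.
Qed.

End IndexedMatrices.

Section LocalOperators.
Variables (K : fieldType) (X : finType) (L : Type).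

(** The two sides are combinations of the six values of f on the orbit of x under
    the group generated by s1 and s2.  Comparing coefficients leaves the three
    stated identities. *)
Lemma op_braid (r0 r1 r2 : X -> L) (s1 s2 : X -> X) (al be : L -> L -> K)
  (f : X -> K) (x : X) :
  involutive s1 -> involutive s2 -> s1 (s2 (s1 x)) = s2 (s1 (s2 x)) ->
  (forall y, [/\ r0 (s1 y) = r1 y, r1 (s1 y) = r0 y & r2 (s1 y) = r2 y]) ->
  (forall y, [/\ r0 (s2 y) = r0 y, r1 (s2 y) = r2 y & r2 (s2 y) = r1 y]) ->
  let A := r0 x in let B := r1 x in let C := r2 x in
  al A B ^+ 2 * al B C + be A B * be B A * al A C
    = al B C ^+ 2 * al A B + be B C * be C B * al A C ->
  be A B * (al A B * al B C + al A C * al B A - al B C * al A C) = 0 ->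
  be B C * (al B C * al A B + al A C * al C B - al A B * al A C) = 0 ->
  let O1 := op (fun y => al (r0 y) (r1 y)) (fun y => be (r0 y) (r1 y)) s1 in
  let O2 := op (fun y => al (r1 y) (r2 y)) (fun y => be (r1 y) (r2 y)) s2 in
  O1 (O2 (O1 f)) x = O2 (O1 (O2 f)) x.
Proof.
move=> s1K s2K sb r_1 r_2 A B C c1 c2 c3 O1 O2; rewrite /O1 /O2 /op.
have [r01 r11 r21] : [/\ forall y, r0 (s1 y) = r1 y, forall y, r1 (s1 y) = r0 y & forall y, r2 (s1 y) = r2 y].
  by split=> y; case: (r_1 y).
have [r02 r12 r22] : [/\ forall y, r0 (s2 y) = r0 y, forall y, r1 (s2 y) = r2 y & forall y, r2 (s2 y) = r1 y].
  by split=> y; case: (r_2 y).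
rewrite !(r01, r11, r21, r02, r12, r22, s1K, s2K) sb.
move: @A @B @C c1 c2 c3 => /=; move: (r0 x) (r1 x) (r2 x) => A B C c1 c2 c3.
move: (f x) (f (s1 x)) (f (s2 x)) (f (s1 (s2 x))) (f (s2 (s1 x))) (f (s2 (s1 (s2 x)))) => f1 f2 f3 f4 f5 f6.
apply/eqP; rewrite -subr_eq0; apply/eqP.
transitivity (f1 * ((al A B ^+ 2 * al B C + be A B * be B A * al A C)
   - (al B C ^+ 2 * al A B + be B C * be C B * al A C))
   + f2 * (be A B * (al A B * al B C + al A C * al B A - al B C * al A C))
   - f3 * (be B C * (al B C * al A B + al A C * al C B - al A B * al A C))).
  by ring.
by rewrite c1 c2 c3; ring.
Qed.

End LocalOperators.

Section LocalRepresentation.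
Variables (n : nat) (K : fieldType) (q : K) (X : finType) (x0 : X) (std : pred X).
Variables (L : Type) (r : 'I_n -> X -> L) (sg : 'I_n -> X -> X) (al be : L -> L -> K).
Hypothesis sgK : forall i, involutive (sg i).
Hypothesis sg_far : forall (i j : 'I_n) x, (0 < i)%N -> (i.+1 < j)%N ->
  sg i (sg j x) = sg j (sg i x).
Hypothesis sg_braid : forall (i j : 'I_n) x, (0 < i)%N -> i.+1 = j ->
  sg i (sg j (sg i x)) = sg j (sg i (sg j x)).
Hypothesis r_sg : forall i k x, r k (sg i x) = r (simple_refl i k) x.

(** Here r k x is the label at the place k of x, and the operator of s_i acts on x
    through the labels at the places i - 1 and i.  At the points that are not
    standard it is the scalar q, an eigenvalue allowed by the quadratic relation. *)
Definition loc_a i x := if std x then al (r (ord_pred i) x) (r i x) else q.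
Definition loc_b i x := if std x then be (r (ord_pred i) x) (r i x) else 0.
Definition locmx i := opmx x0 (loc_a i) (loc_b i) (sg i).

Hypothesis std_sg : forall (i : 'I_n) x, (0 < i)%N -> std x -> ~~ std (sg i x) ->
  be (r (ord_pred i) x) (r i x) = 0.
Hypothesis quad_al : forall (i : 'I_n) x, (0 < i)%N -> std x ->
  let A := r (ord_pred i) x in let B := r i x in
  al A B ^+ 2 + be A B * be B A = (q - 1) * al A B + q
  /\ be A B * (al A B + al B A - (q - 1)) = 0.
Hypothesis braid_al : forall (i j : 'I_n) x, (0 < i)%N -> i.+1 = j -> std x ->
  let A := r (ord_pred i) x in let B := r i x in let C := r j x in
  [/\ al A B ^+ 2 * al B C + be A B * be B A * al A C
    = al B C ^+ 2 * al A B + be B C * be C B * al A C,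
  be A B * (al A B * al B C + al A C * al B A - al B C * al A C) = 0 &
  be B C * (al B C * al A B + al A C * al C B - al A B * al A C) = 0].

Let gen_op (i : 'I_n) := op (fun y => al (r (ord_pred i) y) (r i y))
  (fun y => be (r (ord_pred i) y) (r i y)) (sg i).

(** At standard points the value only depends on the values at standard points: the
    coefficient vanishes whenever sg i leads out of them. *)
Lemma loc_op_std (i : 'I_n) (f g : X -> K) x : (0 < i)%N -> std x ->
  (forall y, std y -> f y = g y) ->
  op (loc_a i) (loc_b i) (sg i) f x = gen_op i g x.
Proof.
move=> i0 sx fg; rewrite /op /gen_op /op /loc_a /loc_b sx fg //; congr (_ + _).
by have [sy|nsy] := boolP (std (sg i x)); [rewrite fg | rewrite std_sg ?mul0r].
Qed.

Lemma loc_op_nstd (i : 'I_n) (f : X -> K) x : ~~ std x ->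
  op (loc_a i) (loc_b i) (sg i) f x = q * f x.
Proof. by move=> /negbTE sx; rewrite /op /loc_a /loc_b sx mul0r addr0. Qed.

Lemma locmxM p (i : 'I_n) (A : 'M[K]_(_, p)) x j :
  (locmx i *m A) (enc x0 x) j = op (loc_a i) (loc_b i) (sg i) (fun y => A (enc x0 y) j) x.
Proof. exact: opmxM. Qed.

Lemma locmxMr (i : 'I_n) (A : 'M[K]_((mxdim X).+1)) x j :
  (locmx i * A) (enc x0 x) j = op (loc_a i) (loc_b i) (sg i) (fun y => A (enc x0 y) j) x.
Proof. exact: opmxM. Qed.

Lemma locmxE (i : 'I_n) x j :
  locmx i (enc x0 x) j = op (loc_a i) (loc_b i) (sg i) (fun y => 1%:M (enc x0 y) j) x.
Proof. by rewrite -[locmx i]mulmx1 locmxM. Qed.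

Lemma locmx_sq (i : 'I_n) : (0 < i)%N -> locmx i * locmx i = (q - 1) *: locmx i + q%:A.
Proof.
move=> i0; apply: (mxX_ext (x0 := x0)) => x j; rewrite locmxMr.
have -> : ((q - 1) *: locmx i + q%:A) (enc x0 x) j =
    (q - 1) * locmx i (enc x0 x) j + q * (1%:M : 'M[K]_((mxdim X).+1)) (enc x0 x) j.
  by rewrite [LHS]mxE; congr (_ + _); rewrite [LHS]mxE.
have [sx|nsx] := boolP (std x); last by rewrite !loc_op_nstd // locmxE loc_op_nstd //; ring.
have E y : std y -> locmx i (enc x0 y) j = gen_op i (fun y => 1%:M (enc x0 y) j) y.
  by move=> sy; rewrite locmxE; apply: loc_op_std.
rewrite (loc_op_std i0 sx E) (E x sx).
rewrite /gen_op /op !r_sg simple_refl_self simple_refl_pred sgK.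
have /= [] := quad_al i0 sx.
set a := al _ _; set b := be _ _; set a' := al _ _; set b' := be _ _.
move: (1%:M _ _) (1%:M _ _) => f2 f1 c1 c2.
apply/eqP; rewrite -subr_eq0; apply/eqP.
transitivity (f1 * ((a ^+ 2 + b * b') - ((q - 1) * a + q)) + f2 * (b * (a + a' - (q - 1)))).
  by ring.
by rewrite c1 c2; ring.
Qed.

Lemma locmx_quad (i : 'I_n) : (0 < i)%N -> (locmx i - q%:A) * (locmx i + 1) = 0.
Proof.
move=> i0; rewrite mulrBl !mulrDr !mulr1 mulr_algl locmx_sq // scalerBl scale1r.
by rewrite [X in X - _]addrAC subrK subrr.
Qed.

Lemma op_comm (a1 b1 a2 b2 : X -> K) s1 s2 (f : X -> K) x :
  s1 (s2 x) = s2 (s1 x) -> a1 (s2 x) = a1 x -> b1 (s2 x) = b1 x ->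
  a2 (s1 x) = a2 x -> b2 (s1 x) = b2 x ->
  op a1 b1 s1 (op a2 b2 s2 f) x = op a2 b2 s2 (op a1 b1 s1 f) x.
Proof. by move=> E E1 E2 E3 E4; rewrite /op E1 E2 E3 E4 E; ring. Qed.

Lemma locmx_braid (i j : 'I_n) : (0 < i)%N -> i.+1 = j ->
  locmx i * locmx j * locmx i = locmx j * locmx i * locmx j.
Proof.
move=> i0 ij; have j0 : (0 < j)%N by rewrite -ij.
have vi : ord_pred j = i by apply/val_inj; rewrite [LHS]val_ord_pred // -ij.
have vp := val_ord_pred i0.
apply: (mxX_ext (x0 := x0)) => x k; rewrite -!mulrA !locmxMr.
have [sx|nsx] := boolP (std x); last first.
  by rewrite !loc_op_nstd // !locmxMr !loc_op_nstd // !locmxE !loc_op_nstd.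
pose f y : K := 1%:M (enc x0 y) k.
have E1 (l : 'I_n) y : (0 < l)%N -> std y -> locmx l (enc x0 y) k = gen_op l f y.
  by move=> l0 sy; rewrite locmxE; apply: loc_op_std.
have E2 (l m : 'I_n) y : (0 < l)%N -> (0 < m)%N -> std y ->
    (locmx l * locmx m) (enc x0 y) k = gen_op l (gen_op m f) y.
  by move=> l0 m0 sy; rewrite locmxMr; apply: loc_op_std => // z sz; apply: E1.
rewrite (loc_op_std i0 sx (fun y => E2 j i y j0 i0)) (loc_op_std j0 sx (fun y => E2 i j y i0 j0)).
have [c1 c2 c3] := braid_al i0 ij sx.
rewrite /gen_op vi; apply: op_braid => //.
- exact: sg_braid.
- move=> y; rewrite !r_sg simple_refl_pred simple_refl_self simple_refl_fix //; lia.
- move=> y; rewrite !r_sg simple_refl_self simple_refl_fix ?vp //; try lia.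
  have -> : simple_refl j i = j by rewrite -vi simple_refl_pred.
  by rewrite vi.
Qed.

Lemma locmx_far_comm (i j : 'I_n) : (0 < i)%N -> (i.+1 < j)%N ->
  locmx i * locmx j = locmx j * locmx i.
Proof.
move=> i0 ij; have j0 : (0 < j)%N by lia.
apply: (mxX_ext (x0 := x0)) => x k; rewrite !locmxMr.
have [sx|nsx] := boolP (std x); last first.
  by rewrite !loc_op_nstd // !locmxE !loc_op_nstd //; ring.
pose f y : K := 1%:M (enc x0 y) k.
have E1 (l : 'I_n) y : (0 < l)%N -> std y -> locmx l (enc x0 y) k = gen_op l f y.
  by move=> l0 sy; rewrite locmxE; apply: loc_op_std.
rewrite (loc_op_std i0 sx (fun y => E1 j y j0)) (loc_op_std j0 sx (fun y => E1 i y i0)).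
have vj := val_ord_pred j0; have vi := val_ord_pred i0.
by apply: op_comm; [exact: sg_far|rewrite !r_sg !simple_refl_fix //; lia..].
Qed.

End LocalRepresentation.

(** * Consequences of semisimplicity, and the tensor space *)

Section SemisimpleModules.
Variables (K : fieldType) (H : algType K) (N : nat) (rho : {lrmorphism H -> 'M[K]_N.+1}).

Lemma lrmorph_mulmx p x y (v : 'M[K]_(N.+1, p)) : rho (x * y) *m v = rho x *m (rho y *m v).
Proof. by rewrite rmorphM mulmxA. Qed.

Lemma mulmx_lrmorph p x y (v : 'M[K]_(p, N.+1)) : v *m rho (x * y) = v *m rho x *m rho y.
Proof. by rewrite rmorphM -mulmxA. Qed.

(** Let I be the left ideal of all h with h v in the line of m, and J a complement;
    write 1 = e + f accordingly.  Then z lies in I, so z f lies in both I and J and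
    vanishes.  Hence m = z v = z e v, which is a multiple of z m = 0. *)
Lemma semisimple_no_radical_vector (v m : 'cV[K]_N.+1) (z : H) :
  semisimple_ring H ->
  (forall h, exists c : K, rho h *m m = c *: m) ->
  rho z *m v = m -> rho z *m m = 0 -> m = 0.
Proof.
move=> ss mK zv zm.
pose I h := exists c : K, rho h *m v = c *: m.
have [J [[J0 JD JM] IJ dec]] : exists J, [/\ left_ideal J, (forall x, I x -> J x -> x = 0)
      & (forall x, exists y w, [/\ I y, J w & x = y + w])].
  apply: ss; split.
  - by exists 0; rewrite rmorph0 mul0mx scale0r.
  - move=> x y [c xc] [e ye]; exists (c + e).
    by rewrite rmorphD mulmxDl xc ye scalerDl.
  - move=> a x [c xc]; have [e ae] := mK a; exists (c * e).
    by rewrite rmorphM -mulmxE -mulmxA xc -scalemxAr ae scalerA.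
have [e [f [[c ec] Jf E1]]] := dec 1.
have Iz : I z by exists 1; rewrite scale1r.
have zf : z * f = 0.
  apply: IJ; last exact: JM.
  exists (1 - 0); rewrite (_ : z * f = z - z * e); last first.
    by rewrite -{2}[z]mulr1 E1 mulrDr addrC addKr.
  rewrite rmorphB rmorphM mulmxBl -mulmxE -mulmxA ec -scalemxAr zm scaler0 subr0.
  by rewrite zv subr0 scale1r.
rewrite -zv -[z]mulr1 E1 mulrDr zf addr0 rmorphM -mulmxE -mulmxA ec.
by rewrite -scalemxAr zm scaler0.
Qed.

End SemisimpleModules.

Section LocalHecke.
Variables (p' d' n : nat) (K : fieldType) (q : K) (Q : 'I_d'.+1 -> K) (N : nat).
Variables (T0 : 'M[K]_N.+1) (M : 'I_n -> 'M[K]_N.+1).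

(** Index 0 stands for T_0; the matrices M are indexed from 1. *)
Definition extend_gens (i : nat) : 'M[K]_N.+1 :=
  if i is 0 then T0 else oapp M 0 (insub i).

Lemma extend_gensE (i : 'I_n) : (0 < i)%N -> extend_gens i = M i.
Proof.
move=> i0; rewrite /extend_gens; have := valK i; rewrite /=.
by case: (nat_of_ord i) i0 => // k _ ->.
Qed.

Hypothesis n1 : (1 < n)%N.
Hypothesis T0_root : \prod_(c < d'.+1) (T0 ^+ p'.+1 - (Q c ^+ p'.+1)%:A) = 0.
Hypothesis T0_far : forall i : 'I_n, (1 < i)%N -> T0 * M i = M i * T0.
Hypothesis T0_M1 : forall i : 'I_n, i = 1%N :> nat ->
  T0 * M i * T0 * M i = M i * T0 * M i * T0.
Hypothesis M_quad : forall i : 'I_n, (0 < i)%N -> (M i - q%:A) * (M i + 1) = 0.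
Hypothesis M_far : forall i j : 'I_n, (0 < i)%N -> (i.+1 < j)%N -> M i * M j = M j * M i.
Hypothesis M_braid : forall i j : 'I_n, (0 < i)%N -> i.+1 = j ->
  M i * M j * M i = M j * M i * M j.

Lemma extend_gens_hecke : hecke_relations p' n q Q extend_gens.
Proof.
split=> //.
- by rewrite (extend_gensE (i := Ordinal n1)) //; apply: T0_M1.
- by move=> i /andP[i0 hi]; rewrite (extend_gensE (i := Ordinal hi)) //; apply: M_quad.
- move=> i j /andP[ij jn].
  rewrite (extend_gensE (i := Ordinal jn)); last by rewrite /=; lia.
  case: (posnP i) => [i0|i0].
    by rewrite i0 in ij *; apply: T0_far.
  have hi : (i < n)%N by lia.
  by rewrite (extend_gensE (i := Ordinal hi)) //; apply: M_far.
move=> i i0 hi; rewrite (extend_gensE (i := Ordinal hi)) //.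
have hi' : (i < n)%N by lia.
by rewrite (extend_gensE (i := Ordinal hi')) //; apply: M_braid.
Qed.

End LocalHecke.

Section TensorSpace.
Variables (n m : nat) (K : fieldType) (q : K).
Hypothesis n1 : (1 < n)%N.

(** Words of length n in m.+1 letters, the standard basis of the tensor space. *)
Definition word := {ffun 'I_n -> 'I_m.+1}.
Implicit Types (x : word) (i j : 'I_n).

Definition letter (k : 'I_n) (x : word) : nat := x k.
Definition word_refl i x : word := [ffun k => x (simple_refl i k)].
(** The action of Jimbo on a tensor space, normalized so that no square root of q
    is needed. *)
Definition ts_a (A B : nat) : K := if (A < B)%N then 0 else if A == B then q else q - 1.
Definition ts_b (A B : nat) : K := if (A < B)%N then q else if A == B then 0 else 1.
Definition word0 : word := [ffun => ord0].

Definition tsmx i := locmx q word0 predT letter word_refl ts_a ts_b i.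

Lemma word_reflK i : involutive (word_refl i).
Proof. by move=> x; apply/ffunP => k; rewrite !ffunE -permM tperm2 perm1. Qed.

Lemma word_refl_far (i j : 'I_n) x : (0 < i)%N -> (i.+1 < j)%N ->
  word_refl i (word_refl j x) = word_refl j (word_refl i x).
Proof.
move=> i0 ij; apply/ffunP => k; rewrite !ffunE; congr (x _).
by rewrite -!permM simple_refl_far.
Qed.

Lemma word_refl_braid (i j : 'I_n) x : (0 < i)%N -> i.+1 = j ->
  word_refl i (word_refl j (word_refl i x)) = word_refl j (word_refl i (word_refl j x)).
Proof.
move=> i0 ij; apply/ffunP => k; rewrite !ffunE; congr (x _).
by rewrite -!permM mulgA simple_refl_braid // mulgA.
Qed.

Lemma letter_refl i k x : letter k (word_refl i x) = letter (simple_refl i k) x.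
Proof. by rewrite /letter ffunE. Qed.

Lemma ts_quad (A B : nat) :
  ts_a A B ^+ 2 + ts_b A B * ts_b B A = (q - 1) * ts_a A B + q
  /\ ts_b A B * (ts_a A B + ts_a B A - (q - 1)) = 0.
Proof. by rewrite /ts_a /ts_b; case: (ltngtP A B) => h; split; ring. Qed.

Lemma ts_braid (A B C : nat) :
  [/\ ts_a A B ^+ 2 * ts_a B C + ts_b A B * ts_b B A * ts_a A C
    = ts_a B C ^+ 2 * ts_a A B + ts_b B C * ts_b C B * ts_a A C,
  ts_b A B * (ts_a A B * ts_a B C + ts_a A C * ts_a B A - ts_a B C * ts_a A C) = 0 &
  ts_b B C * (ts_a B C * ts_a A B + ts_a A C * ts_a C B - ts_a A B * ts_a A C) = 0].
Proof.
rewrite /ts_a /ts_b.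
case: (ltngtP A B) => h1; case: (ltngtP B C) => h2; case: (ltngtP A C) => h3;
  try (by exfalso; lia); split; ring.
Qed.

Lemma tsmx_quad i : (0 < i)%N -> (tsmx i - q%:A) * (tsmx i + 1) = 0.
Proof.
move=> i0; apply: locmx_quad => //; first exact: word_reflK.
- exact: letter_refl.
- by move=> j x _ _; apply: ts_quad.
Qed.

Lemma tsmx_far i j : (0 < i)%N -> (i.+1 < j)%N -> tsmx i * tsmx j = tsmx j * tsmx i.
Proof.
move=> i0 ij; apply: locmx_far_comm => //; first exact: word_refl_far.
exact: letter_refl.
Qed.

Lemma tsmx_braid i j : (0 < i)%N -> i.+1 = j ->
  tsmx i * tsmx j * tsmx i = tsmx j * tsmx i * tsmx j.
Proof.
move=> i0 ij; apply: locmx_braid => //.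
- exact: word_reflK.
- exact: word_refl_braid.
- exact: letter_refl.
- by move=> *; apply: ts_braid.
Qed.

End TensorSpace.

(** * Quantum integers do not vanish *)

(** Induction on the length, peeling off simple reflections on the left. *)
Lemma perm_indL n (P : 'S_n -> Prop) : P 1%g ->
  (forall (w : 'S_n) (i : 'I_n), (0 < i)%N -> (w (ord_pred i) < w i)%N -> P w ->
     P (simple_refl i * w)%g) -> forall w, P w.
Proof.
move=> P1 PS w; have [m] := ubnP (perm_length w); elim: m w => // m IH w; rewrite ltnS => le.
case: (boolP [forall i : 'I_n, (0 < i)%N ==> (w (ord_pred i) < w i)%N]).
  move=> /forallP asc; have -> // : w = 1%g.
  apply: invg_inj; rewrite invg1; apply: all_ascents_id => i i0.
  by rewrite /ascent invgK; apply: (implyP (asc i)).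
rewrite negb_forall => /existsP[i]; rewrite negb_imply -leqNgt => /andP[i0 dsc].
have lt : (w i < w (ord_pred i))%N.
  rewrite ltn_neqAle dsc andbT; apply/eqP => /val_inj /perm_inj E.
  by have := val_ord_pred i0; rewrite -E; lia.
have -> : w = (simple_refl i * (simple_refl i * w))%g by rewrite mulgA tperm2 mul1g.
apply: PS => //; first by rewrite !permM simple_refl_pred simple_refl_self.
by apply: IH; have := perm_length_mulL_desc i0 lt; lia.
Qed.

Lemma T_perm1 n (K : fieldType) (A : algType K) (T : nat -> A) : T_perm T (1%g : 'S_n) = 1.
Proof.
have /and3P[_ /eqP sz _] := reduced_wordP (1%g : 'S_n).
rewrite perm_length1 in sz.
by rewrite /T_perm; case: (reduced_word _) sz => // _; rewrite big_nil.
Qed.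

Section HeckeRelationsTypeA.
Variables (p' d' n : nat) (K : fieldType) (q : K) (Q : 'I_d'.+1 -> K).
Variables (H : algType K) (T : nat -> H).
Hypothesis rel : hecke_relations p' n q Q T.

Lemma hecke_quad i : (0 < i < n)%N -> (T i - q%:A) * (T i + 1) = 0.
Proof. by case: rel => _ _ h _ _; apply: h. Qed.

Lemma hecke_far i j : (0 < i)%N -> (i.+1 < j < n)%N -> T i * T j = T j * T i.
Proof. by case: rel => _ _ _ h _ _; apply: h. Qed.

Lemma hecke_braid i : (0 < i)%N -> (i.+1 < n)%N -> T i * T i.+1 * T i = T i.+1 * T i * T i.+1.
Proof. by case: rel => _ _ _ _ h; apply: h. Qed.

Lemma hecke_T_permL (w : 'S_n) (i : 'I_n) : (0 < i)%N -> (w (ord_pred i) < w i)%N ->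
  T i * T_perm T w = T_perm T (simple_refl i * w)%g.
Proof. exact: (T_permL hecke_far hecke_braid). Qed.

Lemma hecke_T_mul_sum (J : {set 'S_n}) (i : 'I_n) : (0 < i)%N ->
  (forall w, (simple_refl i * w)%g \in J = (w \in J)) ->
  T i * (\sum_(w in J) T_perm T w) = q *: \sum_(w in J) T_perm T w.
Proof. exact: (T_mul_sum hecke_quad hecke_far hecke_braid). Qed.

End HeckeRelationsTypeA.

Section QuantumIntegers.
Variables (p' d' n : nat) (K : fieldType) (q : K) (Q : 'I_d'.+1 -> K).
Variables (H : algType K) (T : nat -> H).
Hypotheses (n1 : (1 < n)%N) (hH : is_hecke_algebra p' n q Q T) (ss : semisimple_ring H).

Let rel : hecke_relations p' n q Q T. Proof. by case: hH. Qed.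

Lemma scalar_gen_hecke : exists rho : {lrmorphism H -> 'M[K]_((mxdim (word n n)).+1)},
  rho (T 0%N) = (Q ord0)%:A /\ forall i : 'I_n, (0 < i)%N -> rho (T i) = tsmx n q i.
Proof.
pose T0 : 'M[K]_((mxdim (word n n)).+1) := (Q ord0)%:A.
have T0C (M : 'M[K]_((mxdim (word n n)).+1)) : T0 * M = M * T0.
  by rewrite /T0 mulr_algl mulr_algr.
have hrel : hecke_relations p' n q Q (extend_gens T0 (tsmx n q)).
  apply: extend_gens_hecke => //.
  - rewrite big_ord_recl /= /T0 exprZn expr1n subrr mul0r //.
  - by move=> i _; rewrite -!mulrA T0C -!mulrA.
  - by move=> i; apply: tsmx_quad.
  - by move=> i j; apply: tsmx_far.
  - by move=> i j; apply: tsmx_braid.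
case: hH => _ ex _; have [rho hrho] := ex _ _ hrel.
exists rho; split; first by rewrite hrho ?(ltnW n1).
by move=> i i0; rewrite hrho // extend_gensE.
Qed.

Definition perm_word (w : 'S_n) : word n n := [ffun k => inord (w k)].

Lemma letter_perm_word (w : 'S_n) k : letter k (perm_word w) = w k.
Proof. by rewrite /letter ffunE inordK // leqW. Qed.

(** In the tensor space the word e with increasing letters generates a copy of the
    regular module of the finite Hecke algebra: T_w e is the word spelled by w.  For z the sum of
    all T_w, the vector m = z e has all these coordinates equal to 1 and satisfies
    T_i m = q m, so z m is the Poincare polynomial times m.  If this polynomial
    vanished, m would be a radical vector. *)
Lemma poincare_neq0 : poincare q [set: 'S_n] != 0.
Proof.
apply/eqP => P0; have [rho [rho0 rhoT]] := scalar_gen_hecke.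
pose E (x : word n n) : 'cV[K]_(mxdim (word n n)).+1 := delta_mx (enc (word0 n n) x) 0.
have Eent x y : E x (enc (word0 n n) y) 0 = (y == x)%:R.
  by rewrite mxE andbT (inj_eq (can_inj (encK _))).
pose z := \sum_(w in [set: 'S_n]) T_perm T w.
have TE (w : 'S_n) : rho (T_perm T w) *m E (perm_word 1%g) = E (perm_word w).
  elim/perm_indL: w => [|w i i0 up IH]; first by rewrite T_perm1 rmorph1 mul1mx.
  rewrite -(hecke_T_permL rel i0 up) lrmorph_mulmx IH rhoT //.
  apply: (mxX_ext (x0 := word0 n n)) => x j; rewrite (ord1 j) Eent opmxM /op !Eent.
  rewrite /loc_a /loc_b /= /ts_a /ts_b.
  have -> : (x == perm_word (simple_refl i * w)%g) = (word_refl i x == perm_word w).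
    rewrite (canF_eq (@word_reflK _ _ i)); congr (_ == _).
    by apply/ffunP => k; rewrite !ffunE permM.
  case: (word_refl i x =P perm_word w) => [E1|_]; last first.
    rewrite mulr0 addr0; case: (x =P perm_word w) => [->|_]; last by rewrite mulr0.
    by rewrite !letter_perm_word up mul0r.
  have E2 k : letter k x = w (simple_refl i k).
    by rewrite -letter_perm_word -E1 letter_refl -permM tperm2 perm1.
  rewrite !E2 simple_refl_pred simple_refl_self.
  rewrite ltnNge (ltnW up) /= gtn_eqF // mul1r.
  case: (x =P perm_word w) => [E3|_]; last by rewrite mulr0 add0r.
  have := E2 i; rewrite E3 letter_perm_word simple_refl_self => /val_inj /perm_inj E4.
  by have := val_ord_pred i0; rewrite -E4; lia.
pose m := rho z *m E (perm_word 1%g).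
have mE : m = \sum_(w : 'S_n) E (perm_word w).
  rewrite /m /z rmorph_sum mulmx_suml; apply: eq_big => [w|w _]; first by rewrite inE.
  exact: TE.
have Tm i : (i < n)%N -> (0 < i)%N -> rho (T i) *m m = q *: m.
  move=> hi i0; rewrite /m -lrmorph_mulmx.
  rewrite (@hecke_T_mul_sum _ _ _ _ _ _ _ _ rel _ (Ordinal hi)) //; last by move=> w; rewrite !inE.
  by rewrite linearZ -scalemxAl.
have Km h : exists c : K, rho h *m m = c *: m.
  move: h; apply: (hecke_ind n1 hH) => [|x y [c xc] [e ye]|a x y [c xc] [e ye]|i hi].
  - by exists 1; rewrite rmorph1 mul1mx scale1r.
  - by exists (c * e); rewrite lrmorph_mulmx ye -scalemxAr xc scalerA mulrC.
  - by exists (a * c + e); rewrite linearP mulmxDl -scalemxAl xc ye scalerA scalerDl.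
  case: (posnP i) => [->|i0]; last by exists q; apply: Tm.
  by exists (Q ord0); rewrite rho0 -scalemxAl mul1mx.
have Twm (w : 'S_n) : rho (T_perm T w) *m m = q ^+ perm_length w *: m.
  elim/perm_indL: w => [|w i i0 up IH]; first by rewrite T_perm1 rmorph1 mul1mx perm_length1 scale1r.
  rewrite -(hecke_T_permL rel i0 up) lrmorph_mulmx IH -scalemxAr Tm //.
  by rewrite scalerA perm_length_mulL_asc // exprSr.
have zm : rho z *m m = 0.
  rewrite /z rmorph_sum mulmx_suml; under eq_bigr => w _ do rewrite Twm.
  by rewrite -scaler_suml -/(poincare q _) P0 scale0r.
have /colP/(_ (enc (word0 n n) (perm_word 1%g))) := semisimple_no_radical_vector ss Km (erefl m) zm.
rewrite mE summxE mxE (bigD1 1%g) //= Eent eqxx big1 ?addr0; last first.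
  move=> w w1; rewrite Eent; case: eqP => // /ffunP E1.
  case/eqP: w1; apply/permP => k; have := E1 k; rewrite !ffunE perm1 => /(congr1 val).
  by rewrite /= !inordK ?leqW // => /val_inj.
by move/eqP; rewrite oner_eq0.
Qed.

Lemma qint_neq0 k : (0 < k <= n)%N -> qint q k != 0.
Proof.
move=> /andP[k0 kn]; have := poincare_neq0.
rewrite poincare_full => /prodf_neq0 nz.
have hk : (k.-1 < n)%N by lia.
by have := nz (Ordinal hk) isT; rewrite /= prednK.
Qed.

Hypothesis q1 : q != 1.

(** Because (q - 1) [k]_q = q ^ k - 1. *)
Lemma q_expn_neq1 k : (0 < k <= n)%N -> q ^+ k != 1.
Proof.
move=> hk; apply/eqP => qk; have := qint_neq0 hk.
have := subrX1 q k; rewrite qk subrr => /esym/eqP.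
by rewrite mulf_eq0 subr_eq0 (negbTE q1) /= /qint => ->.
Qed.

End QuantumIntegers.

(** * Words in two letters *)

Section CyclotomicParameters.
Variables (p' d' : nat) (K : fieldType) (eps : K) (Q : 'I_d'.+1 -> K).
Hypotheses (heps : p'.+1.-primitive_root eps) (hQ : forall c, Q c != 0).
Local Notation r := (p'.+1 * d'.+1)%N.

Lemma cyc_param_neq0 (s : 'I_r) : cyc_param eps Q s != 0.
Proof.
rewrite mulf_neq0 // expf_neq0 //; apply/eqP => e0.
by have := prim_expr_order heps; rewrite e0 expr0n => /esym/eqP; rewrite oner_eq0.
Qed.

Lemma cyc_paramXp (s : 'I_r) :
  cyc_param eps Q s ^+ p'.+1 = Q (inord (s %% d'.+1)) ^+ p'.+1.
Proof.
by rewrite /cyc_param exprMn exprAC (prim_expr_order heps) expr1n mul1r.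
Qed.

(** Two distinct parameters are roots of two different factors X ^ p - Q_c ^ p, or
    two different roots of the same factor; in both cases the quadratic polynomial
    divides the relation of T_0. *)
Lemma quadratic_root_T0 (A : algType K) (X : A) (s s' : 'I_r) : s != s' ->
  (X - (cyc_param eps Q s)%:A) * (X - (cyc_param eps Q s')%:A) = 0 ->
  \prod_(c < d'.+1) (X ^+ p'.+1 - (Q c ^+ p'.+1)%:A) = 0.
Proof.
set a := cyc_param _ _ s; set b := cyc_param _ _ s' => ss X0.
pose F (c : 'I_d'.+1) : {poly K} := 'X^(p'.+1) - (Q c ^+ p'.+1)%:P.
have rootF (u : 'I_r) : root (F (inord (u %% d'.+1))) (cyc_param eps Q u).
  by rewrite /root /F !hornerE cyc_paramXp subrr.
have dv : ('X - a%:P) * ('X - b%:P) %| \prod_c F c.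
  have [Ec|nc] := eqVneq (inord (s %% d'.+1) : 'I_d'.+1) (inord (s' %% d'.+1)).
    have nab : a != b.
      apply/eqP => ab; case/eqP: ss; apply/val_inj.
      have Em : (s %% d'.+1 = s' %% d'.+1)%N.
        by have := congr1 val Ec; rewrite /= !inordK ?ltn_mod.
      have : (eps ^+ (s %/ d'.+1).+1 == eps ^+ (s' %/ d'.+1).+1).
        by rewrite -(inj_eq (mulIf (hQ (inord (s %% d'.+1))))) {2}Ec; apply/eqP.
      rewrite (eq_prim_root_expr heps) -addn1 -[(s' %/ _).+1]addn1 eqn_modDr.
      rewrite !modn_small ?ltn_divLR // => /eqP Ed.
      by rewrite /= (divn_eq s d'.+1) Ed Em -divn_eq.
    rewrite (bigD1 (inord (s %% d'.+1))) //=; apply: dvdp_mulr.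
    have := uniq_roots_dvdp (p := F (inord (s %% d'.+1))) (rs := [:: a; b]).
    rewrite !big_cons big_nil mulr1; apply.
      by rewrite /= rootF Ec rootF.
    by rewrite uniq_rootsE /= inE nab.
  rewrite (bigD1 (inord (s %% d'.+1))) //= (bigD1 (inord (s' %% d'.+1))) 1?eq_sym //=.
  rewrite mulrA; apply: dvdp_mulr; apply: dvdp_mul; by rewrite dvdp_XsubCl.
have [g Eg] := dvdpP _ _ dv.
have := congr1 (horner_alg X) Eg.
rewrite rmorph_prod rmorphM rmorphM !rmorphB /= !horner_algX !horner_algC X0 mulr0 => <-.
apply: eq_bigr => c _.
by rewrite rmorphB /= rmorphXn /= horner_algX horner_algC.
Qed.

End CyclotomicParameters.

Section SignWords.
Variables (n : nat) (K : fieldType) (q Q1 Q2 : K).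
Hypothesis n1 : (1 < n)%N.
Local Notation word := (word n 1).
Local Notation w0 := (word0 n 1).
Let i0 : 'I_n := Ordinal (ltnW n1).

(** T_0 acts on the first letter of a word in two letters, with the eigenvalues Q1
    and Q2. *)
Definition flip (x : word) : word := [ffun k : 'I_n => if (k == 0%N :> nat) then rev_ord (x k) else x k].
(** The companion matrix of (X - Q1) (X - Q2) on the first tensor factor. *)
Definition flip_a (x : word) : K := if letter i0 x == 0%N then Q1 + Q2 else 0.
Definition flip_b (x : word) : K := if letter i0 x == 0%N then 1 else - (Q1 * Q2).
Definition flipmx := opmx w0 flip_a flip_b flip.

Lemma flipK : involutive flip.
Proof.
by move=> x; apply/ffunP => k; rewrite !ffunE; case: eqP => // _; rewrite rev_ordK.
Qed.

Lemma letter2 k (x : word) : (letter k x = 0 \/ letter k x = 1)%N.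
Proof. by rewrite /letter; case: (x k) => -[|[|//]] ?; [left|right]. Qed.

Lemma letter_flip0 x : letter i0 (flip x) = (1 - letter i0 x)%N.
Proof. by rewrite /letter ffunE eqxx /= subSS. Qed.

Lemma letter_flip (k : 'I_n) x : (0 < k)%N -> letter k (flip x) = letter k x.
Proof. by move=> k0; rewrite /letter ffunE; case: eqP => //; lia. Qed.

Lemma flip_quadratic : (flipmx - Q1%:A) * (flipmx - Q2%:A) = 0.
Proof.
have sq : flipmx * flipmx = (Q1 + Q2) *: flipmx - (Q1 * Q2)%:A.
  apply: (mxX_ext (x0 := w0)) => x j; rewrite [LHS]opmxM.
  have -> : ((Q1 + Q2) *: flipmx - (Q1 * Q2)%:A) (enc w0 x) j =
      (Q1 + Q2) * flipmx (enc w0 x) j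
      - Q1 * Q2 * (1%:M : 'M[K]_((mxdim word).+1)) (enc w0 x) j.
    by rewrite [LHS]mxE; congr (_ + _); rewrite [LHS]mxE // [in LHS]mxE.
  have E y : flipmx (enc w0 y) j = op flip_a flip_b flip (fun y => 1%:M (enc w0 y) j) y.
    by rewrite -[flipmx]mulmx1 opmxM.
  rewrite /op !E /op /flip_a /flip_b !letter_flip0 flipK.
  by have [->|->] := letter2 i0 x; rewrite /=; ring.
rewrite mulrBl !mulrBr sq mulr_algr !mulr_algl scalerA scalerDl.
by rewrite [X in X - _]addrAC addrK subrr.
Qed.

Lemma word_refl_flip (i : 'I_n) x : (1 < i)%N -> word_refl i (flip x) = flip (word_refl i x).
Proof.
move=> i1; apply/ffunP => k; rewrite !ffunE.
have := @simple_refl_cases _ i k; case: eqP => h1; case: eqP => h2 //; lia.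
Qed.

Lemma flipmx_far (i : 'I_n) : (1 < i)%N -> flipmx * tsmx 1 q i = tsmx 1 q i * flipmx.
Proof.
move=> i1; apply: (mxX_ext (x0 := w0)) => x j.
rewrite [LHS]opmxM [RHS]opmxM.
have E y : flipmx (enc w0 y) j = op flip_a flip_b flip (fun y => 1%:M (enc w0 y) j) y.
  by rewrite -[flipmx]mulmx1 opmxM.
pose f y : K := (1%:M : 'M[K]_((mxdim word).+1)) (enc w0 y) j.
transitivity (op flip_a flip_b flip (op (loc_a q predT (@letter n 1) (ts_a q) i)
   (loc_b predT (@letter n 1) (ts_b q) i) (word_refl i) f) x).
  by rewrite /op /tsmx !locmxE /op.
transitivity (op (loc_a q predT (@letter n 1) (ts_a q) i)
   (loc_b predT (@letter n 1) (ts_b q) i) (word_refl i) (op flip_a flip_b flip f) x); last first.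
  by rewrite /op !E /op.
have vp : ord_pred i = i.-1 :> nat by rewrite val_ord_pred //; lia.
have fx : simple_refl i i0 = i0 by rewrite simple_refl_fix //=; lia.
apply: op_comm.
- by rewrite word_refl_flip.
- by rewrite /flip_a letter_refl fx.
- by rewrite /flip_b letter_refl fx.
- by rewrite /loc_a /= !letter_flip // ?vp; lia.
- by rewrite /loc_b /= !letter_flip // ?vp; lia.
Qed.

(** A calculation on the four values of the first two letters. *)
Lemma flipmx_braid (i : 'I_n) : i = 1%N :> nat ->
  flipmx * tsmx 1 q i * flipmx * tsmx 1 q i = tsmx 1 q i * flipmx * tsmx 1 q i * flipmx.
Proof.
move=> i1; apply: (mxX_ext (x0 := w0)) => x j; rewrite -!mulrA.
pose A0 := op flip_a flip_b flip.
pose A1 := op (loc_a q predT (@letter n 1) (ts_a q) i)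
   (loc_b predT (@letter n 1) (ts_b q) i) (word_refl i).
pose f y : K := (1%:M : 'M[K]_((mxdim word).+1)) (enc w0 y) j.
have vp : ord_pred i = i0 by apply/val_inj; rewrite [LHS]val_ord_pred ?i1.
have i_pos : (0 < i)%N by rewrite i1.
have E0 y : flipmx (enc w0 y) j = A0 f y by rewrite -[flipmx]mulmx1 opmxM.
have E1 y : tsmx 1 q i (enc w0 y) j = A1 f y by rewrite /tsmx locmxE.
have M0 (M : 'M[K]_((mxdim word).+1)) g y : (forall y, M (enc w0 y) j = g y) ->
  (flipmx * M) (enc w0 y) j = A0 g y by move=> h; rewrite [LHS]opmxM /A0 /op !h.
have M1 (M : 'M[K]_((mxdim word).+1)) g y : (forall y, M (enc w0 y) j = g y) ->
  (tsmx 1 q i * M) (enc w0 y) j = A1 g y by move=> h; rewrite [LHS]opmxM /A1 /op !h.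
rewrite (M0 _ _ _ (fun y => M1 _ _ y (fun y => M0 _ _ y E1))).
rewrite (M1 _ _ _ (fun y => M0 _ _ y (fun y => M1 _ _ y E0))).
have s0 : simple_refl i i0 = i by rewrite -vp simple_refl_pred.
have s1 : simple_refl i i = i0 by rewrite simple_refl_self vp.
have l0 y : letter i0 (word_refl i y) = letter i y by rewrite letter_refl s0.
have l1 y : letter i (word_refl i y) = letter i0 y by rewrite letter_refl s1.
have l2 y : letter i (flip y) = letter i y by rewrite letter_flip.
rewrite /A0 /A1 /op /flip_a /flip_b /loc_a /loc_b /= vp.
rewrite !(l0, l1, l2, letter_flip0, flipK, word_reflK).
rewrite /ts_a /ts_b.
by have [->|->] := letter2 i0 x; have [->|->] := letter2 i x; rewrite /= ?flipK ?word_reflK; ring.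
Qed.

End SignWords.

(** * Separation of the cyclotomic parameters *)

Section Separation.
Variables (p' d' n : nat) (K : fieldType) (eps q : K) (Q : 'I_d'.+1 -> K).
Hypotheses (heps : p'.+1.-primitive_root eps) (hQ : forall c, Q c != 0).
Variables (H : algType K) (T : nat -> H).
Hypotheses (n1 : (1 < n)%N) (hH : is_hecke_algebra p' n q Q T) (ss : semisimple_ring H).
Local Notation r := (p'.+1 * d'.+1)%N.
Local Notation word := (word n 1).
Local Notation w0 := (word0 n 1).
Local Notation N1 := ((mxdim word).+1).

Section Pair.
Variables (s s' : 'I_r).
Hypothesis nss : s != s'.
Local Notation Q1 := (cyc_param eps Q s).
Local Notation Q2 := (cyc_param eps Q s').

Lemma sign_rep : exists rho : {lrmorphism H -> 'M[K]_N1},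
  rho (T 0%N) = flipmx Q1 Q2 n1 /\ forall i : 'I_n, (0 < i)%N -> rho (T i) = tsmx 1 q i.
Proof.
have hrel : hecke_relations p' n q Q (extend_gens (flipmx Q1 Q2 n1) (@tsmx n 1 K q)).
  apply: extend_gens_hecke => //.
  - exact: (quadratic_root_T0 heps hQ nss (flip_quadratic Q1 Q2 n1)).
  - by move=> i; apply: flipmx_far.
  - by move=> i; apply: flipmx_braid.
  - by move=> i; apply: tsmx_quad.
  - by move=> i j; apply: tsmx_far.
  - by move=> i j; apply: tsmx_braid.
case: hH => _ ex _; have [rho hrho] := ex _ _ hrel.
exists rho; split; first by rewrite hrho ?(ltnW n1).
by move=> i i0; rewrite hrho // extend_gensE.
Qed.

(** A column and a row eigenvector of the whole algebra, for the character that maps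
    T_0 to Q1 and every T_i to q. *)
Definition sg_m : 'cV[K]_N1 :=
  \col_i \prod_k (if dec w0 i k == ord0 then 1 else - Q2).
Definition sg_phi : 'rV[K]_N1 :=
  \row_i \prod_(k < n) (if dec w0 i k == ord0 then Q1 * q ^+ k else 1).

Lemma sg_mE x j : sg_m (enc w0 x) j = \prod_k (if letter k x == 0%N then 1 else - Q2).
Proof. by rewrite mxE encK. Qed.

Lemma sg_phiE x j :
  sg_phi j (enc w0 x) = \prod_(k < n) (if letter k x == 0%N then Q1 * q ^+ k else 1).
Proof. by rewrite mxE encK. Qed.

(** The sum over all words of a product of letter weights is a product of sums over
    the two letters. *)
Lemma sg_phi_m : sg_phi *m sg_m = (\prod_(k < n) (Q1 * q ^+ k - Q2))%:M.
Proof.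
apply/matrixP => i j; rewrite !ord1 mxE (sum_enc w0) [RHS]mxE eqxx.
rewrite (eq_bigr (fun k : 'I_n => \sum_(l < 2) (if l == ord0 then Q1 * q ^+ k else - Q2))); last first.
  by move=> k _; rewrite big_ord_recl big_ord1.
rewrite bigA_distr_bigA /=; apply: eq_bigr => x _.
rewrite sg_phiE sg_mE -big_split; apply: eq_bigr => k _.
rewrite /letter -[x k == ord0]/(x k == 0%N :> nat).
by rewrite /=; case: ifP; rewrite ?mulr1 ?mul1r.
Qed.

Lemma sg_m_refl (i : 'I_n) x j : sg_m (enc w0 (word_refl i x)) j = sg_m (enc w0 x) j.
Proof.
rewrite !sg_mE [RHS](reindex_inj (@perm_inj _ (simple_refl i))).
by apply: eq_bigr => k _; rewrite letter_refl.
Qed.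

Lemma prod_i0 (F : 'I_n -> K) :
  \prod_k F k = F (Ordinal (ltnW n1)) * \prod_(k < n | (0 < k)%N) F k.
Proof.
rewrite (bigD1 (Ordinal (ltnW n1))) //=; congr (_ * _); apply: eq_bigl => k.
by rewrite -(inj_eq val_inj) lt0n.
Qed.

Lemma sg_m_T0 : flipmx Q1 Q2 n1 *m sg_m = Q1 *: sg_m.
Proof.
apply: (mxX_ext (x0 := w0)) => x j; rewrite opmxM [RHS]mxE /op !sg_mE !prod_i0.
have -> : \prod_(k < n | (0 < k)%N) (if letter k (flip x) == 0%N then 1 else - Q2) =
    \prod_(k < n | (0 < k)%N) (if letter k x == 0%N then 1 else - Q2).
  by apply: eq_bigr => k k0; rewrite letter_flip.
rewrite letter_flip0 /flip_a /flip_b.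
by have [->|->] := letter2 (Ordinal (ltnW n1)) x; rewrite /=; ring.
Qed.

Lemma sg_m_T (i : 'I_n) : (0 < i)%N -> tsmx 1 q i *m sg_m = q *: sg_m.
Proof.
move=> i0; apply: (mxX_ext (x0 := w0)) => x j.
rewrite /tsmx locmxM [RHS]mxE /op sg_m_refl /loc_a /loc_b /= /ts_a /ts_b.
by case: ltngtP => _; ring.
Qed.

Lemma sg_phi_T0 : sg_phi *m flipmx Q1 Q2 n1 = Q1 *: sg_phi.
Proof.
apply/matrixP => j l; rewrite -(decK w0 l); move: (dec _ _) => x.
rewrite Mopmx; last exact: flipK.
rewrite [RHS]mxE !sg_phiE !prod_i0.
have -> : \prod_(k < n | (0 < k)%N) (if letter k (flip x) == 0%N then Q1 * q ^+ k else 1) =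
    \prod_(k < n | (0 < k)%N) (if letter k x == 0%N then Q1 * q ^+ k else 1).
  by apply: eq_bigr => k k0; rewrite letter_flip.
rewrite /flip_a /flip_b !letter_flip0.
by have [->|->] := letter2 (Ordinal (ltnW n1)) x; rewrite /= expr0; ring.
Qed.

Lemma sg_phi_refl (i : 'I_n) x j : (0 < i)%N -> (letter (ord_pred i) x < letter i x)%N ->
  sg_phi j (enc w0 (word_refl i x)) = q * sg_phi j (enc w0 x).
Proof.
move=> i0 lt; have vp := val_ord_pred i0.
have ne : i != ord_pred i by rewrite eq_ord_pred //; lia.
rewrite !sg_phiE (bigD1 (ord_pred i)) //= (bigD1 i) //=.
rewrite [in RHS](bigD1 (ord_pred i)) //= [in RHS](bigD1 i) //=.
rewrite !letter_refl simple_refl_pred simple_refl_self.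
rewrite (eq_bigr (fun k : 'I_n => if letter k x == 0%N then Q1 * q ^+ k else 1)); last first.
  move=> k /andP[k1 k2]; rewrite letter_refl simple_refl_fix //.
    by move=> E; case/eqP: k1; apply/val_inj; rewrite [RHS]vp.
  by move=> E; case/eqP: k2; apply/val_inj.
have [-> ->] : (letter (ord_pred i) x = 0 /\ letter i x = 1)%N.
  by have [] := letter2 (ord_pred i) x; have [] := letter2 i x; lia.
have -> : q ^+ i = q * q ^+ ord_pred i by rewrite -exprS vp prednK.
by rewrite /=; ring.
Qed.

Lemma sg_phi_T (i : 'I_n) : (0 < i)%N -> sg_phi *m tsmx 1 q i = q *: sg_phi.
Proof.
move=> i0; apply/matrixP => j l; rewrite -(decK w0 l); move: (dec _ _) => x.
rewrite [LHS]Mopmx; last exact: word_reflK.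
rewrite [RHS]mxE /loc_a /loc_b /= !letter_refl simple_refl_pred simple_refl_self.
rewrite /ts_a /ts_b; case: ltngtP => lt.
- by rewrite sg_phi_refl //; ring.
- have := @sg_phi_refl i (word_refl i x) j i0.
  rewrite !letter_refl simple_refl_pred simple_refl_self word_reflK => -> //; ring.
by ring.
Qed.

(** The word that generates the whole two-letter module. *)
Definition word1 : word := [ffun => ord_max].
Definition set_letter0 (j : 'I_n) (x : word) : word := [ffun k => if k == j then ord0 else x k].

Section Reach.
Variable rho : {lrmorphism H -> 'M[K]_N1}.
Hypothesis rho0 : rho (T 0%N) = flipmx Q1 Q2 n1.
Hypothesis rhoT : forall i : 'I_n, (0 < i)%N -> rho (T i) = tsmx 1 q i.

Definition reachable (u : 'cV[K]_N1) : Prop :=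
  exists h, rho h *m (delta_mx (enc w0 word1) 0 : 'cV[K]_N1) = u.

Local Notation E x := (delta_mx (enc w0 x) 0 : 'cV[K]_N1).

Lemma deltaE x y j : (E x) (enc w0 y) j = (y == x)%:R.
Proof. by rewrite mxE ord1 eqxx andbT (inj_eq (can_inj (encK _))). Qed.

Lemma reachable_mul h u : reachable u -> reachable (rho h *m u).
Proof. by case=> g <-; exists (h * g); rewrite lrmorph_mulmx. Qed.

Lemma word_refl_E (i : 'I_n) x : (0 < i)%N -> (letter (ord_pred i) x < letter i x)%N ->
  tsmx 1 q i *m E x = E (word_refl i x).
Proof.
move=> i0 lt; apply: (mxX_ext (x0 := w0)) => y j; rewrite /tsmx locmxM /op !deltaE.
rewrite (canF_eq (@word_reflK _ _ i)) /loc_a /loc_b /= /ts_a /ts_b.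
case: (y =P x) => [->|nyx].
  rewrite lt mul0r add0r; case: eqP => [E1|_]; last by rewrite mulr0.
  have := letter_refl i i x; rewrite -E1 simple_refl_self => E2.
  by rewrite E2 ltnn in lt.
rewrite mulr0 add0r; case: (y =P word_refl i x) => [->|_]; last by rewrite mulr0.
rewrite !letter_refl simple_refl_pred simple_refl_self ltnNge (ltnW lt) /= gtn_eqF //.
by rewrite mulr1.
Qed.

Lemma flip_E x : letter (Ordinal (ltnW n1)) x = 1%N -> flipmx Q1 Q2 n1 *m E x = E (flip x).
Proof.
move=> x1; apply: (mxX_ext (x0 := w0)) => y j; rewrite opmxM /op !deltaE.
rewrite (canF_eq (@flipK _)) /flip_a /flip_b.
case: (y =P x) => [->|nyx].
  rewrite x1 /= mul0r add0r; case: eqP => [E1|_]; last by rewrite mulr0.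
  by have := letter_flip0 n1 x; rewrite -E1 x1.
rewrite mulr0 add0r; case: (y =P flip x) => [->|_]; last by rewrite mulr0.
by rewrite letter_flip0 x1 /= mulr1.
Qed.

(** T_0 changes the first letter.  At another place j, the generator T_j exchanges the
    letters 0, 1 at j - 1, j.  If the place j - 1 has the letter 0, exchange first
    and then change the letter 1 that has come to j - 1; if it has the letter 1,
    change that one first and then exchange. *)
Lemma reachable_set (j : 'I_n) x : letter j x = 1%N -> reachable (E x) ->
  reachable (E (set_letter0 j x)).
Proof.
have [k] := ubnP (j : nat); elim: k j x => // k IH j x; rewrite ltnS => jk xj rx.
have two (a b : 'I_2) : (a = b :> nat) -> a = b by move/val_inj.
case: (posnP j) => [j0|j0].
  have Ej : j = Ordinal (ltnW n1) by apply/val_inj.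
  have -> : set_letter0 j x = flip x.
    apply/ffunP => l; rewrite !ffunE -(inj_eq val_inj) /= j0; case: eqP => // l0.
    have -> : l = j by apply/val_inj; rewrite /= l0 j0.
    by apply: two; rewrite /= -[nat_of_ord (x j)]/(letter j x) xj.
  by rewrite -flip_E -?Ej // -rho0; apply: reachable_mul.
have vp := val_ord_pred j0.
have ne : (ord_pred j == j) = false by apply/negbTE; rewrite eq_sym eq_ord_pred //; lia.
have ltp : (ord_pred j < k)%N by lia.
have [xp|xp] := letter2 (ord_pred j) x.
  have lt : (letter (ord_pred j) x < letter j x)%N by rewrite xp xj.
  have -> : set_letter0 j x = set_letter0 (ord_pred j) (word_refl j x).
    apply/ffunP => l; rewrite !ffunE; case: (eqVneq l j) => [->|lj].
      by rewrite eq_sym ne simple_refl_self; apply: two; rewrite -[RHS]/(letter _ x) xp.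
    case: (eqVneq l (ord_pred j)) => [->|lp]; first by apply: two; rewrite -[LHS]/(letter _ x) xp.
    rewrite simple_refl_fix // => E1.
      by case/eqP: lp; apply/val_inj; rewrite [RHS]vp.
    by case/eqP: lj; apply/val_inj.
  apply: IH => //; first by rewrite letter_refl simple_refl_pred.
  by rewrite -word_refl_E // -rhoT //; apply: reachable_mul.
have rs : reachable (E (set_letter0 (ord_pred j) x)) by apply: IH.
have lt : (letter (ord_pred j) (set_letter0 (ord_pred j) x) <
           letter j (set_letter0 (ord_pred j) x))%N.
  by rewrite /letter !ffunE eqxx eq_sym ne /= -[nat_of_ord (x j)]/(letter j x) xj.
have -> : set_letter0 j x = word_refl j (set_letter0 (ord_pred j) x).
  apply/ffunP => l; rewrite !ffunE; case: (eqVneq l j) => [->|lj].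
    by rewrite simple_refl_self eqxx.
  case: (eqVneq l (ord_pred j)) => [->|lp].
    rewrite simple_refl_pred eq_sym ne; apply: two.
    by rewrite -[LHS]/(letter _ x) -[RHS]/(letter _ x) xp xj.
  rewrite simple_refl_fix ?(negbTE lp) // => E1.
    by case/eqP: lp; apply/val_inj; rewrite [RHS]vp.
  by case/eqP: lj; apply/val_inj.
by rewrite -word_refl_E // -rhoT //; apply: reachable_mul.
Qed.

Lemma reachable_word x : reachable (E x).
Proof.
have [k] := ubnP #|[pred j | x j == ord0]|; elim: k x => // k IH x; rewrite ltnS => le.
case: (pickP [pred j | x j == ord0]) => [j /= xj|no]; last first.
  exists 1; rewrite rmorph1 mul1mx; congr (delta_mx (enc _ _) _).
  apply/ffunP => j; rewrite ffunE; apply/val_inj => /=.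
  by have := no j; rewrite /= -(inj_eq val_inj) /=; case: (x j) => -[|[|]].
pose y : word := [ffun l => if l == j then ord_max else x l].
have -> : x = set_letter0 j y.
  by apply/ffunP => l; rewrite !ffunE; case: eqP => [->|]; rewrite ?(eqP xj).
apply: reachable_set; first by rewrite /letter ffunE eqxx.
apply: IH; apply: leq_trans le; apply: proper_card; apply/properP; split.
  by apply/subsetP => l; rewrite !inE ffunE; case: (l =P j).
by exists j; rewrite !inE ?ffunE ?eqxx.
Qed.

Lemma reachable_m : reachable sg_m.
Proof.
have -> : sg_m = \sum_x sg_m (enc w0 x) 0 *: E x.
  apply: (mxX_ext (x0 := w0)) => x j; rewrite summxE (bigD1 x) //= [X in _ = X + _]mxE deltaE eqxx mulr1.
  rewrite (ord1 j) big1 ?addr0 // => y yx.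
by rewrite [LHS]mxE deltaE eq_sym (negbTE yx) mulr0.
apply: big_ind => [|u v [g <-] [h <-]|x _].
- by exists 0; rewrite rmorph0 mul0mx.
- by exists (g + h); rewrite rmorphD mulmxDl.
have [h <-] := reachable_word x; exists (sg_m (enc w0 x) 0 *: h).
by rewrite linearZ -scalemxAl.
Qed.

End Reach.

(** The row phi and the column m are eigenvectors for the same character, and m = z v
    for v the generating word.  If phi m = 0, then the scalar c by which z acts
    satisfies c (phi v) = phi z v = phi m = 0, while phi v = 1.  So z m = 0, and m is
    a radical vector. *)
Lemma parameter_prod_neq0 : \prod_(k < n) (Q1 * q ^+ k - Q2) != 0.
Proof.
apply/eqP => P0; have [rho [rho0 rhoT]] := sign_rep.
have eig h : exists c : K, rho h *m sg_m = c *: sg_m /\ sg_phi *m rho h = c *: sg_phi.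
  move: h; apply: (hecke_ind n1 hH) => [|x y [c [c1 c2]] [e [e1 e2]]|a x y [c [c1 c2]] [e [e1 e2]]|i hi].
  - by exists 1; rewrite rmorph1 mul1mx mulmx1 !scale1r.
  - exists (c * e); rewrite lrmorph_mulmx mulmx_lrmorph e1 c2 -scalemxAr -scalemxAl c1 e2 !scalerA.
    by rewrite mulrC.
  - exists (a * c + e); rewrite linearP mulmxDl mulmxDr -scalemxAl -scalemxAr c1 c2 e1 e2.
    by rewrite !scalerA !scalerDl.
  case: (posnP i) => [->|i0].
    by exists Q1; rewrite rho0 sg_m_T0 sg_phi_T0.
  by exists q; rewrite (rhoT (Ordinal hi)) // sg_m_T // sg_phi_T.
have [z zv] := reachable_m rho0 rhoT.
have [c [c1 c2]] := eig z.
have c0 : c = 0.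
  have := congr1 (mulmx sg_phi) zv; rewrite mulmxA c2 sg_phi_m P0 -scalemxAl.
  move/matrixP/(_ 0 0); rewrite [LHS]mxE [RHS]mxE mxE (bigD1 (enc w0 word1)) //=.
  rewrite big1 ?addr0 => [|l /negbTE nl]; last by rewrite [X in _ * X]mxE nl mulr0.
  rewrite sg_phiE big1 => [|k _]; last by rewrite /letter ffunE.
  by rewrite mxE !eqxx !mulr1 mul0rn.
have m0 : sg_m = 0.
  apply: (semisimple_no_radical_vector ss _ zv) => [h|]; last by rewrite c1 c0 scale0r.
  by have [e [e1 _]] := eig h; exists e.
have := sg_mE (word0 n 1) 0; rewrite m0 mxE big1 => [/esym/eqP|k _].
  by rewrite oner_eq0.
by rewrite /letter ffunE.
Qed.

End Pair.

Lemma parameters_separated (s s' : 'I_r) k : s != s' -> (k < n)%N ->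
  cyc_param eps Q s * q ^+ k != cyc_param eps Q s'.
Proof.
move=> ne kn; have /prodf_neq0 h := parameter_prod_neq0 ne.
by have := h (Ordinal kn) isT; rewrite subr_eq0.
Qed.

End Separation.

(** * Diagrams and standard tableaux *)

Lemma sum_ltS m (F : 'I_m -> nat) (k : 'I_m) :
  (\sum_(i < m | i < k.+1) F i = \sum_(i < m | i < k) F i + F k)%N.
Proof.
rewrite (bigD1 k) //= addnC; congr (_ + _)%N; apply: eq_bigl => i.
by rewrite -(inj_eq val_inj) /=; lia.
Qed.

Lemma leq_sum_lt m (F : 'I_m -> nat) a b : (a <= b)%N ->
  (\sum_(i < m | i < a) F i <= \sum_(i < m | i < b) F i)%N.
Proof.
move=> ab; rewrite [X in (_ <= X)%N](bigID (fun i : 'I_m => (i < a)%N)) /=.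
apply: leq_trans (leq_addr _ _); apply: eq_leq; apply: eq_bigl => i; lia.
Qed.

Lemma leq_sum_lt_all m (F : 'I_m -> nat) a :
  (\sum_(i < m | i < a) F i <= \sum_(i < m) F i)%N.
Proof. by rewrite [X in (_ <= X)%N](bigID (fun i : 'I_m => (i < a)%N)) leq_addr. Qed.

Section Diagrams.
Variables p' d' n : nat.
Local Notation r := (p'.+1 * d'.+1)%N.
Local Notation node := (node p' d' n).
Local Notation mpart := (mpart p' d' n).
Local Notation tableau := (tableau p' d' n).
Implicit Types (X Y Z : node) (la : mpart) (t : tableau).

Definition nrow X : nat := X.2.1.
Definition ncol X : nat := X.2.2.

(** The order in which the initial tableau reads the nodes. *)
Definition prec X Y : bool :=
  (X.1 < Y.1)%N || (X.1 == Y.1) && ((nrow X < nrow Y)%N || (nrow X == nrow Y) && (ncol X < ncol Y)%N).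

(** Standard tableaux increase weakly along this order, within one component. *)
Definition nw X Y : bool := [&& X.1 == Y.1, (nrow X <= nrow Y)%N & (ncol X <= ncol Y)%N].

Lemma node_eq X Y : X.1 = Y.1 -> nrow X = nrow Y -> ncol X = ncol Y -> X = Y.
Proof.
case: X Y => [s [a b]] [s' [a' b']]; rewrite /nrow /ncol /= => -> h1 h2.
by rewrite (val_inj h1) (val_inj h2).
Qed.

Lemma prec_total X Y : X != Y -> prec X Y || prec Y X.
Proof.
move=> ne; rewrite /prec -!(inj_eq val_inj) /=.
case: (ltngtP X.1 Y.1) => //= /val_inj E1.
case: (ltngtP (nrow X) (nrow Y)) => //= E2.
case: (ltngtP (ncol X) (ncol Y)) => //= E3.
by case/eqP: ne; apply: node_eq.
Qed.

Lemma nw_prec X Y : nw X Y -> X != Y -> prec X Y.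
Proof.
case/and3P => /eqP E h1 h2 ne; rewrite /prec E eqxx ltnn /=.
case: (ltngtP (nrow X) (nrow Y)) h1 => //= E2 _; rewrite ltn_neqAle h2 andbT.
by apply/eqP => E3; case/eqP: ne; apply: node_eq.
Qed.

Section Shape.
Variable la : mpart.
Hypothesis hla : is_mpart la.

Lemma shape_decr s (i j : 'I_n) : (i <= j)%N -> (la s j <= la s i)%N.
Proof.
by case/andP: hla => /forallP/(_ s)/forallP/(_ i)/forallP/(_ j)/implyP.
Qed.

Lemma shape_size : (\sum_s comp_size la s = n)%N.
Proof. by case/andP: hla => _ /eqP. Qed.

Lemma in_diagram X : (X \in diagram la) = (X.2.2 < la X.1 X.2.1)%N.
Proof. by rewrite inE. Qed.

Lemma diagram_nw X Y : nw X Y -> Y \in diagram la -> X \in diagram la.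
Proof.
case/and3P => /eqP E h1 h2; rewrite !in_diagram => hY.
by rewrite E; apply: leq_ltn_trans h2 (leq_trans hY _); apply: shape_decr.
Qed.

(** The first row of the component has more than ncol X nodes, and the first column
    more than nrow Y. *)
Lemma hook_size X Y : X.1 = Y.1 -> X \in diagram la -> Y \in diagram la ->
  (nrow Y + ncol X < comp_size la X.1)%N.
Proof.
move=> E hX hY; have hY' := hY; rewrite in_diagram in hY'; rewrite in_diagram in hX.
have z0 : (0 < n)%N by case: n X.2.1 => [[]|].
pose o : 'I_n := Ordinal z0.
rewrite /comp_size (bigD1 o) //= addnC.
have h0 : (ncol X < la X.1 o)%N by apply: leq_trans hX _; apply: shape_decr.
have h1 : (nrow Y <= \sum_(i < n | i != o) la X.1 i)%N.
  apply: (@leq_trans (\sum_(i < n | (i != o) && (i <= Y.2.1)%N) 1)%N); last first.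
    rewrite [X in (_ <= X)%N](bigID (fun i : 'I_n => (i <= Y.2.1)%N)) /=.
    apply: leq_trans (leq_addr _ _); apply: leq_sum => i /andP[_ hi].
    by apply: leq_trans (shape_decr _ hi); rewrite E; lia.
  rewrite sum1dep_card; set S := finset _.
  have E1 := card_ord_lt (ltn_ord Y.2.1).
  rewrite -ltnS -[X in (X <= _)%N]E1; apply: (@leq_trans #|o |: S|).
    apply: subset_leq_card; apply/subsetP => i; rewrite !inE ltnS => ->.
    by rewrite andbT orbN.
  by rewrite cardsU1; case: (o \notin S); rewrite ?add1n.
exact: (leq_add h0 h1).
Qed.

Lemma comp_size_le s : (comp_size la s <= n)%N.
Proof. by rewrite -[X in (_ <= X)%N]shape_size (bigD1 s) //= leq_addr. Qed.

Lemma comp_size2_le s s' : s != s' -> (comp_size la s + comp_size la s' <= n)%N.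
Proof.
move=> ne; rewrite -[X in (_ <= X)%N]shape_size (bigD1 s) //= (bigD1 s') 1?eq_sym //=.
by rewrite addnA leq_addr.
Qed.

Lemma rr_lt_comp X : X \in diagram la ->
  (row_reading la X < \sum_(s < r | s < X.1) comp_size la s + comp_size la X.1)%N.
Proof.
rewrite in_diagram /row_reading -addnA ltn_add2l => h.
apply: (@leq_trans (\sum_(i < n | (i < X.2.1.+1)%N) la X.1 i)%N); last exact: leq_sum_lt_all.
by rewrite sum_ltS ltn_add2l.
Qed.

(** The reading number counts the nodes that are read earlier. *)
Lemma rr_prec X Y : X \in diagram la -> prec X Y -> (row_reading la X < row_reading la Y)%N.
Proof.
move=> hX /orP[h|/andP[/eqP E h]].
  apply: leq_trans (rr_lt_comp hX) _; rewrite -sum_ltS /row_reading -addnA.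
  by apply: leq_trans (leq_addr _ _); apply: leq_sum_lt.
rewrite /row_reading E -!addnA ltn_add2l; case/orP: h => [h|/andP[/eqP E2 h]].
  apply: (@leq_trans (\sum_(i < n | (i < X.2.1.+1)%N) la Y.1 i)%N).
    by rewrite sum_ltS ltn_add2l -E -in_diagram.
  by apply: leq_trans (leq_addr _ _); apply: leq_sum_lt.
by rewrite (val_inj E2 : X.2.1 = Y.2.1) ltn_add2l.
Qed.

Lemma rr_lt X : X \in diagram la -> (row_reading la X < n)%N.
Proof.
move=> hX; apply: leq_trans (rr_lt_comp hX) _; rewrite -sum_ltS -[X in (_ <= X)%N]shape_size.
exact: leq_sum_lt_all.
Qed.

Lemma rr_inj X Y : X \in diagram la -> Y \in diagram la ->
  row_reading la X = row_reading la Y -> X = Y.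
Proof.
move=> hX hY E; apply/eqP; apply: contraT => /prec_total /orP[] h.
  by have := rr_prec hX h; rewrite E ltnn.
by have := rr_prec hY h; rewrite E ltnn.
Qed.

Lemma card_diagram : #|diagram la| = n.
Proof.
rewrite -[RHS]shape_size -sum1_card.
rewrite (eq_bigl (fun X : node => true && (X.2.2 < la X.1 X.2.1)%N)); last first.
  by move=> X; rewrite inE.
rewrite -(pair_big_dep predT (fun s (ab : 'I_n * 'I_n) => (ab.2 < la s ab.1)%N) (fun _ _ => 1%N)) /=.
apply: eq_bigr => s _.
rewrite -(pair_big_dep predT (fun a b : 'I_n => (b < la s a)%N) (fun _ _ => 1%N)) /=.
apply: eq_bigr => a _; rewrite sum1dep_card.
have le : (la s a <= n)%N by rewrite -ltnS.
by rewrite -[RHS](card_ord_lt le); apply: eq_card => b; rewrite !inE.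
Qed.

(** An injection between finite sets with n elements each. *)
Lemma rr_surj (k : 'I_n) : exists2 X, X \in diagram la & row_reading la X = k.
Proof.
pose f (X : node) : 'I_n := insubd k (row_reading la X).
have fE X : X \in diagram la -> f X = row_reading la X :> nat.
  by move=> h; rewrite val_insubd rr_lt.
have inj : {in diagram la &, injective f}.
  by move=> X Y hX hY E; apply: rr_inj => //; rewrite -!fE // E.
have : k \in [set f X | X in diagram la].
  have -> : [set f X | X in diagram la] = setT; last by rewrite inE.
  by apply/eqP; rewrite eqEcard subsetT cardsT card_ord card_in_imset // card_diagram /=.
by case/imsetP => X hX E; exists X => //; rewrite -fE // -E.
Qed.

(** The node with reading number k. *)
Definition nd (k : 'I_n) : node := init_tab la k.

Lemma ndP k : nd k \in diagram la /\ row_reading la (nd k) = k.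
Proof.
rewrite /nd /init_tab ffunE; case: pickP => [X /andP[h /eqP E] //|no].
by have [X h E] := rr_surj k; have := no X; rewrite h E eqxx.
Qed.

Lemma nd_diagram k : nd k \in diagram la. Proof. by case: (ndP k). Qed.

Lemma rr_nd k : row_reading la (nd k) = k. Proof. by case: (ndP k). Qed.

Lemma nd_inj : injective nd.
Proof. by move=> i j E; apply/val_inj; rewrite /= -rr_nd E rr_nd. Qed.

Lemma nd_surj X : X \in diagram la -> exists k, nd k = X.
Proof.
move=> hX; exists (Ordinal (rr_lt hX)); apply: rr_inj => //; first exact: nd_diagram.
by rewrite rr_nd.
Qed.

Lemma prec_nd i j : prec (nd i) (nd j) = (i < j)%N.
Proof.
apply/idP/idP => [h|h]; first by rewrite -[X in (X < _)%N]rr_nd -[X in (_ < X)%N]rr_nd rr_prec ?nd_diagram.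
have /prec_total : nd i != nd j by rewrite (inj_eq nd_inj) -(inj_eq val_inj) /= ltn_eqF.
case/orP => // /(rr_prec (nd_diagram _)); rewrite !rr_nd; lia.
Qed.

Lemma nd_comp_lt (k : 'I_n) (m : nat) :
  (k < \sum_(s < r | (s < m)%N) comp_size la s)%N = ((nd k).1 < m)%N.
Proof.
have rk := rr_nd k; apply/idP/idP => [|h].
  apply: contraTT; rewrite -!leqNgt => h; apply: leq_trans (leq_sum_lt _ h) _.
  by rewrite -[X in (_ <= X)%N]rk /row_reading -addnA leq_addr.
have := rr_lt_comp (nd_diagram k); rewrite rk -sum_ltS => lt.
by apply: leq_trans lt _; apply: leq_sum_lt.
Qed.

(** Standardness transported to permutations: for w = d(t) it says that t = t^la w
    is standard. *)
Definition std_perm (w : 'S_n) : bool := is_std la (tab_act (init_tab la) w).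

Lemma tab_actE (w : 'S_n) k : tab_act (init_tab la) w k = nd (w^-1%g k).
Proof. by rewrite ffunE. Qed.

Definition nd_lt i j : bool :=
  ((nd i).1 == (nd j).1) &&
  ((nrow (nd i) == nrow (nd j)) && (ncol (nd i) < ncol (nd j))%N
   || (ncol (nd i) == ncol (nd j)) && (nrow (nd i) < nrow (nd j))%N).

Lemma std_permP (w : 'S_n) :
  reflect (forall i j, nd_lt i j -> (w i < w j)%N) (std_perm w).
Proof.
have inj : injectiveb (tab_act (init_tab la) w).
  by apply/injectiveP => i j; rewrite !tab_actE => /nd_inj /perm_inj.
have im : [set tab_act (init_tab la) w k | k : 'I_n] == diagram la.
  apply/eqP/setP => X; apply/imsetP/idP => [[k _ ->]|hX].
    by rewrite tab_actE nd_diagram.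
  by have [k <-] := nd_surj hX; exists (w k); rewrite ?tab_actE ?permK.
rewrite /std_perm /is_std inj im /=; apply: (iffP andP).
  case=> /forallP h1 /forallP h2 i j /andP[E h].
  have /forallP/(_ (w j))/implyP := h1 (w i); have /forallP/(_ (w j))/implyP := h2 (w i).
  rewrite !tab_actE !permK => k1 k2.
  by case/orP: h => /andP[h3 h4]; [apply: k2|apply: k1]; apply/and3P; split.
move=> h; split; apply/forallP => k; apply/forallP => l; apply/implyP.
  rewrite !tab_actE => /and3P[E1 E2 E3].
  have := h (w^-1%g k) (w^-1%g l); rewrite !permKV; apply.
  by rewrite /nd_lt E1 /nrow /ncol (eqP E2) eqxx E3.
rewrite !tab_actE => /and3P[E1 E2 E3].
have := h (w^-1%g k) (w^-1%g l); rewrite !permKV; apply.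
by rewrite /nd_lt E1 /nrow /ncol (eqP E2) eqxx E3 orbT.
Qed.

(** Go first along the row of i, then along the column of j; the corner of this path
    belongs to the diagram. *)
Lemma std_perm_nw (w : 'S_n) i j : std_perm w -> nw (nd i) (nd j) -> (w i <= w j)%N.
Proof.
move=> /std_permP hw h; have /and3P[/eqP E h1 h2] := h.
have [ij|ne] := eqVneq i j; first by rewrite ij.
pose Z : node := ((nd j).1, ((nd i).2.1, (nd j).2.2)).
have hZ : Z \in diagram la.
  by apply: diagram_nw (nd_diagram j); rewrite /nw eqxx /=; apply/andP.
have [k Ek] := nd_surj hZ.
have rZ : nrow Z = nrow (nd i) by [].
have cZ : ncol Z = ncol (nd j) by [].
have sZ : Z.1 = (nd j).1 by [].
have l1 : (w i <= w k)%N.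
  have [->//|nk] := eqVneq i k; apply/ltnW/hw; rewrite /nd_lt Ek rZ cZ sZ E !eqxx /=.
  rewrite ltn_neqAle h2 andbT; apply/orP; left; apply/eqP => E2; case/eqP: nk.
  by apply: nd_inj; rewrite Ek; apply: node_eq.
apply: leq_trans l1 _.
have [->//|nk] := eqVneq k j; apply/ltnW/hw; rewrite /nd_lt Ek rZ cZ sZ !eqxx /=.
rewrite ltnn andbF /= ltn_neqAle h1 andbT; apply/eqP => E2; case/eqP: nk.
by apply: nd_inj; rewrite Ek; apply: node_eq.
Qed.

Lemma nd_lt_nw i j : nd_lt i j -> nw (nd i) (nd j).
Proof.
by case/andP => E /orP[] /andP[/eqP h1 h2]; rewrite /nw E h1 leqnn ?(ltnW h2).
Qed.

Lemma nd_lt_ltn i j : nd_lt i j -> (i < j)%N.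
Proof.
move=> h; rewrite -prec_nd nw_prec ?nd_lt_nw //; apply/eqP => E.
by move: h; rewrite /nd_lt E !ltnn !andbF.
Qed.

Lemma std_perm1 : std_perm 1%g.
Proof. by apply/std_permP => i j /nd_lt_ltn; rewrite !perm1. Qed.

Lemma tab_permP t : is_std la t -> tab_act (init_tab la) (tab_perm la t) = t.
Proof.
case/and4P => /injectiveP inj /eqP im _ _; rewrite /tab_perm.
case: pickP => [w /eqP //|no].
have hd k : t k \in diagram la by rewrite -im; apply/imsetP; exists k.
pose f k : 'I_n := Ordinal (rr_lt (hd k)).
have fi : injective f.
  by move=> i j /(congr1 val) /= E; apply: inj; apply: rr_inj.
have := no (perm fi)^-1%g; case/eqP; apply/ffunP => k; rewrite tab_actE invgK permE.
by apply: rr_inj; rewrite ?nd_diagram // rr_nd.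
Qed.

End Shape.
End Diagrams.

(** * Residues *)

Section Residues.
Variables p' d' n : nat.
Local Notation r := (p'.+1 * d'.+1)%N.
Local Notation node := (node p' d' n).
Local Notation mpart := (mpart p' d' n).
Variables (K : fieldType) (eps q : K) (Q : 'I_d'.+1 -> K).
Hypotheses (q0 : q != 0) (cyc0 : forall s : 'I_r, cyc_param eps Q s != 0).
Hypothesis hq : forall k, (0 < k <= n)%N -> q ^+ k != 1.
Hypothesis hsep : forall (s s' : 'I_r) k, s != s' -> (k < n)%N ->
  cyc_param eps Q s * q ^+ k != cyc_param eps Q s'.

(** The powers of q are kept separate because integral exponents of a single power
    are awkward to split. *)
Definition node_res (X : node) : K :=
  q ^ (ncol X)%:Z / q ^ (nrow X)%:Z * cyc_param eps Q X.1.

Lemma resE (t : tableau p' d' n) k : res eps q Q t k = node_res (t k).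
Proof. by rewrite /res /node_res expfzDr // invr_expz. Qed.

Lemma node_res_neq0 X : node_res X != 0.
Proof. by apply: mulf_neq0 => //; apply: mulf_neq0; rewrite ?invr_eq0; apply: expfz_neq0. Qed.

(** The factor by which gamma changes when two consecutive entries are exchanged. *)
Definition gfac (x y : K) : K := (q * x - y) * (x - q * y) / (x - y) ^+ 2.

Lemma gfacC x y : gfac x y = gfac y x.
Proof.
rewrite /gfac; congr (_ / _); first by ring.
by rewrite -[in RHS]sqrrN opprB.
Qed.

Lemma gfacZ a x y : a != 0 -> gfac (a * x) (a * y) = gfac x y.
Proof.
move=> a0; rewrite /gfac.
have -> : q * (a * x) - a * y = a * (q * x - y) by ring.
have -> : a * x - q * (a * y) = a * (x - q * y) by ring.
have -> : a * x - a * y = a * (x - y) by ring.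
rewrite mulrACA exprMn -expr2 invfM mulrACA divff ?mul1r //.
by rewrite expf_neq0.
Qed.

Section Shape.
Variable la : mpart.
Hypothesis hla : is_mpart la.

(** If the components agree, the exponents differ by at most n, and q ^ k is not 1 for
    0 < k <= n.  If they differ, the two hooks fit together into n nodes, so the
    difference of the contents is less than n, and the parameters are separated. *)
Lemma node_res_shift X Y (e : nat) : (e <= 1)%N ->
  X \in diagram la -> Y \in diagram la -> node_res X = q ^+ e * node_res Y ->
  X.1 = Y.1 /\ (ncol X + nrow Y = ncol Y + nrow X + e)%N.
Proof.
move=> e1 hX hY E.
have {}E : cyc_param eps Q X.1 * q ^+ (ncol X + nrow Y)
         = cyc_param eps Q Y.1 * q ^+ (ncol Y + nrow X + e).
  have := congr1 (fun z => z * (q ^+ nrow X * q ^+ nrow Y)) E.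
  rewrite /node_res -!exprnP => E'.
  have qX : q ^+ nrow X != 0 by rewrite expf_neq0.
  have qY : q ^+ nrow Y != 0 by rewrite expf_neq0.
  rewrite !exprD; apply: etrans (etrans _ E') _; by field; rewrite ?qX ?qY.
have [sE|ne] := eqVneq X.1 Y.1.
  split=> //; have {}E : q ^+ (ncol X + nrow Y) = q ^+ (ncol Y + nrow X + e).
    by apply: (mulfI (cyc0 X.1)); rewrite E sE.
  have b1 : (nrow Y + ncol X < n)%N := leq_trans (hook_size hla sE hX hY) (comp_size_le hla _).
  have b2 : (nrow X + ncol Y < n)%N := leq_trans (hook_size hla (esym sE) hY hX) (comp_size_le hla _).
  case: (ltngtP (ncol X + nrow Y) (ncol Y + nrow X + e)) => // lt.
    have : q ^+ ((ncol Y + nrow X + e) - (ncol X + nrow Y)) != 1 by apply: hq; lia.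
    by rewrite expfB // -E divff ?expf_neq0 // eqxx.
  have : q ^+ ((ncol X + nrow Y) - (ncol Y + nrow X + e)) != 1 by apply: hq; lia.
  by rewrite expfB // -E divff ?expf_neq0 // eqxx.
have b3 : (nrow X + ncol X + 1 + (nrow Y + ncol Y + 1) <= n)%N.
  apply: leq_trans (comp_size2_le hla ne); rewrite !addn1.
  by apply: leq_add; apply: hook_size.
exfalso; case: (leqP (ncol X + nrow Y) (ncol Y + nrow X + e)) => le.
  have : cyc_param eps Q Y.1 * q ^+ ((ncol Y + nrow X + e) - (ncol X + nrow Y)) != cyc_param eps Q X.1.
    by apply: hsep; [rewrite eq_sym|lia].
  case/eqP; apply: (mulIf (expf_neq0 (ncol X + nrow Y) q0)).
  by rewrite -mulrA -exprD subnK.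
have : cyc_param eps Q X.1 * q ^+ ((ncol X + nrow Y) - (ncol Y + nrow X + e)) != cyc_param eps Q Y.1.
  by apply: hsep => //; lia.
case/eqP; apply: (mulIf (expf_neq0 (ncol Y + nrow X + e) q0)).
by rewrite -mulrA -exprD subnK // ltnW.
Qed.

Local Notation nd := (nd la).
Local Notation std := (std_perm la).
Definition rho (i : 'I_n) : K := node_res (nd i).

Lemma rho_eq i j : rho i = rho j ->
  (nd i).1 = (nd j).1 /\ (ncol (nd i) + nrow (nd j) = ncol (nd j) + nrow (nd i))%N.
Proof.
by move=> E; have := @node_res_shift (nd i) (nd j) 0%N isT; rewrite addn0 mul1r; apply;
  rewrite ?nd_diagram.
Qed.

Lemma rho_q i j : rho i = q * rho j ->
  (nd i).1 = (nd j).1 /\ (ncol (nd i) + nrow (nd j) = ncol (nd j) + nrow (nd i) + 1)%N.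
Proof.
by move=> E; apply: (@node_res_shift (nd i) (nd j) 1%N isT); rewrite ?expr1 ?nd_diagram.
Qed.

Lemma eq_rho_nw i j : rho i = rho j -> (i < j)%N -> nw (nd i) (nd j).
Proof.
move=> /rho_eq[E h]; rewrite -(prec_nd hla) /prec /nw E eqxx ltnn /=; lia.
Qed.

Lemma node_between (w : 'S_n) i j Z : std w -> Z \in diagram la ->
  nw (nd i) Z -> nw Z (nd j) -> Z != nd i -> Z != nd j ->
  exists2 k, nd k = Z & (w i < w k < w j)%N.
Proof.
move=> hw hZ h1 h2 n1 n2; have [k Ek] := nd_surj hla hZ; exists k => //.
have l1 := std_perm_nw hla hw (i := i) (j := k); have l2 := std_perm_nw hla hw (i := k) (j := j).
rewrite Ek in l1 l2; move/(_ h1): l1; move/(_ h2): l2; rewrite !ltn_neqAle => -> ->; rewrite !andbT.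
by apply/andP; split; apply/eqP => /val_inj /perm_inj E; rewrite -Ek E eqxx in n1 n2.
Qed.

(** Nodes of equal residue lie on one diagonal, so the two corners of the rectangle
    they span carry two distinct entries strictly between w i and w j. *)
Lemma std_close_rho (w : 'S_n) i j : std w -> (w i < w j)%N -> (w j <= (w i).+2)%N -> rho i != rho j.
Proof.
move=> hw lt le; apply/eqP => E.
have [ij|ji|Eij] := ltngtP i j; last by move: lt; rewrite (val_inj Eij) ltnn.
2: by have := std_perm_nw hla hw (eq_rho_nw (esym E) ji); lia.
have := eq_rho_nw E ij; have [Ec Ed] := rho_eq E; case/and3P => _ h1 h2.
have ne : nd i != nd j by rewrite (inj_eq (nd_inj hla)) -(inj_eq val_inj) /= ltn_eqF.
have lrow : (nrow (nd i) < nrow (nd j))%N.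
  rewrite ltn_neqAle h1 andbT; apply/eqP => E2; case/eqP: ne; apply: node_eq => //; lia.
have lcol : (ncol (nd i) < ncol (nd j))%N by lia.
pose Z1 : node := ((nd i).1, ((nd i).2.1, (nd j).2.2)).
pose Z2 : node := ((nd i).1, ((nd j).2.1, (nd i).2.2)).
have r1 : nrow Z1 = nrow (nd i) by []. have c1 : ncol Z1 = ncol (nd j) by [].
have r2 : nrow Z2 = nrow (nd j) by []. have c2 : ncol Z2 = ncol (nd i) by [].
have d1 : nw (nd i) Z1 by rewrite /nw r1 c1 eqxx leqnn.
have d2 : nw Z1 (nd j) by rewrite /nw r1 c1 /= Ec eqxx leqnn h1.
have d3 : nw (nd i) Z2 by rewrite /nw r2 c2 eqxx leqnn h1.
have d4 : nw Z2 (nd j) by rewrite /nw r2 c2 /= Ec eqxx leqnn.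
have neq X Y : (nrow X != nrow Y) || (ncol X != ncol Y) -> X != Y.
  by apply: contraL => /eqP ->; rewrite !eqxx.
have [k1 Ek1 b1] : exists2 k, nd k = Z1 & (w i < w k < w j)%N.
  apply: (node_between hw (diagram_nw hla d2 (nd_diagram hla _)) d1 d2); apply: neq; clear -lrow lcol r1 c1 r2 c2; lia.
have [k2 Ek2 b2] : exists2 k, nd k = Z2 & (w i < w k < w j)%N.
  apply: (node_between hw (diagram_nw hla d4 (nd_diagram hla _)) d3 d4); apply: neq; clear -lrow lcol r1 c1 r2 c2; lia.
have E12 : w k1 = w k2 :> nat by clear -lt le b1 b2; lia.
have E3 : k1 = k2 by apply: (@perm_inj _ w); apply: val_inj.
by move: Ek1; rewrite E3 Ek2 => /(congr1 (@nrow _ _ _)); rewrite r1 r2; clear -lrow; lia.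
Qed.

Lemma gfac_eq0_row x : gfac x (q * x) = 0.
Proof. by rewrite /gfac subrr !mul0r. Qed.

(** Exchanging two consecutive entries breaks standardness only if they are neighbours in
    a row or a column, and then their residues differ by the factor q. *)
Lemma std_swap_gfac (w : 'S_n) (i : 'I_n) : (0 < i)%N -> std w ->
  ~~ std (w * simple_refl i)%g ->
  let A := (w^-1)%g (ord_pred i) in let B := (w^-1)%g i in
  (A < B)%N /\ gfac (rho A) (rho B) = 0.
Proof.
move=> i0 hw nw' A B.
have wA : w A = ord_pred i by rewrite permKV.
have wB : w B = i by rewrite permKV.
have vp := val_ord_pred i0.
have AB : nd_lt la A B.
  apply: contraNT nw' => nAB; apply/(std_permP hla) => c e ce.
  have lt := (std_permP hla _ hw) _ _ ce; rewrite !permM.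
  have nce : ~ ((w c = i.-1 :> nat) /\ (w e = i :> nat)).
    case=> h1 h2; case/negP: nAB.
    have -> : A = c by apply: (@perm_inj _ w); apply: val_inj; rewrite wA /= h1.
    by have -> : B = e by apply: (@perm_inj _ w); apply: val_inj; rewrite wB /= h2.
  have := simple_refl_cases (w c) i0; have := simple_refl_cases (w e) i0; lia.
split; first exact: nd_lt_ltn AB.
have adj Z : Z \in diagram la -> nw (nd A) Z -> nw Z (nd B) -> (Z == nd A) || (Z == nd B).
  move=> hZ h1 h2; apply: contraT; rewrite negb_or => /andP[n1 n2].
  by have [k _] := node_between hw hZ h1 h2 n1 n2; rewrite wA wB; clear -vp i0; lia.
have /andP[/eqP Ec h] := AB.
have cases : (nrow (nd A) = nrow (nd B) /\ ncol (nd B) = (ncol (nd A)).+1) \/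
             (ncol (nd A) = ncol (nd B) /\ nrow (nd B) = (nrow (nd A)).+1).
  case/orP: h => /andP[/eqP E1 lt]; [left|right]; split=> //.
    have hc : ((ncol (nd A)).+1 < n)%N by apply: leq_ltn_trans lt (ltn_ord _).
    pose Z : node := ((nd A).1, ((nd A).2.1, Ordinal hc)).
    have rZ : nrow Z = nrow (nd A) by []. have cZ : ncol Z = (ncol (nd A)).+1 by [].
    have d1 : nw (nd A) Z by rewrite /nw rZ cZ eqxx leqnn /=.
    have d2 : nw Z (nd B) by rewrite /nw rZ cZ /= Ec eqxx -E1 leqnn lt.
    have := adj Z (diagram_nw hla d2 (nd_diagram hla _)) d1 d2.
    by case/orP => /eqP EZ; [have := cZ; rewrite EZ; lia|rewrite -EZ cZ].
  have hc : ((nrow (nd A)).+1 < n)%N by apply: leq_ltn_trans lt (ltn_ord _).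
  pose Z : node := ((nd A).1, (Ordinal hc, (nd A).2.2)).
  have rZ : nrow Z = (nrow (nd A)).+1 by []. have cZ : ncol Z = ncol (nd A) by [].
  have d1 : nw (nd A) Z by rewrite /nw rZ cZ eqxx leqnn leqnSn.
  have d2 : nw Z (nd B) by rewrite /nw rZ cZ /= Ec eqxx -E1 leqnn lt.
  have := adj Z (diagram_nw hla d2 (nd_diagram hla _)) d1 d2.
  by case/orP => /eqP EZ; [have := rZ; rewrite EZ; lia|rewrite -EZ rZ].
rewrite /rho; case: cases => -[E1 E2].
  rewrite (_ : node_res (nd B) = q * node_res (nd A)) ?gfac_eq0_row //.
  by rewrite /node_res -!exprnP E1 E2 Ec exprS !mulrA.
rewrite gfacC (_ : node_res (nd A) = q * node_res (nd B)) ?gfac_eq0_row //.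
rewrite /node_res -!exprnP E1 E2 Ec exprS invfM.
by rewrite !mulrA [q * _]mulrC mulfK.
Qed.

(** By induction on k, the first k entries occupy the same nodes.  The nodes
    of the entry k have equal residue, so one is north-west of the other, and it would already be
    filled in one of the tableaux. *)
Lemma std_rho_inj (w w' : 'S_n) : std w -> std w' ->
  (forall k, rho ((w^-1)%g k) = rho ((w'^-1)%g k)) -> w = w'.
Proof.
move=> hw hw' E; apply: invg_inj; apply/permP => k.
have [m] := ubnP (k : nat); elim: m k => // m IH k; rewrite ltnS => km.
set c := (w^-1)%g k; set e := (w'^-1)%g k.
have {}IH (j : 'I_n) : (j < k)%N -> (w^-1)%g j = (w'^-1)%g j by move=> jk; apply: IH; lia.
have wc : w c = k by rewrite permKV. have we : w' e = k by rewrite permKV.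
have [lt|lt|/val_inj //] := ltngtP c e; exfalso.
  have := std_perm_nw hla hw' (eq_rho_nw (E k) lt); rewrite we leq_eqVlt => /orP[/eqP h|h].
    have ce : c = e by apply: (@perm_inj _ w'); apply: val_inj; rewrite /= h we.
    by rewrite ce ltnn in lt.
  have := IH _ h; rewrite permK => h2.
  have : w c = w' c by apply: (@perm_inj _ w^-1%g); rewrite permK h2.
  by rewrite wc => h3; rewrite -h3 ltnn in h.
have := std_perm_nw hla hw (eq_rho_nw (esym (E k)) lt); rewrite wc leq_eqVlt => /orP[/eqP h|h].
  have ce : e = c by apply: (@perm_inj _ w); apply: val_inj; rewrite /= h wc.
  by rewrite ce ltnn in lt.
have := IH _ h; rewrite permK => h2.
have : w' e = w e by apply: (@perm_inj _ w'^-1%g); rewrite permK -h2.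
by rewrite we => h3; rewrite -h3 ltnn in h.
Qed.

Lemma std_first (w : 'S_n) (k : 'I_n) : k = 0%N :> nat -> std w ->
  nrow (nd ((w^-1)%g k)) = 0%N /\ ncol (nd ((w^-1)%g k)) = 0%N.
Proof.
move=> k0 hw; set c := (w^-1)%g k.
pose Z : node := ((nd c).1, (k, k)).
have rZ : nrow Z = 0%N by []. have cZ : ncol Z = 0%N by [].
have d : nw Z (nd c) by rewrite /nw rZ cZ eqxx.
have [u Eu] := nd_surj hla (diagram_nw hla d (nd_diagram hla c)).
have := std_perm_nw hla hw (i := u) (j := c); rewrite Eu => /(_ d); rewrite permKV k0 leqn0 => /eqP h.
have -> : c = u by apply: (@perm_inj _ w); apply: val_inj; rewrite permKV /= h.
by rewrite Eu.
Qed.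

(** The factor vanishes or has a pole only for equal or adjacent residues; these force
    a north-west relation, and such a pair is never inverted. *)
Lemma std_inv_gfac (w : 'S_n) (i j : 'I_n) : std w -> (i < j)%N -> (w j < w i)%N ->
  gfac (rho i) (rho j) != 0.
Proof.
move=> hw ij lt.
have nnw : ~~ nw (nd i) (nd j).
  by apply/negP => /(std_perm_nw hla hw); lia.
have := ij; rewrite -(prec_nd hla) /prec => hp.
rewrite /gfac !mulf_neq0 // ?invr_eq0 ?expf_neq0 // subr_eq0; apply/eqP => E;
  apply/negP: nnw; move: hp; rewrite /nw.
- by have [-> h] := rho_q (esym E); rewrite eqxx ltnn /=; lia.
- by have [-> h] := rho_q E; rewrite eqxx ltnn /=; lia.
by have [-> h] := rho_eq E; rewrite eqxx ltnn /=; lia.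
Qed.

End Shape.
End Residues.

(** * The seminormal form *)

Section SeminormalCoefficients.
Variables (K : fieldType) (q : K).

(** The diagonal coefficient of T_i in the seminormal form, for the residues x and y
    of i - 1 and i. *)
Definition sn_diag (x y : K) : K := (q - 1) * y / (y - x).

Lemma sn_diag_add x y : x != y -> sn_diag x y + sn_diag y x = q - 1.
Proof.
move=> ne; have h1 : y - x != 0 by rewrite subr_eq0 eq_sym.
have h2 : x - y != 0 by rewrite subr_eq0.
by rewrite /sn_diag; field; rewrite h1 h2.
Qed.

Lemma sn_diag_quad x y : x != y -> sn_diag x y ^+ 2 + gfac q x y = (q - 1) * sn_diag x y + q.
Proof.
move=> ne; have h1 : y - x != 0 by rewrite subr_eq0 eq_sym.
have h2 : x - y != 0 by rewrite subr_eq0.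
by rewrite /sn_diag /gfac; field; rewrite h1 h2.
Qed.

Lemma sn_diag_res x y : x != y -> sn_diag x y * x + sn_diag y x * y = 0.
Proof.
move=> ne; have h1 : y - x != 0 by rewrite subr_eq0 eq_sym.
have h2 : x - y != 0 by rewrite subr_eq0.
by rewrite /sn_diag; field; rewrite h1 h2.
Qed.

(** Together with the preceding identity, this turns T_i L_i T_i into q L_(i+1). *)
Lemma sn_diag_JM x y : x != y -> sn_diag x y ^+ 2 * x + gfac q x y * y = q * y.
Proof.
move=> ne; have h1 : y - x != 0 by rewrite subr_eq0 eq_sym.
have h2 : x - y != 0 by rewrite subr_eq0.
by rewrite /sn_diag /gfac; field; rewrite h1 h2.
Qed.

Lemma sn_diag_braid x y z : x != y -> x != z -> y != z ->
  sn_diag x y * sn_diag y z + sn_diag x z * sn_diag y x - sn_diag y z * sn_diag x z = 0.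
Proof.
move=> xy xz yz.
have h1 : y - x != 0 by rewrite subr_eq0 eq_sym.
have h2 : x - y != 0 by rewrite subr_eq0.
have h3 : z - x != 0 by rewrite subr_eq0 eq_sym.
have h4 : z - y != 0 by rewrite subr_eq0 eq_sym.
by rewrite /sn_diag; field; rewrite h1 h2 h3 h4.
Qed.

Lemma sn_diag_braid' x y z : x != y -> x != z -> y != z ->
  sn_diag y z * sn_diag x y + sn_diag x z * sn_diag z y - sn_diag x y * sn_diag x z = 0.
Proof.
move=> xy xz yz.
have h1 : y - x != 0 by rewrite subr_eq0 eq_sym.
have h3 : z - x != 0 by rewrite subr_eq0 eq_sym.
have h4 : z - y != 0 by rewrite subr_eq0 eq_sym.
have h5 : y - z != 0 by rewrite subr_eq0.
by rewrite /sn_diag; field; rewrite h1 h3 h4 h5.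
Qed.

Lemma sn_diag_braid_id x y z : x != y -> x != z -> y != z ->
  sn_diag x y ^+ 2 * sn_diag y z + gfac q x y * sn_diag x z
  = sn_diag y z ^+ 2 * sn_diag x y + gfac q y z * sn_diag x z.
Proof.
move=> xy xz yz.
have -> : gfac q x y = (q - 1) * sn_diag x y + q - sn_diag x y ^+ 2.
  by rewrite -sn_diag_quad // addrC addKr.
have -> : gfac q y z = (q - 1) * sn_diag y z + q - sn_diag y z ^+ 2.
  by rewrite -sn_diag_quad // addrC addKr.
have h1 : y - x != 0 by rewrite subr_eq0 eq_sym.
have h3 : z - x != 0 by rewrite subr_eq0 eq_sym.
have h4 : z - y != 0 by rewrite subr_eq0 eq_sym.
by rewrite /sn_diag; field; rewrite h1 h3 h4.
Qed.

End SeminormalCoefficients.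

Section DiagonalOperators.
Variables (K : fieldType) (X : finType) (x0 : X).
Local Notation N1 := ((mxdim X).+1).

(** Diagonal matrices are the local operators with trivial off-diagonal part. *)
Definition dgmx (c : X -> K) : 'M[K]_N1 := opmx x0 c (fun=> 0) id.

Lemma dgmxM c p (A : 'M[K]_(N1, p)) x j : (dgmx c *m A) (enc x0 x) j = c x * A (enc x0 x) j.
Proof. by rewrite opmxM /op mul0r addr0. Qed.

Lemma Mdgmx c p (A : 'M[K]_(p, N1)) i y : (A *m dgmx c) i (enc x0 y) = A i (enc x0 y) * c y.
Proof. by rewrite Mopmx // mulr0 addr0. Qed.

Lemma dgmxE c x j : dgmx c (enc x0 x) j = c x * (1%:M : 'M[K]_N1) (enc x0 x) j.
Proof. by rewrite -[dgmx c]mulmx1 dgmxM. Qed.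

Lemma dgmx_mul c e : dgmx c * dgmx e = dgmx (fun x => c x * e x).
Proof.
by apply: (mxX_ext (x0 := x0)) => x j; rewrite [LHS]dgmxM !dgmxE mulrA.
Qed.

Lemma dgmx_scalar a : a%:A = dgmx (fun=> a).
Proof. by apply: (mxX_ext (x0 := x0)) => x j; rewrite dgmxE [LHS]mxE. Qed.

Lemma dgmx_sub c e : dgmx c - dgmx e = dgmx (fun x => c x - e x).
Proof.
by apply: (mxX_ext (x0 := x0)) => x j; rewrite [LHS]mxE [X in _ + X = _]mxE !dgmxE mulrBl.
Qed.

Lemma dgmx_scale a c : a *: dgmx c = dgmx (fun x => a * c x).
Proof. by apply: (mxX_ext (x0 := x0)) => x j; rewrite [LHS]mxE !dgmxE mulrA. Qed.

Lemma eq_dgmx c e : c =1 e -> dgmx c = dgmx e.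
Proof. by move=> E; apply: (mxX_ext (x0 := x0)) => x j; rewrite !dgmxE E. Qed.

Lemma dgmx_prod (I : Type) (s : seq I) (P : pred I) (c : I -> X -> K) :
  \prod_(i <- s | P i) dgmx (c i) = dgmx (fun x => \prod_(i <- s | P i) c i x).
Proof.
elim: s => [|i s IH].
  rewrite big_nil -[1]scale1r dgmx_scalar; apply: eq_dgmx => x; by rewrite big_nil.
rewrite big_cons IH; case: ifP => Pi; rewrite ?dgmx_mul; apply: eq_dgmx => x;
  by rewrite big_cons Pi.
Qed.

Lemma dgmx_exp c k : dgmx c ^+ k = dgmx (fun x => c x ^+ k).
Proof.
elim: k => [|k IH]; first by rewrite expr0 -[1]scale1r dgmx_scalar.
by rewrite exprS IH dgmx_mul; apply: eq_dgmx => x; rewrite exprS.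
Qed.

Lemma dgmx0 : dgmx (fun=> 0) = 0.
Proof. by apply: (mxX_ext (x0 := x0)) => x j; rewrite dgmxE mul0r mxE. Qed.

End DiagonalOperators.

Section Seminormal.
Variables p' d' n : nat.
Local Notation r := (p'.+1 * d'.+1)%N.
Local Notation mpart := (mpart p' d' n).
Variables (K : fieldType) (eps q : K) (Q : 'I_d'.+1 -> K).
Hypotheses (q0 : q != 0) (cyc0 : forall s : 'I_r, cyc_param eps Q s != 0).
Hypothesis eps_root : eps ^+ p'.+1 = 1.
Hypothesis hq : forall k, (0 < k <= n)%N -> q ^+ k != 1.
Hypothesis hsep : forall (s s' : 'I_r) k, s != s' -> (k < n)%N ->
  cyc_param eps Q s * q ^+ k != cyc_param eps Q s'.
Hypothesis n1 : (1 < n)%N.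
Variable la : mpart.
Hypothesis hla : is_mpart la.

Local Notation nd := (nd la).
Local Notation std := (@std_perm p' d' n la).
Local Notation rho := (@rho p' d' n K eps q Q la).
Local Notation x0 := (1%g : 'S_n).
Local Notation N1 := ((mxdim 'S_n).+1).
Local Notation MX := 'M[K]_N1.

(** The basis is indexed by permutations; w stands for the tableau t^la w, and the
    entry k of this tableau sits where t^la has the entry w^-1 k. *)
Definition entry_pos (k : 'I_n) (w : 'S_n) : 'I_n := (w^-1)%g k.
Definition rmul_refl (i : 'I_n) (w : 'S_n) : 'S_n := (w * simple_refl i)%g.
Definition sn_a (A B : 'I_n) : K := sn_diag q (rho A) (rho B).
(** Only the product of the two off-diagonal coefficients matters for the relations;
    putting all of it on one side collects the factors of gamma along a reduced
    word. *)
Definition sn_b (A B : 'I_n) : K := if (A < B)%N then gfac q (rho A) (rho B) else 1.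
Definition snmx (i : 'I_n) : MX := locmx q x0 std entry_pos rmul_refl sn_a sn_b i.

Lemma rmul_reflK i : involutive (rmul_refl i).
Proof. by move=> w; rewrite /rmul_refl simple_reflK. Qed.

Lemma rmul_refl_far (i j : 'I_n) w : (0 < i)%N -> (i.+1 < j)%N ->
  rmul_refl i (rmul_refl j w) = rmul_refl j (rmul_refl i w).
Proof. by move=> i0 ij; rewrite /rmul_refl -!mulgA (simple_refl_far i0 ij). Qed.

Lemma rmul_refl_braid (i j : 'I_n) w : (0 < i)%N -> i.+1 = j ->
  rmul_refl i (rmul_refl j (rmul_refl i w)) = rmul_refl j (rmul_refl i (rmul_refl j w)).
Proof.
by move=> i0 ij; have := simple_refl_braid i0 ij; rewrite /rmul_refl -!mulgA => ->.
Qed.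

Lemma pos_refl i k w : entry_pos k (rmul_refl i w) = entry_pos (simple_refl i k) w.
Proof. by rewrite /entry_pos /rmul_refl invMg simple_reflV permM. Qed.

Lemma pos_rho_neq (w : 'S_n) (k l : 'I_n) : std w -> (k < l)%N -> (l <= k.+2)%N ->
  rho (entry_pos k w) != rho (entry_pos l w).
Proof.
by move=> hw kl lk; apply: (std_close_rho q0 cyc0 hq hsep hla hw); rewrite !permKV.
Qed.

Lemma sn_bC A B : A != B -> sn_b A B * sn_b B A = gfac q (rho A) (rho B).
Proof.
rewrite -(inj_eq val_inj) /sn_b; case: (ltngtP A B) => //= _ _; rewrite ?mulr1 ?mul1r //.
exact: gfacC.
Qed.

Lemma sn_std (i : 'I_n) w : (0 < i)%N -> std w -> ~~ std (rmul_refl i w) ->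
  sn_b (entry_pos (ord_pred i) w) (entry_pos i w) = 0.
Proof.
by move=> i0 hw nw; have [lt E] := std_swap_gfac eps Q q0 hla i0 hw nw; rewrite /sn_b lt.
Qed.

Lemma sn_quad (i : 'I_n) w : (0 < i)%N -> std w ->
  let A := entry_pos (ord_pred i) w in let B := entry_pos i w in
  sn_a A B ^+ 2 + sn_b A B * sn_b B A = (q - 1) * sn_a A B + q
  /\ sn_b A B * (sn_a A B + sn_a B A - (q - 1)) = 0.
Proof.
move=> i0 hw A B; have vp := val_ord_pred i0.
have ne : rho A != rho B by apply: pos_rho_neq => //; lia.
have AB : A != B by apply: contraNneq ne => ->.
by rewrite sn_bC // sn_diag_quad // /sn_a sn_diag_add // subrr mulr0.
Qed.

Lemma sn_braid (i j : 'I_n) w : (0 < i)%N -> i.+1 = j -> std w ->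
  let A := entry_pos (ord_pred i) w in let B := entry_pos i w in let C := entry_pos j w in
  [/\ sn_a A B ^+ 2 * sn_a B C + sn_b A B * sn_b B A * sn_a A C
    = sn_a B C ^+ 2 * sn_a A B + sn_b B C * sn_b C B * sn_a A C,
  sn_b A B * (sn_a A B * sn_a B C + sn_a A C * sn_a B A - sn_a B C * sn_a A C) = 0 &
  sn_b B C * (sn_a B C * sn_a A B + sn_a A C * sn_a C B - sn_a A B * sn_a A C) = 0].
Proof.
move=> i0 ij hw A B C; have vp := val_ord_pred i0.
have nAB : rho A != rho B by apply: pos_rho_neq => //; lia.
have nBC : rho B != rho C by apply: pos_rho_neq => //; lia.
have nAC : rho A != rho C by apply: pos_rho_neq => //; lia.
have AB : A != B by apply: contraNneq nAB => ->.
have BC : B != C by apply: contraNneq nBC => ->.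
rewrite !sn_bC //; split; first exact: sn_diag_braid_id.
  by rewrite sn_diag_braid // mulr0.
by rewrite sn_diag_braid' // mulr0.
Qed.

Lemma snmx_quad (i : 'I_n) : (0 < i)%N -> (snmx i - q%:A) * (snmx i + 1) = 0.
Proof.
move=> i0; apply: locmx_quad => //.
- exact: rmul_reflK.
- exact: pos_refl.
- exact: sn_std.
- exact: sn_quad.
Qed.

Lemma snmx_far (i j : 'I_n) : (0 < i)%N -> (i.+1 < j)%N -> snmx i * snmx j = snmx j * snmx i.
Proof.
move=> i0 ij; apply: locmx_far_comm => //.
- exact: rmul_refl_far.
- exact: pos_refl.
- exact: sn_std.
Qed.

Lemma snmx_braid (i j : 'I_n) : (0 < i)%N -> i.+1 = j ->
  snmx i * snmx j * snmx i = snmx j * snmx i * snmx j.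
Proof.
move=> i0 ij; apply: locmx_braid => //.
- exact: rmul_reflK.
- exact: rmul_refl_braid.
- exact: pos_refl.
- exact: sn_std.
- exact: sn_braid.
Qed.

(** At the other permutations the algebra acts by the character that maps T_0 to
    Q 0 and every T_i to q, and this is the value of L_k there. *)
Definition jm_val (k : 'I_n) (w : 'S_n) : K :=
  if std w then rho (entry_pos k w) else q ^+ k * Q ord0.
Definition jmmx (k : 'I_n) : MX := dgmx x0 (jm_val k).

Lemma snmx_jm (i : 'I_n) : (0 < i)%N -> snmx i * jmmx (ord_pred i) * snmx i = q *: jmmx i.
Proof.
move=> i0; have vp := val_ord_pred i0.
rewrite /jmmx dgmx_scale; apply: (mxX_ext (x0 := x0)) => w j; rewrite -mulrA.
rewrite [LHS]locmxM dgmxE.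
pose f w : K := (1%:M : MX) (enc x0 w) j.
have E v : std v -> (jmmx (ord_pred i) * snmx i) (enc x0 v) j =
    rho (entry_pos (ord_pred i) v) * (sn_a (entry_pos (ord_pred i) v) (entry_pos i v) * f v +
     sn_b (entry_pos (ord_pred i) v) (entry_pos i v) * f (rmul_refl i v)).
  move=> hv; rewrite [LHS]dgmxM /jm_val hv locmxE.
  by rewrite (loc_op_std _ _ sn_std i0 hv (fun _ _ => erefl)).
have [hw|nw] := boolP (std w); last first.
  rewrite loc_op_nstd // [in LHS]dgmxM locmxE loc_op_nstd // /jm_val (negbTE nw).
  by rewrite vp -[in RHS](prednK i0) exprS; move: (1%:M _ _) => z; ring.
rewrite (loc_op_std _ _ sn_std i0 hw E) /op !pos_refl simple_refl_pred simple_refl_self.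
rewrite rmul_reflK /jm_val hw -/(f w).
set A := entry_pos (ord_pred i) w; set B := entry_pos i w.
have ne : rho A != rho B by apply: pos_rho_neq => //; lia.
have AB : A != B by apply: contraNneq ne => ->.
have c1 := sn_diag_JM q ne; have c2 := sn_diag_res q ne.
rewrite -sn_bC // -/(sn_a A B) in c1; rewrite -/(sn_a A B) -/(sn_a B A) in c2.
move: (f w) (f (rmul_refl i w)) => f1 f2.
apply/eqP; rewrite -subr_eq0; apply/eqP.
transitivity (f1 * ((sn_a A B ^+ 2 * rho A + sn_b A B * sn_b B A * rho B) - q * rho B)
  + sn_b A B * f2 * (sn_a A B * rho A + sn_a B A * rho B)); first by ring.
by rewrite c1 c2; ring.
Qed.

End Seminormal.

(** * The structure constants of the seminormal basis *)

Section SeminormalRep.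
Variables p' d' n : nat.
Local Notation r := (p'.+1 * d'.+1)%N.
Local Notation mpart := (mpart p' d' n).
Variables (K : fieldType) (eps q : K) (Q : 'I_d'.+1 -> K).
Hypotheses (q0 : q != 0) (cyc0 : forall s : 'I_r, cyc_param eps Q s != 0).
Hypothesis heps : p'.+1.-primitive_root eps.
Hypothesis hq : forall k, (0 < k <= n)%N -> q ^+ k != 1.
Hypothesis hsep : forall (s s' : 'I_r) k, s != s' -> (k < n)%N ->
  cyc_param eps Q s * q ^+ k != cyc_param eps Q s'.
Hypothesis hqint : forall k, (0 < k <= n)%N -> qint q k != 0.
Hypothesis n1 : (1 < n)%N.
Variables (H : algType K) (T : nat -> H) (star : {linear H -> H}).
Hypotheses (hH : is_hecke_algebra p' n q Q T) (hstar : is_star n T star).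
Variable la : mpart.
Hypothesis hla : is_mpart la.

Local Notation nd := (nd la).
Local Notation std := (@std_perm p' d' n la).
Local Notation rho := (@rho p' d' n K eps q Q la).
Local Notation x0 := (1%g : 'S_n).
Local Notation N1 := ((mxdim 'S_n).+1).
Local Notation MX := 'M[K]_N1.
Local Notation en := (enc x0).
Local Notation snmx := (@snmx p' d' n K eps q Q la).
Local Notation jmmx := (@jmmx p' d' n K eps q Q la).
Local Notation jm_val := (@jm_val p' d' n K eps q Q la).
Local Notation sn_a := (@sn_a p' d' n K eps q Q la).
Local Notation sn_b := (@sn_b p' d' n K eps q Q la).
Let o : 'I_n := Ordinal (ltnW n1).

Let rel : hecke_relations p' n q Q T. Proof. by case: hH. Qed.

Let snstd (i : 'I_n) (w : 'S_n) : (0 < i)%N -> std w -> ~~ std (rmul_refl i w) ->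
  sn_b (entry_pos (ord_pred i) w) (entry_pos i w) = 0.
Proof. exact: sn_std. Qed.

(** The entry 0 sits in the first row and column of its component, so its residue is
    a parameter; its p-th power is some Q_c ^ p. *)
Lemma jmmx_root : \prod_(c < d'.+1) (jmmx o ^+ p'.+1 - (Q c ^+ p'.+1)%:A) = 0.
Proof.
rewrite -(dgmx0 K x0).
under eq_bigr => c _ do rewrite dgmx_exp (dgmx_scalar x0) dgmx_sub.
rewrite dgmx_prod; apply: eq_dgmx => w; rewrite /jm_val.
have [hw|nw] := boolP (std w); last first.
  by rewrite (bigD1 ord0) //= expr0 mul1r subrr mul0r.
have [r0 c0] := std_first hla (erefl : o = 0%N :> nat) hw.
rewrite (bigD1 (inord ((nd (entry_pos o w)).1 %% d'.+1))) //= /rho /node_res /entry_pos r0 c0 divr1 mul1r.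
by rewrite (cyc_paramXp Q heps) subrr mul0r.
Qed.

Lemma jmmx_comm (k i : 'I_n) : (0 < i)%N -> (k < i.-1)%N -> jmmx k * snmx i = snmx i * jmmx k.
Proof.
move=> i0 ki; apply: (mxX_ext (x0 := x0)) => w j.
rewrite [LHS]dgmxM [RHS]locmxM locmxE.
have [hw|nw] := boolP (std w); last first.
  by rewrite !loc_op_nstd // dgmxE mulrCA.
pose f w : K := (1%:M : MX) (en w) j.
rewrite (loc_op_std _ _ snstd i0 hw (fun _ _ => erefl)) /op /=.
rewrite /loc_a /loc_b hw !dgmxE -!/(f _) mulrDr; congr (_ + _); first by rewrite mulrCA.
have [hs|ns] := boolP (std (rmul_refl i w)); last by rewrite snstd // !mul0r mulr0.
rewrite [RHS]mulrCA; congr (_ * _); rewrite /jm_val hw hs pos_refl.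
by rewrite simple_refl_fix //; lia.
Qed.

Lemma sn_hecke : hecke_relations p' n q Q (extend_gens (jmmx o) snmx).
Proof.
apply: extend_gens_hecke => //.
- exact: jmmx_root.
- by move=> i i1; apply: jmmx_comm; rewrite /=; lia.
- move=> i i1; have i0 : (0 < i)%N by rewrite i1.
  have Eo : o = ord_pred i by apply/val_inj; rewrite [RHS]val_ord_pred // i1.
  have := snmx_jm q0 cyc0 hq hsep n1 hla i0; rewrite -Eo => E.
  have -> : jmmx o * snmx i * jmmx o * snmx i = jmmx o * (snmx i * jmmx o * snmx i).
    by rewrite !mulrA.
  rewrite !E -scalerAl -scalerAr !dgmx_mul; congr (_ *: _).
  by apply: eq_dgmx => w; rewrite mulrC.
- by move=> i i0; apply: snmx_quad.
- by move=> i j i0 ij; apply: snmx_far.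
- by move=> i j i0 ij; apply: snmx_braid.
Qed.

Lemma sn_rep : exists Rho : {lrmorphism H -> MX},
  Rho (T 0%N) = jmmx o /\ forall i : 'I_n, (0 < i)%N -> Rho (T i) = snmx i.
Proof.
case: hH => _ ex _; have [Rho hR] := ex _ _ sn_hecke.
exists Rho; split; first by rewrite hR ?(ltnW n1).
by move=> i i0; rewrite hR // extend_gensE.
Qed.

Section Rep.
Variable Rho : {lrmorphism H -> MX}.
Hypothesis Rho0 : Rho (T 0%N) = jmmx o.
Hypothesis RhoT : forall i : 'I_n, (0 < i)%N -> Rho (T i) = snmx i.

(** The coefficient that leads from a standard permutation to another one vanishes for
    every generator. *)
Lemma Rho_block h (w v : 'S_n) : std w -> ~~ std v -> Rho h (en w) (en v) = 0.
Proof.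
move: h w v; apply: (hecke_ind n1 hH) => [w v hw nv|x y hx hy w v hw nv|a x y hx hy w v hw nv|i hi w v hw nv].
- rewrite rmorph1 mxE (inj_eq (can_inj (encK _))); case: eqP => // E.
  by rewrite -E hw in nv.
- rewrite rmorphM [LHS]mxE (sum_enc x0) big1 // => u _.
  by have [hu|nu] := boolP (std u); [rewrite hy // mulr0|rewrite hx // mul0r].
- by rewrite linearP [LHS]mxE [X in X + _ = _]mxE hx // hy // mulr0 addr0.
case: (posnP i) => [->|i0].
  rewrite Rho0 dgmxE mxE (inj_eq (can_inj (encK _))); case: eqP => [E|_]; last by rewrite mulr0.
  by rewrite -E hw in nv.
rewrite (RhoT (i := Ordinal hi)) // [LHS]opmxE /loc_b hw.
have -> : w == v = false by apply/negbTE/eqP => E; rewrite -E hw in nv.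
rewrite mulr0n add0r; case: eqP => [E|_]; last by rewrite mulr0n.
by rewrite -E in nv; rewrite snstd.
Qed.

Lemma Rho_L (k : 'I_n) : Rho (L q T k) = jmmx k.
Proof.
case: k => k /=; elim: k => [|k IH] hk; first by rewrite Rho0; congr (jmmx _); apply: val_inj.
have hk' : (k < n)%N by lia.
rewrite linearZ /= !rmorphM /= IH // (RhoT (i := Ordinal hk)) //.
have Ep : Ordinal hk' = ord_pred (Ordinal hk) by apply/val_inj; rewrite [RHS]val_ord_pred.
by rewrite Ep snmx_jm // scalerA mulVf // scale1r.
Qed.

Lemma RhoZ a h : Rho (a *: h) = a *: Rho h.
Proof. exact: linearZ. Qed.

Lemma RhoB x y : Rho (x - y) = Rho x - Rho y.
Proof. exact: rmorphB. Qed.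

Lemma RhoM x y : Rho (x * y) = Rho x * Rho y.
Proof. exact: rmorphM. Qed.

Lemma Rho1 : Rho 1 = 1.
Proof. exact: rmorph1. Qed.

Lemma Rho_prod (I : Type) (s : seq I) (P : pred I) (F : I -> H) :
  Rho (\prod_(i <- s | P i) F i) = \prod_(i <- s | P i) Rho (F i).
Proof. exact: rmorph_prod. Qed.

Lemma Rho_sum (I : Type) (s : seq I) (P : pred I) (F : I -> H) :
  Rho (\sum_(i <- s | P i) F i) = \sum_(i <- s | P i) Rho (F i).
Proof. exact: rmorph_sum. Qed.

Lemma Rho_L_sub (k : 'I_n) c : Rho (L q T k - c%:A) = dgmx x0 (fun v => jm_val k v - c).
Proof. by rewrite RhoB RhoZ Rho1 Rho_L (dgmx_scalar x0) dgmx_sub. Qed.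

Definition tab (w : 'S_n) : tableau p' d' n := tab_act (init_tab la) w.

Lemma res_tab w k : res eps q Q (tab w) k = rho (entry_pos k w).
Proof. by rewrite resE // /tab tab_actE. Qed.

(** F_t is a product of interpolation factors in the L_k.  Its eigenvalue at another
    standard v contains the factor for the residue of some k at v, because residue
    sequences determine standard tableaux. *)
Lemma Rho_F (w : 'S_n) : std w -> exists F, [/\ Rho (F_ eps q Q T (tab w)) = dgmx x0 F,
  F w = 1 & forall v, std v -> v != w -> F v = 0].
Proof.
move=> hw; pose t := tab w.
exists (fun v => \prod_(k < n) \prod_(c <- residues p' eps q Q k | c != res eps q Q t k)
  ((res eps q Q t k - c)^-1 * (jm_val k v - c))); split.
- rewrite /F_ Rho_prod -dgmx_prod; apply: eq_bigr => k _.
  rewrite Rho_prod -dgmx_prod; apply: eq_bigr => c _.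
  by rewrite RhoZ Rho_L_sub dgmx_scale.
- rewrite big1 // => k _; rewrite big1 // => c nc.
  by rewrite /jm_val hw res_tab mulVf // subr_eq0 -res_tab eq_sym.
move=> v hv nvw.
have [k nk] : exists k, rho (entry_pos k v) != rho (entry_pos k w).
  apply/existsP; apply: contraNT nvw; rewrite negb_exists => /forallP E.
  apply/eqP/(std_rho_inj q0 cyc0 hq hsep hla hv hw) => k.
  by have := E k; rewrite negbK => /eqP.
rewrite (bigD1 k) //=; apply/eqP; rewrite mulf_eq0; apply/orP; left.
rewrite prodf_seq_eq0; apply/hasP; exists (res eps q Q (tab v) k).
  rewrite mem_undup; apply/mapP; exists (tab v) => //.
  by rewrite mem_enum; apply/existsP; exists la; rewrite hla.
by rewrite /t !res_tab nk /= /jm_val hv subrr mulr0.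
Qed.

(** By gamma_formula this is gamma up to a constant of the shape. *)
Definition Gfac (w : 'S_n) : K := \prod_(ij in invset w) gfac q (rho ij.1) (rho ij.2).

Lemma Gfac1 : Gfac 1%g = 1.
Proof.
rewrite /Gfac big1 // => -[i j]; rewrite in_invset !perm1.
by case: ltngtP.
Qed.

Lemma Gfac_ascent (w : 'S_n) (i : 'I_n) : (0 < i)%N -> ascent w i ->
  Gfac (w * simple_refl i)%g = gfac q (rho (entry_pos (ord_pred i) w)) (rho (entry_pos i w)) * Gfac w.
Proof. by move=> i0 asc; rewrite /Gfac invset_ascent // big_setU1 ?invset_notin. Qed.

Lemma Gfac_neq0 w : std w -> Gfac w != 0.
Proof.
move=> hw; rewrite /Gfac; apply/prodf_neq0 => -[i j]; rewrite in_invset => /andP[ij lt].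
exact: (std_inv_gfac q0 cyc0 hq hsep hla hw ij lt).
Qed.

(** A word reaches only permutations of at most its length. *)
Lemma Tword_Rho_short s (v : 'S_n) : all (fun i : 'I_n => 0 < i)%N s ->
  (size s < perm_length v)%N -> Rho (Tword T s) (en x0) (en v) = 0.
Proof.
elim/last_ind: s v => [|s i IH] v.
  rewrite /Tword big_nil Rho1 mxE (inj_eq (can_inj (encK _))) => _; case: eqP => // <-.
  by rewrite perm_length1.
rewrite all_rcons size_rcons => /andP[i0 s0] lt.
rewrite Tword_rcons RhoM RhoT // [LHS]Mopmx; last exact: rmul_reflK.
rewrite !IH ?mul0r ?addr0 //; last by lia.
have [a|d] := boolP (ascent v i); first by rewrite perm_length_ascent //; lia.
by have := perm_length_descent i0 d; rewrite /rmul_refl; lia.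
Qed.

Lemma star_Tword_rcons s (i : 'I_n) : star (Tword T (rcons s i)) = T i * star (Tword T s).
Proof. by case: hstar => _ sM sT; rewrite Tword_rcons sM sT. Qed.

Lemma star_Tword_nil : star (Tword T ([::] : seq 'I_n)) = 1.
Proof. by case: hstar => s1 _ _; rewrite /Tword big_nil. Qed.

Lemma star_Tword_Rho_short s (v : 'S_n) : all (fun i : 'I_n => 0 < i)%N s ->
  (size s < perm_length v)%N -> Rho (star (Tword T s)) (en v) (en x0) = 0.
Proof.
elim/last_ind: s v => [|s i IH] v.
  rewrite star_Tword_nil Rho1 mxE (inj_eq (can_inj (encK _))) => _; case: eqP => // ->.
  by rewrite perm_length1.
rewrite all_rcons size_rcons => /andP[i0 s0] lt.
rewrite star_Tword_rcons RhoM RhoT // [LHS]locmxM /op.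
rewrite !IH ?mulr0 ?addr0 //; last by lia.
have [a|d] := boolP (ascent v i); first by rewrite perm_length_ascent //; lia.
by have := perm_length_descent i0 d; rewrite /rmul_refl; lia.
Qed.

(** In a standard tableau the smaller of two neighbours in a row or a column comes first,
    so the exchange at a descent does not affect such a pair. *)
Lemma std_descent (v : 'S_n) (i : 'I_n) : (0 < i)%N -> ~~ ascent v i -> std v ->
  std (rmul_refl i v).
Proof.
move=> i0 d hv; apply: contraT => nv.
by have [lt _] := std_swap_gfac eps Q q0 hla i0 hv nv; move: d; rewrite /ascent lt.
Qed.

(** The only way to go from 1 to v in as many steps as its length is upwards along
    the word, and each step contributes one factor of Gfac v.  Read in the opposite
    direction, for the image under the anti-automorphism, each step contributes 1. *)
Lemma Tword_Rho_reduced s (v : 'S_n) : std v -> is_reduced_word v s ->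
  Rho (Tword T s) (en x0) (en v) = Gfac v /\ Rho (star (Tword T s)) (en v) (en x0) = 1.
Proof.
elim/last_ind: s v => [|s i IH] v hv.
  case/and3P => _ _; rewrite big_nil => /eqP <-.
  by rewrite star_Tword_nil /Tword big_nil Rho1 mxE eqxx Gfac1.
move=> red; have [i0 d red'] := reduced_rcons red.
have hs := std_descent i0 d hv.
have /and3P[s0 /eqP sz _] := red'.
have lv := perm_length_descent i0 d.
have [E1 E2] := IH _ hs red'.
have asc' : ascent (v * simple_refl i)%g i by rewrite ascent_mul.
split.
  rewrite Tword_rcons RhoM RhoT // [LHS]Mopmx; last exact: rmul_reflK.
  rewrite Tword_Rho_short //; last by rewrite sz lv.
  rewrite mul0r add0r E1 /loc_b hs -[in RHS](simple_reflK i v) Gfac_ascent // mulrC.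
  congr (_ * _); rewrite /sn_b; move: asc'; rewrite /ascent -!/(entry_pos _ _) => lt.
  by rewrite lt.
rewrite star_Tword_rcons RhoM RhoT // [LHS]locmxM /op.
rewrite star_Tword_Rho_short //; last by rewrite sz lv.
rewrite mulr0 add0r E2 mulr1 /loc_b hv /sn_b.
by move: d; rewrite /ascent -!/(entry_pos _ _) => /negbTE ->.
Qed.

Lemma comp_sum_le (s : 'I_r) : (\sum_(s' < r | (s' < s)%N) comp_size la s' <= n)%N.
Proof. by rewrite -[X in (_ <= X)%N](shape_size hla); apply: leq_sum_lt_all. Qed.

(** The eigenvalue of the product of the L_k - Q_s at w vanishes as soon as an entry
    of an earlier component of t^la has the residue Q_s; at the identity it does not
    vanish because the parameters are separated. *)
Lemma Rho_m_left : exists u : 'S_n -> K,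
  [/\ Rho (\prod_(s < r | (0 < s)%N)
        \prod_(k < (\sum_(s' < r | s' < s) comp_size la s')%N)
          (L q T k - (cyc_param eps Q s)%:A)) = dgmx x0 u,
      forall w, std w -> u w != 0 -> forall (s : 'I_r) (k : 'I_n), (0 < s)%N ->
        ((nd k).1 < s)%N -> rho (entry_pos k w) != cyc_param eps Q s
    & u 1%g != 0].
Proof.
exists (fun v => \prod_(s < r | (0 < s)%N)
        \prod_(k < (\sum_(s' < r | s' < s) comp_size la s')%N)
          (jm_val (insubd o (k : nat)) v - cyc_param eps Q s)); split.
- rewrite Rho_prod -dgmx_prod; apply: eq_bigr => s _.
  rewrite Rho_prod -dgmx_prod; apply: eq_bigr => k _.
  rewrite -Rho_L_sub val_insubd.
  by rewrite (leq_trans (ltn_ord k) (comp_sum_le s)).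
- move=> w hw uw s k s0 ks; apply: contraNneq uw => E.
  rewrite (bigD1 s) //= mulf_eq0; apply/orP; left.
  rewrite -(nd_comp_lt hla) in ks; rewrite (bigD1 (Ordinal ks)) //= mulf_eq0; apply/orP; left.
  by rewrite /jm_val hw (_ : insubd o _ = k) ?E ?subrr //; apply/val_inj; rewrite val_insubd ltn_ord.
apply/prodf_neq0 => s s0; apply/prodf_neq0 => k _.
rewrite /jm_val std_perm1 // /entry_pos invg1 perm1; set k' := insubd _ _.
have vk : k' = k :> nat by rewrite val_insubd (leq_trans (ltn_ord k) (comp_sum_le s)).
have lt : ((nd k').1 < s)%N by rewrite -(nd_comp_lt hla) vk ltn_ord.
have ne : (nd k').1 != s by rewrite -(inj_eq val_inj) /= ltn_eqF.
have b1 := hook_size hla erefl (nd_diagram hla k') (nd_diagram hla k').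
have b2 := comp_size_le hla (nd k').1.
rewrite subr_eq0 /rho /node_res -!exprnP; apply/eqP => E.
have qr : q ^+ nrow (nd k') != 0 by rewrite expf_neq0.
case: (leqP (nrow (nd k')) (ncol (nd k'))) => le.
  have : cyc_param eps Q (nd k').1 * q ^+ (ncol (nd k') - nrow (nd k')) != cyc_param eps Q s.
    by apply: hsep => //; apply: leq_ltn_trans (leq_subr _ _) _; apply: leq_trans b2;
       apply: leq_ltn_trans b1; apply: leq_addl.
  by rewrite expfB_cond ?(negbTE q0) // mulrC E eqxx.
have : cyc_param eps Q s * q ^+ (nrow (nd k') - ncol (nd k')) != cyc_param eps Q (nd k').1.
  apply: hsep; first by rewrite eq_sym.
  by apply: leq_ltn_trans (leq_subr _ _) _; apply: leq_trans b2;
       apply: leq_ltn_trans b1; apply: leq_addr.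
rewrite -E expfB_cond ?(negbTE q0) 1?ltnW //.
have qc : q ^+ ncol (nd k') != 0 by rewrite expf_neq0.
case/eqP; move: (cyc_param _ _ _) qr qc => c; move: (q ^+ _) (q ^+ _) => a b a0 b0.
by field; rewrite a0 b0.
Qed.

(** A numbering of the rows of all components; the row stabilizer is the Young
    subgroup of this labelling. *)
Definition row_index (k : 'I_n) : nat := ((nd k).1 * n + nrow (nd k))%N.

Lemma row_index_eq (k l : 'I_n) : (row_index k == row_index l) =
  ((nd k).1 == (nd l).1) && ((nd k).2.1 == (nd l).2.1).
Proof.
have n0 : (0 < n)%N by apply: ltnW.
apply/eqP/andP => [E|[/eqP E1 /eqP E2]]; last by rewrite /row_index /nrow E1 E2.
have := congr1 (fun m => m %/ n)%N E; have := congr1 (fun m => m %% n)%N E.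
rewrite /row_index !divnMDl // !modnMDl !modn_small ?divn_small ?ltn_ord // !addn0.
by move=> /val_inj -> /val_inj ->.
Qed.

Lemma row_index_mono (k l : 'I_n) : (k <= l)%N -> (row_index k <= row_index l)%N.
Proof.
rewrite leq_eqVlt => /orP[/eqP/val_inj -> //|]; rewrite -(prec_nd hla) /prec.
rewrite /row_index => /orP[lt|/andP[/eqP -> h]]; last first.
  by rewrite leq_add2l; case/orP: h => [/ltnW //|/andP[/eqP ->]].
apply: leq_trans (leq_addr _ _); apply: (@leq_trans ((nd k).1.+1 * n)%N).
  by rewrite [X in (_ <= X)%N]mulSn addnC leq_add2r; apply: ltnW (ltn_ord _).
by rewrite leq_mul2r lt orbT.
Qed.

Lemma row_stabilizerE : row_stabilizer la = young row_index.
Proof.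
apply/setP => w; rewrite !inE; apply/eq_forallb => k.
by rewrite row_index_eq -!/(nd _).
Qed.

Definition in_row (i : 'I_n) : bool := (0 < i)%N && (row_index (ord_pred i) == row_index i).

Lemma in_row_refl (i k : 'I_n) : in_row i -> row_index (simple_refl i k) = row_index k.
Proof.
case/andP => i0 /eqP E; rewrite /simple_refl; case: tpermP => [->|->|] //.
Qed.

Lemma in_row_q i : in_row i -> rho i = q * rho (ord_pred i).
Proof.
case/andP => i0; rewrite row_index_eq => /andP[/eqP E1 /eqP E2].
have vp := val_ord_pred i0.
have lt : (ncol (nd (ord_pred i)) < ncol (nd i))%N.
  have : (ord_pred i < i)%N by lia.
  by rewrite -(prec_nd hla) /prec /nrow E1 E2 eqxx !ltnn eqxx.
have rr1 := rr_nd hla i; have rr2 := rr_nd hla (ord_pred i).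
have Ec : ncol (nd i) = (ncol (nd (ord_pred i))).+1.
  move: rr1 rr2; rewrite /row_reading E1 E2 -!/(ncol _) => rr1 rr2.
  by apply/eqP; rewrite -(eqn_add2l (\sum_(s < r | (s < (nd i).1)%N) comp_size la s
   + \sum_(j < n | (j < (nd i).2.1)%N) la (nd i).1 j)) addnS rr1 rr2 vp prednK.
by rewrite /rho /node_res -!exprnP Ec /nrow E1 E2 exprS !mulrA.
Qed.

Let xla : H := \sum_(w in row_stabilizer la) T_perm T w.

(** The sum over the row stabilizer is invariant under its own simple reflections. *)
Lemma snmx_xla i : in_row i -> snmx i *m Rho xla = q *: Rho xla.
Proof.
move=> hi; have /andP[i0 _] := hi; rewrite -(RhoT i0) mulmxE -RhoM /xla.
rewrite (hecke_T_mul_sum rel i0) ?RhoZ // => w; rewrite row_stabilizerE !inE.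
apply/forallP/forallP => h k; have := h (simple_refl i k); rewrite !permM.
  by rewrite tpermK in_row_refl.
by rewrite in_row_refl.
Qed.

(** A descent of a permutation that preserves rows exchanges two values of one row,
    because row_index is monotone. *)
Lemma row_stabilizer_word s (w : 'S_n) : w \in row_stabilizer la -> is_reduced_word w s ->
  all in_row s.
Proof.
rewrite row_stabilizerE; elim/last_ind: s w => // s i IH w hw red.
have [i0 d red'] := reduced_rcons red.
have hc k : row_index (w k) = row_index k by move: hw; rewrite inE => /forallP/(_ k)/eqP.
have hir : in_row i.
  rewrite /in_row i0 /=; move: d; rewrite /ascent -leqNgt => /row_index_mono.
  rewrite -(hc (w^-1%g i)) -(hc (w^-1%g (ord_pred i))) !permKV => le.
  rewrite eqn_leq le andbT; apply: row_index_mono.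
  by have := val_ord_pred i0; lia.
rewrite all_rcons hir /=; apply: IH red'.
by rewrite inE; apply/forallP => k; rewrite permM in_row_refl ?hc.
Qed.

(** Adjacent entries of a row of t^la have residues x and q x, where the off-diagonal
    coefficient is 0 and the diagonal one is q. *)
Lemma row1_word s (v : 'S_n) : all in_row s ->
  Rho (Tword T s) (en x0) (en v) = q ^+ size s *+ (x0 == v).
Proof.
elim: s v => [|i s IH] v /=.
  by rewrite /Tword big_nil Rho1 mxE (inj_eq (can_inj (encK _))) expr0.
case/andP => hi hs; have /andP[i0 _] := hi.
rewrite /Tword big_cons -/(Tword T s) RhoM RhoT // [LHS]locmxM /op IH //.
rewrite /loc_a /loc_b std_perm1 // /entry_pos invg1 !perm1.
have E := in_row_q hi.
have nz := @node_res_neq0 p' d' n K eps q Q q0 cyc0 (nd (ord_pred i)).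
have q1 : q - 1 != 0 by rewrite subr_eq0; have := @hq 1%N; rewrite expr1; apply; lia.
have -> : sn_b (ord_pred i) i = 0.
  by rewrite /sn_b; case: ifP => [_|]; rewrite ?E ?gfac_eq0_row //; have := val_ord_pred i0; lia.
rewrite mul0r addr0 exprS mulrnAr; congr (_ * _ *+ _).
rewrite /sn_a /sn_diag E -[rho (ord_pred i)]/(node_res eps q Q (nd (ord_pred i))).
move: (node_res _ _ _ _) nz => x x0'.
by field; rewrite -{2}[x]mul1r -mulrBl mulf_neq0.
Qed.

Lemma row1_xla (v : 'S_n) : Rho xla (en x0) (en v) = poincare q (row_stabilizer la) *+ (x0 == v).
Proof.
rewrite /xla Rho_sum summxE -sumrMnl; apply: eq_bigr => w hw.
have red := reduced_wordP w; have hs := row_stabilizer_word hw red.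
by rewrite [LHS](row1_word v hs); case/and3P: red => _ /eqP -> _.
Qed.

Lemma poincare_stab_neq0 : poincare q (row_stabilizer la) != 0.
Proof. by rewrite row_stabilizerE; apply: poincare_young_neq0 => //; apply: row_index_mono. Qed.

Lemma nd_comp_mono (k l : 'I_n) : (k <= l)%N -> ((nd k).1 <= (nd l).1)%N.
Proof.
by move=> kl; rewrite leqNgt -(nd_comp_lt hla) -leqNgt; apply: leq_trans kl; rewrite leqNgt (nd_comp_lt hla) ltnn.
Qed.

(** The corner of component s carries the residue Q_s, so its entry does not come from
    an earlier component of t^la; the other entries of the component are larger and
    do not either.  Thus the component of w j in t^la is never before that of j, and
    equality holds because both have the same sum over j. *)
Lemma good_comp (w : 'S_n) : std w ->
  (forall (s : 'I_r) (k : 'I_n), (0 < s)%N -> ((nd k).1 < s)%N ->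
     rho (entry_pos k w) != cyc_param eps Q s) ->
  forall k, (nd (entry_pos k w)).1 = (nd k).1.
Proof.
move=> hw hgood.
have le (j : 'I_n) : ((nd j).1 <= (nd (w j)).1)%N.
  case: (posnP (nd j).1) => [-> //|s0].
  pose Z : node p' d' n := ((nd j).1, (o, o)).
  have rZ : nrow Z = 0%N by []. have cZ : ncol Z = 0%N by [].
  have d : nw Z (nd j) by rewrite /nw rZ cZ eqxx.
  have [u Eu] := nd_surj hla (diagram_nw hla d (nd_diagram hla j)).
  have lu := std_perm_nw hla hw (i := u) (j := j); rewrite Eu in lu.
  apply: leq_trans (nd_comp_mono (lu d)); rewrite leqNgt; apply/negP => lt.
  have := hgood _ _ s0 lt; rewrite /entry_pos permK /rho Eu /node_res rZ cZ.
  by rewrite -!exprnP expr0 divr1 mul1r eqxx.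
have sum_eq : (\sum_j (nd (w j)).1 = \sum_j (nd j).1)%N.
  by rewrite [RHS](reindex_inj (@perm_inj _ w)).
have := leqif_sum (fun (j : 'I_n) (_ : true) => leqif_eq (le j)).
move=> [_]; rewrite sum_eq eqxx => /esym/forallP h k.
by have /= /eqP /val_inj E := h (entry_pos k w); rewrite E permKV.
Qed.

Lemma first_moved_entry (v : 'S_n) : v != 1%g ->
  exists2 k, entry_pos k v != k & forall l : 'I_n, (l < k)%N -> entry_pos l v = l.
Proof.
move=> v1; have [k0 h0] : exists k, entry_pos k v != k.
  apply/existsP; apply: contraNT v1; rewrite negb_exists => /forallP h.
  apply/eqP/invg_inj; rewrite invg1; apply/permP => k; rewrite perm1.
  by have := h k; rewrite negbK => /eqP.
case: (@arg_minnP _ k0 (fun k => entry_pos k v != k) (fun k : 'I_n => k : nat) h0) => k hk kmin; exists k => // l lk.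
by apply/eqP; apply: contraLR lk => /kmin; rewrite -leqNgt.
Qed.

(** Before k the tableau agrees with t^la, so k sits at a node all of whose
    predecessors in the order nw hold smaller entries.  Within the same component
    this is only possible at the start of the next row, while t^la continues the
    current row; the residues involved then differ by a power of q that counts the
    nodes before k in its row. *)
Lemma first_moved_geometry (v : 'S_n) (k : 'I_n) : std v ->
  (nd (entry_pos k v)).1 = (nd k).1 -> entry_pos k v != k ->
  (forall l : 'I_n, (l < k)%N -> entry_pos l v = l) ->
  [/\ in_row k, (k < entry_pos k v)%N, (0 < ncol (nd k))%N
    & rho (ord_pred k) = q ^+ ncol (nd k) * rho (entry_pos k v)].
Proof.
move=> hv; set c := entry_pos k v => Ecomp ck fixl.
have vc : v c = k by rewrite permKV.
have kc : (k < c)%N.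
  rewrite ltn_neqAle eq_sym ck leqNgt; apply/negP => lt.
  have := fixl _ lt => E; have : v c = c by rewrite -{1}E permKV.
  by rewrite vc => E'; rewrite E' eqxx in ck.
have before u : nd_lt la u c -> (u < k)%N.
  move=> /(std_permP hla _ hv); rewrite vc => lt.
  by have := fixl _ lt; rewrite /entry_pos permK => ->.
have := kc; rewrite -(prec_nd hla) /prec Ecomp ltnn eqxx /= => pk.
have c0 : ncol (nd c) = 0%N.
  case: (posnP (ncol (nd c))) => // cpos; exfalso.
  have hb : ((ncol (nd c)).-1 < n)%N by apply: leq_ltn_trans (leq_pred _) (ltn_ord _).
  pose Z : node p' d' n := ((nd c).1, ((nd c).2.1, Ordinal hb)).
  have rZ : nrow Z = nrow (nd c) by []. have cZ : ncol Z = (ncol (nd c)).-1 by [].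
  have d : nw Z (nd c) by rewrite /nw rZ cZ eqxx leqnn leq_pred.
  have [u Eu] := nd_surj hla (diagram_nw hla d (nd_diagram hla c)).
  have uc : nd_lt la u c by rewrite /nd_lt Eu rZ cZ !eqxx /= prednK ?leqnn.
  have := before _ uc; rewrite -(prec_nd hla) Eu /prec rZ cZ /= Ecomp ltnn eqxx /=.
  by clear -pk cpos; lia.
have lrow : (nrow (nd k) < nrow (nd c))%N by clear -pk c0; lia.
have hb : ((nrow (nd c)).-1 < n)%N by apply: leq_ltn_trans (leq_pred _) (ltn_ord _).
pose Z : node p' d' n := ((nd c).1, (Ordinal hb, (nd c).2.2)).
have rZ : nrow Z = (nrow (nd c)).-1 by []. have cZ : ncol Z = ncol (nd c) by [].
have d : nw Z (nd c) by rewrite /nw rZ cZ eqxx leqnn leq_pred.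
have [u Eu] := nd_surj hla (diagram_nw hla d (nd_diagram hla c)).
have uc : nd_lt la u c.
  by rewrite /nd_lt Eu rZ cZ !eqxx /= prednK ?leqnn ?orbT //; apply: leq_ltn_trans lrow.
have := before _ uc => uk; have := uk.
rewrite -(prec_nd hla) Eu /prec rZ cZ /= Ecomp ltnn eqxx /= c0 => pZ.
have [Er bpos] : nrow (nd c) = (nrow (nd k)).+1 /\ (0 < ncol (nd k))%N.
  by clear -pZ lrow; lia.
have k0 : (0 < k)%N by apply: leq_ltn_trans uk.
have hb2 : ((ncol (nd k)).-1 < n)%N by apply: leq_ltn_trans (leq_pred _) (ltn_ord _).
pose Y : node p' d' n := ((nd k).1, ((nd k).2.1, Ordinal hb2)).
have rY : nrow Y = nrow (nd k) by []. have cY : ncol Y = (ncol (nd k)).-1 by [].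
have dY : nw Y (nd k) by rewrite /nw rY cY eqxx leqnn leq_pred.
have hY := diagram_nw hla dY (nd_diagram hla k).
have EY : nd (ord_pred k) = Y.
  apply: rr_inj (nd_diagram hla _) hY _.
  rewrite rr_nd // [LHS]val_ord_pred //; have := rr_nd hla k.
  by rewrite /row_reading /Y /= -/(ncol (nd k)) => <-; rewrite -[in LHS](prednK bpos) addnS.
split=> //; first by rewrite /in_row k0 /row_index EY rY eqxx.
  by rewrite lrow.
rewrite /rho EY /node_res rY cY c0 Er [Y.1]/= -Ecomp -!exprnP expr0 exprS.
have qr : q ^+ nrow (nd k) != 0 by rewrite expf_neq0.
rewrite -{2}(prednK bpos) exprS invfM mul1r.
by rewrite !mulrA [q * _]mulrC mulfK.
Qed.

(** This is the triangularity behind the rule of Young.  At the first moved entry k,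
    invariance of the row sum under T_k gives (a - q) X(v) + b X(v s_k) = 0.  The
    second term vanishes by induction, since the first moved entry of v s_k is
    smaller, and a is different from q because q is not a root of unity of small
    order. *)
Lemma xla_column (v : 'S_n) j : std v -> (forall k, (nd (entry_pos k v)).1 = (nd k).1) ->
  v != 1%g -> Rho xla (en v) j = 0.
Proof.
move=> hv gv /first_moved_entry[k]; have [m] := ubnP (k : nat).
elim: m k v hv gv => // m IH k v hv gv; rewrite ltnS => km ck fixl.
have [hir kc bpos Erho] := first_moved_geometry hv (gv k) ck fixl.
have /andP[k0 _] := hir; have vp := val_ord_pred k0.
have lastE : entry_pos (ord_pred k) v = ord_pred k by apply: fixl; rewrite vp; clear -k0; lia.
have := congr1 (fun M : MX => M (en v) j) (snmx_xla hir).
rewrite [LHS]locmxM /op /loc_a /loc_b hv [RHS]mxE.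
have -> : sn_b (entry_pos (ord_pred k) v) (entry_pos k v) * Rho xla (en (rmul_refl k v)) j = 0.
  have [hs|ns] := boolP (std (rmul_refl k v)); last by rewrite snstd // mul0r.
  rewrite (IH (ord_pred k)) ?mulr0 //.
  - move=> l; rewrite pos_refl gv.
    rewrite /simple_refl; case: tpermP => [->|->|] //; move: hir; rewrite /in_row row_index_eq;
      by case/and3P => _ /eqP E _; rewrite E.
  - by rewrite vp; clear -km k0; lia.
  - rewrite pos_refl simple_refl_pred; apply/eqP => E.
    by move: kc; rewrite E vp; clear -k0; lia.
  move=> l; rewrite vp => lk; rewrite pos_refl simple_refl_fix //; first (apply: fixl);
    by clear -lk k0; lia.
rewrite addr0 lastE /sn_a /sn_diag Erho; set y := rho _; set b := ncol _ => /eqP.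
have y0 : y != 0 by apply: (node_res_neq0 q0 cyc0).
have nb : (b < n)%N := ltn_ord _.
have qb : q ^+ b - 1 != 0 by rewrite subr_eq0 hq // bpos ltnW.
have qb1 : q ^+ b.+1 - 1 != 0 by rewrite subr_eq0 hq.
rewrite -subr_eq0 -mulrBl mulf_eq0 => /orP[/eqP E|/eqP //]; exfalso.
have : (q ^+ b.+1 - 1) / (1 - q ^+ b) = 0.
  rewrite -E exprS; move: (q ^+ b) qb y0 => z z1 y0'.
  have z2 : 1 - z != 0 by rewrite -opprB oppr_eq0.
  field; rewrite z2 -{1}[y]mul1r -mulrBl mulf_neq0 //.
by apply/eqP; rewrite mulf_neq0 // invr_eq0 -opprB oppr_eq0.
Qed.

(** By Rho_m_left and good_comp, the left factor of m_la kills the standard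
    permutations that move entries between components; by xla_column, the row sum
    kills the remaining ones except 1. *)
Lemma Rho_m_la : exists2 kappa, kappa != 0 &
  (forall v : 'S_n, Rho (m_ eps q Q T la) (en x0) (en v) = kappa *+ (x0 == v)) /\
  (forall v : 'S_n, std v -> v != 1%g -> forall j, Rho (m_ eps q Q T la) (en v) j = 0).
Proof.
have [u [Eu ugood u1]] := Rho_m_left.
exists (u 1%g * poincare q (row_stabilizer la)); first by rewrite mulf_neq0 // poincare_stab_neq0.
have E v j : Rho (m_ eps q Q T la) (en v) j = u v * Rho xla (en v) j.
  by rewrite /m_ RhoM Eu [LHS]dgmxM.
split=> [v|v hv v1 j]; first by rewrite E row1_xla mulrnAr.
rewrite E; have [->|uv] := eqVneq (u v) 0; first by rewrite mul0r.
by rewrite xla_column ?mulr0 // => k; apply: good_comp => // s l s0 ls; apply: ugood.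
Qed.

(** In the (w, w) entry of f_tt only the path from w down to 1, through m_la, and
    back up to w survives, and it contributes kappa (Gfac w).  As F_t projects onto
    w, the relation f_tt ^ 2 = gamma_t f_tt becomes an equation between scalars. *)
Lemma gamma_formula (gamma : tableau p' d' n -> K) : is_gamma eps q Q T star gamma ->
  exists2 kappa, kappa != 0 & forall w, std w -> gamma (tab w) = kappa * Gfac w.
Proof.
move=> [_ hg]; have [kappa k0 [m1 m2]] := Rho_m_la; exists kappa => // w hw.
pose t := tab w.
have ht : is_std la t := hw.
have [F [EF F1 F0]] := Rho_F hw.
have tw : tab_perm la t = w.
  have := tab_permP hla ht => E; apply: invg_inj; apply/permP => k.
  by have := congr1 (fun s : tableau p' d' n => s k) E; rewrite /t /tab !tab_actE => /(nd_inj hla).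
have red := reduced_wordP w.
have [E1 E2] := Tword_Rho_reduced hw red.
have key3 a b c : Rho (a * b * c) = Rho a * (Rho b * Rho c) by rewrite !RhoM mulrA.
have key5 a b c d e : Rho (a * b * c * d * e) = Rho a * Rho (b * c * d) * Rho e.
  by rewrite !RhoM !mulrA.
pose M := Rho (star (T_perm T w) * m_ eps q Q T la * T_perm T w).
have Ms v : std w -> ~~ std v -> M (en w) (en v) = 0 by apply: Rho_block.
have Mw : M (en w) (en w) = kappa * Gfac w.
  rewrite /M key3; move: (Rho (m_ _ _ _ _ _)) m1 m2 => mm m1 m2; rewrite [LHS]mxE (sum_enc x0) (bigD1 x0) //= big1 ?addr0 => [|v v1].
    rewrite [X in X * _]E2 mul1r [LHS]mxE (sum_enc x0) (bigD1 x0) //= big1 ?addr0 => [|v v1].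
      by rewrite m1 eqxx [X in _ * X]E1.
    by rewrite m1 eq_sym (negbTE v1) mul0r.
  have [hv|nv] := boolP (std v); last by rewrite Rho_block ?mul0r.
  by rewrite [X in _ * X]mxE big1 ?mulr0 // => l _; rewrite m2 // mul0r.
have ff := hg la la t t t t hla hla ht ht ht ht; rewrite eqxx in ff.
have Ef : Rho (f_ eps q Q T star la t t) = dgmx x0 F * M * dgmx x0 F.
  by rewrite /f_ tw key5 EF.
have Efe v u : Rho (f_ eps q Q T star la t t) (en v) (en u) = F v * M (en v) (en u) * F u.
  by rewrite Ef [LHS]Mdgmx [X in X * _]dgmxM.
have := congr1 (fun h => Rho h (en w) (en w)) ff.
rewrite RhoM RhoZ [RHS]mxE Efe F1 mul1r mulr1 [LHS]mxE (sum_enc x0) (bigD1 w) //= !Efe.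
rewrite F1 !mul1r !mulr1 big1 ?addr0 => [|v vw]; last first.
  rewrite Efe; have [hv|nv] := boolP (std v); first by rewrite (F0 v hv vw) mulr0 mul0r.
  by rewrite Ms // mulr0 !mul0r.
rewrite Mw => /(mulIf _) -> //.
by rewrite mulf_neq0 // Gfac_neq0.
Qed.

End Rep.
End SeminormalRep.

(** * Young subgroups of two blocks, and shifts of components *)

Section YoungTwo.
Variable n : nat.
Implicit Types (w x y z : 'S_n) (a : nat).

Lemma young2P a z : reflect (forall i, (z i < a)%N = (i < a)%N) (young2 a z).
Proof. by apply: (iffP forallP) => h i; [exact: (eqP (h i))|rewrite h]. Qed.

Lemma young2M a x y : young2 a x -> young2 a y -> young2 a (x * y)%g.
Proof. by move=> /young2P hx /young2P hy; apply/young2P => i; rewrite permM hy hx. Qed.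

Lemma young2V a x : young2 a x -> young2 a x^-1%g.
Proof. by move=> /young2P hx; apply/young2P => i; rewrite -hx permKV. Qed.

Lemma young2_partP a w : young2 a (young2_part a w) /\
  forall z, young2 a z -> (perm_length ((young2_part a w)^-1 * w)%g
                           <= perm_length (z * ((young2_part a w)^-1 * w))%g)%N.
Proof.
rewrite /young2_part; case: pickP => [x /andP[hx /forallP h] /=|no].
  by split=> // z hz; have /implyP := h z; apply.
have y1 : young2 a (1%g : 'S_n) by apply/young2P => i; rewrite perm1.
have := @arg_minnP _ (1%g : 'S_n) (young2 a) (fun z => perm_length (z * w)%g) y1.
case=> x hx xmin; have := no x^-1%g; rewrite young2V //=.
move=> /negbT/negP; case; apply/forallP => z; apply/implyP => hz.
by rewrite invgK mulgA; apply: xmin; apply: young2M.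
Qed.

(** Minimality of the coset representative y means that y is increasing on each of
    the two blocks, so x orders each block as w does. *)
Lemma young2_part_lt a w (i j : 'I_n) : (i < a)%N = (j < a)%N ->
  (young2_part a w i < young2_part a w j)%N = (w i < w j)%N.
Proof.
have [hx ymin] := young2_partP a w; set x := young2_part a w in hx ymin *.
set y := (x^-1 * w)%g in ymin.
have wE k : w k = y (x k) by rewrite -permM mulgA mulgV mul1g.
have step (k : 'I_n) : (0 < k)%N -> (k.-1 < a)%N = (k < a)%N -> (y (ord_pred k) < y k)%N.
  move=> k0 ka; rewrite ltnNge; apply/negP => le.
  have lt : (y k < y (ord_pred k))%N.
    rewrite ltn_neqAle le andbT; apply/eqP => /val_inj /perm_inj E.
    by have := val_ord_pred k0; rewrite -E; lia.
  have hs : young2 a (simple_refl k).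
    apply/young2P => l; have := simple_refl_cases l k0.
    by case=> [[-> ->]|[[-> ->]|[_ [_ ->]]]].
  by have := ymin _ hs; rewrite (perm_length_mulL_desc k0 lt) ltnn.
have incr (u v : 'I_n) : (u < v)%N -> (u < a)%N = (v < a)%N -> (y u < y v)%N.
  have [m] := ubnP (v - u)%N; elim: m u v => // m IH u v; rewrite ltnS => le uv uva.
  have v0 : (0 < v)%N by lia.
  have vp := val_ord_pred v0.
  have va : (v.-1 < a)%N = (v < a)%N by lia.
  have lt := step v v0 va.
  have [E|ne] := eqVneq u (ord_pred v); first by rewrite E.
  apply: ltn_trans lt; apply: IH; rewrite ?vp ?va //; first by lia.
  by have : (u != ord_pred v :> nat) by []; rewrite vp; lia.
move=> ij; rewrite !wE; have /young2P xa := hx.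
apply/idP/idP => [lt|]; first by apply: incr; rewrite ?xa.
apply: contraTT; rewrite -!leqNgt leq_eqVlt => /orP[/eqP/val_inj -> //|lt].
by apply/ltnW/incr; rewrite ?xa.
Qed.

End YoungTwo.

Section Shifts.
Variables p' d' n : nat.
Local Notation p := p'.+1.
Local Notation d := d'.+1.
Local Notation r := (p'.+1 * d'.+1)%N.
Local Notation node := (node p' d' n).
Local Notation mpart := (mpart p' d' n).
Local Notation tableau := (tableau p' d' n).
Implicit Types (X Y : node) (la : mpart) (t : tableau) (z e : nat).

Definition blk X : nat := X.1 %/ d.
(** For X in the shift of a diagram by e blocks, this is the corresponding node of the
    diagram itself. *)
Definition sh e X : node := (@shift_comp p' d' e X.1, X.2).

Lemma blk_lt X : (blk X < p)%N.
Proof. by rewrite /blk ltn_divLR. Qed.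

Lemma shift_compE e (s : 'I_r) :
  (@shift_comp p' d' e s : nat) = (((s %/ d + e) %% p) * d + s %% d)%N.
Proof.
rewrite /shift_comp val_insubd ltn_pmod //.
rewrite [X in ((X + _) %% _)%N](divn_eq s d) addnAC [(d * e)%N]mulnC -mulnDl.
rewrite {1}(divn_eq (s %/ d + e) p) mulnDl -mulnA -addnA modnMDl modn_small //.
apply: (@leq_trans (((s %/ d + e) %% p).+1 * d)%N).
  by rewrite [X in (_ < X)%N]mulSn addnC ltn_add2r ltn_pmod.
by rewrite leq_mul2r ltn_pmod ?orbT.
Qed.

Lemma shift_comp_blk e (s : 'I_r) :
  (@shift_comp p' d' e s %/ d = (s %/ d + e) %% p)%N.
Proof. by rewrite shift_compE divnMDl // [(s %% d %/ d)%N]divn_small ?addn0 ?ltn_pmod. Qed.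

Lemma shift_comp_mod e (s : 'I_r) : (@shift_comp p' d' e s %% d = s %% d)%N.
Proof. by rewrite shift_compE modnMDl modn_mod. Qed.

Lemma comp_eq (s s' : 'I_r) : (s %/ d = s' %/ d)%N -> (s %% d = s' %% d)%N -> s = s'.
Proof. by move=> h1 h2; apply/val_inj; rewrite /= (divn_eq s d) h1 h2 -divn_eq. Qed.

Lemma shift_comp_comp a b (s : 'I_r) :
  @shift_comp p' d' a (@shift_comp p' d' b s) = @shift_comp p' d' (b + a) s.
Proof.
by apply: comp_eq; rewrite ?shift_comp_mod // !shift_comp_blk modnDml addnA.
Qed.

Lemma shift_comp_eqmod a b (s : 'I_r) : (a = b %[mod p])%N ->
  @shift_comp p' d' a s = @shift_comp p' d' b s.
Proof.
move=> E; apply: comp_eq; rewrite ?shift_comp_mod // !shift_comp_blk.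
by rewrite -modnDmr E modnDmr.
Qed.

Lemma shift_comp0 (s : 'I_r) : @shift_comp p' d' 0 s = s.
Proof.
by apply: comp_eq; rewrite ?shift_comp_mod // shift_comp_blk addn0 modn_small // ltn_divLR.
Qed.

Lemma blk_sh e X : blk (sh e X) = ((blk X + e) %% p)%N.
Proof. exact: shift_comp_blk. Qed.

Lemma sh_sh a b X : sh a (sh b X) = sh (b + a) X.
Proof. by rewrite /sh /= shift_comp_comp. Qed.

Lemma sh_eqmod a b X : (a = b %[mod p])%N -> sh a X = sh b X.
Proof. by move=> E; rewrite /sh (shift_comp_eqmod _ E). Qed.

Lemma sh0 X : sh 0 X = X.
Proof. by case: X => s ab; rewrite /sh shift_comp0. Qed.

(** An inverse of z modulo p, in the form used by tab_shift. *)
Definition negz z : nat := (p - z %% p)%N.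

Lemma negzK z : (z + negz z = 0 %[mod p])%N.
Proof. by rewrite /negz -modnDml subnKC ?modnn ?mod0n // ltnW // ltn_pmod. Qed.

Lemma sh_negzK z X : sh z (sh (negz z) X) = X.
Proof. by rewrite sh_sh addnC (@sh_eqmod _ 0) ?negzK // sh0. Qed.

Lemma sh_Knegz z X : sh (negz z) (sh z X) = X.
Proof. by rewrite sh_sh (@sh_eqmod _ 0) ?negzK // sh0. Qed.

Lemma tab_shiftE z t k : tab_shift z t k = sh (negz z) (t k).
Proof. by rewrite ffunE. Qed.

Lemma in_diagram_shift z la X : (X \in diagram (mpart_shift z la)) = (sh z X \in diagram la).
Proof. by rewrite !inE ffunE. Qed.

Lemma sh_inj z : injective (sh z).
Proof. exact: can_inj (sh_Knegz z). Qed.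

Lemma shift_comp_inj z : injective (@shift_comp p' d' z).
Proof.
move=> s s' E; apply: comp_eq.
  have := congr1 (fun s : 'I_r => s %/ d)%N E; rewrite !shift_comp_blk => /eqP.
  by rewrite eqn_modDr => /eqP; rewrite !modn_small // ltn_divLR.
by have := congr1 (fun s : 'I_r => s %% d)%N E; rewrite !shift_comp_mod.
Qed.

Lemma is_mpart_shift z la : is_mpart la -> is_mpart (mpart_shift z la).
Proof.
move=> hla; apply/andP; split.
  apply/forallP => s; apply/forallP => i; apply/forallP => j; apply/implyP => ij.
  by rewrite !ffunE; apply: shape_decr.
rewrite -[X in _ == X](shape_size hla) [X in _ == X](reindex_inj (@shift_comp_inj z)).
by apply/eqP/eq_bigr => s _; apply: eq_bigr => i _; rewrite ffunE.
Qed.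

(** The shift only renames components. *)
Lemma is_std_shift z la t : is_std la t -> is_std (mpart_shift z la) (tab_shift z t).
Proof.
case/and4P => /injectiveP inj /eqP im h1 h2.
have E1 k l : ((tab_shift z t k).1 == (tab_shift z t l).1) = ((t k).1 == (t l).1).
  by rewrite !ffunE /= (inj_eq (@shift_comp_inj _)).
have E2 k : (tab_shift z t k).2 = (t k).2 by rewrite !ffunE.
apply/and4P; split.
- apply/injectiveP => k l; rewrite !tab_shiftE => /(@sh_inj _); exact: inj.
- apply/eqP/setP => X; rewrite in_diagram_shift -im; apply/imsetP/imsetP => -[k _ E]; exists k => //.
    by rewrite E tab_shiftE sh_negzK.
  by rewrite tab_shiftE -E sh_Knegz.
- apply/forallP => k; apply/forallP => l; rewrite E1 !E2.
  by move/forallP/(_ k)/forallP/(_ l): h1.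
apply/forallP => k; apply/forallP => l; rewrite E1 !E2.
by move/forallP/(_ k)/forallP/(_ l): h2.
Qed.

Lemma mpart_shift_add a b la : mpart_shift a (mpart_shift b la) = mpart_shift (a + b) la.
Proof. by apply/ffunP => s; rewrite !ffunE shift_comp_comp. Qed.

Lemma mpart_shift_eqmod a b la : (a = b %[mod p])%N -> mpart_shift a la = mpart_shift b la.
Proof. by move=> E; apply/ffunP => s; rewrite !ffunE (shift_comp_eqmod _ E). Qed.

Lemma mpart_shift0 la : mpart_shift 0 la = la.
Proof. by apply/ffunP => s; rewrite !ffunE shift_comp0. Qed.

Lemma negz_add a b : (negz a + negz b = negz (a + b) %[mod p])%N.
Proof.
apply/eqP; rewrite -(eqn_modDl (a + b)) negzK addnACA -modnDm !negzK.
by rewrite mod0n.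
Qed.

Lemma tab_shift_add a b t : tab_shift a (tab_shift b t) = tab_shift (a + b) t.
Proof.
apply/ffunP => k; rewrite !tab_shiftE sh_sh; apply: sh_eqmod.
by rewrite addnC negz_add.
Qed.

Lemma tab_shift_eqmod a b t : (a = b %[mod p])%N -> tab_shift a t = tab_shift b t.
Proof. by move=> E; apply/ffunP => k; rewrite !tab_shiftE /negz E. Qed.

Lemma tab_shift0 t : tab_shift 0 t = t.
Proof. by apply/ffunP => k; rewrite tab_shiftE (@sh_eqmod _ 0) ?sh0 // /negz mod0n subn0 modnn. Qed.

Lemma shape_unique la mu t : is_mpart la -> is_mpart mu -> is_std la t -> is_std mu t -> la = mu.
Proof.
move=> hla hmu /and4P[_ /eqP i1 _ _] /and4P[_ /eqP i2 _ _].
have E : diagram la = diagram mu by rewrite -i1.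
apply/ffunP => s; apply/ffunP => i; apply/val_inj => /=.
apply/eqP; rewrite eqn_leq; apply/andP; split; rewrite leqNgt; apply/negP => lt.
  have hc : (mu s i < n)%N by apply: leq_trans lt _; rewrite -ltnS.
  by have /setP/(_ (s, (i, Ordinal hc))) := E; rewrite !inE /= ltnn lt.
have hc : (la s i < n)%N by apply: leq_trans lt _; rewrite -ltnS.
by have /setP/(_ (s, (i, Ordinal hc))) := E; rewrite !inE /= ltnn lt.
Qed.

Lemma o_P la : (0 < o_ la)%N /\ mpart_shift (o_ la) la = la.
Proof. by rewrite /o_; case: ex_minnP => m /andP[m0 /eqP E] _. Qed.

Lemma o_min la k : (0 < k)%N -> mpart_shift k la = la -> (o_ la <= k)%N.
Proof. by move=> k0 E; rewrite /o_; case: ex_minnP => m _ h; apply: h; rewrite k0 E eqxx. Qed.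

Lemma mpart_shift_mul_o la k : mpart_shift (k * o_ la) la = la.
Proof.
elim: k => [|k IH]; first by rewrite mul0n mpart_shift0.
by rewrite mulSn -mpart_shift_add IH (o_P la).2.
Qed.

(** The set of periods is closed under remainders. *)
Lemma o_dvd la k : mpart_shift k la = la -> (o_ la %| k)%N.
Proof.
move=> E; rewrite /dvdn -leqn0 leqNgt; apply/negP => k0.
have [o0 _] := o_P la.
have E' : mpart_shift (k %% o_ la) la = la.
  rewrite -[in RHS]E (divn_eq k (o_ la)) addnC -mpart_shift_add mpart_shift_mul_o.
  by rewrite addnC modnMDl modn_mod.
by have := o_min k0 E'; rewrite leqNgt ltn_pmod.
Qed.

Lemma o_dvdp la : (o_ la %| p)%N.
Proof. by apply: o_dvd; rewrite (@mpart_shift_eqmod _ 0) ?mpart_shift0 // modnn mod0n. Qed.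

Lemma p_mul_o la : (p_ la * o_ la = p)%N.
Proof. by rewrite /p_ divnK // o_dvdp. Qed.

Lemma o_shift z la : o_ (mpart_shift z la) = o_ la.
Proof.
apply/eqP; rewrite eqn_leq; have [o0 Eo] := o_P la; have [o0' Eo'] := o_P (mpart_shift z la).
rewrite o_min //=; last by rewrite mpart_shift_add addnC -mpart_shift_add Eo.
apply: o_min => //; have := congr1 (mpart_shift (negz z)) Eo'.
rewrite !mpart_shift_add => E.
have E0 : mpart_shift (negz z + z) la = la.
  by rewrite (@mpart_shift_eqmod _ 0) ?mpart_shift0 // addnC negzK.
by move: E; rewrite E0 -addnA addnCA -mpart_shift_add E0.
Qed.

End Shifts.

(** * Products over the inversions of a tableau *)

Section ShiftedOrder.
Variables p' d' n : nat.
Local Notation p := p'.+1.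
Local Notation d := d'.+1.
Local Notation node := (node p' d' n).
Implicit Types (X Y : node) (z e : nat).

Lemma blk_comp_lt X Y : (blk X < blk Y)%N -> (X.1 < Y.1)%N.
Proof. by apply: contraTT; rewrite -!leqNgt; apply: leq_div2r. Qed.

Lemma prec_blk X Y : blk X != blk Y -> prec X Y = (blk X < blk Y)%N.
Proof.
rewrite /prec => ne; case: (ltngtP (blk X) (blk Y)) ne => // lt _; first by rewrite (blk_comp_lt lt).
have lt' := blk_comp_lt lt; rewrite ltnNge (ltnW lt') /=.
by case: eqP => // E; rewrite E ltnn in lt'.
Qed.

Lemma prec_sh_same e X Y : blk X = blk Y -> prec (sh e X) (sh e Y) = prec X Y.
Proof.
move=> E; rewrite /prec /= (inj_eq (@shift_comp_inj _ _ e)); congr (_ || _).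
rewrite !shift_compE -!/(blk _) E ltn_add2l.
by rewrite [in RHS](divn_eq X.1 d) [in RHS](divn_eq Y.1 d) -!/(blk _) E ltn_add2l.
Qed.

Lemma blk_negz z X : blk (sh (negz p' z) X) =
  (if (blk X < z %% p)%N then blk X + p - z %% p else blk X - z %% p)%N.
Proof.
have zp : (z %% p < p)%N by apply: ltn_pmod. have bp := blk_lt X.
rewrite blk_sh /negz; case: ltnP => h.
  by rewrite modn_small; lia.
rewrite (_ : (blk X + (p - z %% p) = (blk X - z %% p) + p)%N); last by lia.
by rewrite modnDr modn_small //; lia.
Qed.

(** The rotation exchanges the blocks before z with those from z on, and keeps the
    order inside either part; across the parts it reverses the order. *)
Lemma prec_negz_same z X Y : (blk X < z %% p)%N = (blk Y < z %% p)%N ->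
  prec (sh (negz p' z) X) (sh (negz p' z) Y) = prec X Y.
Proof.
move=> side; have [E|ne] := eqVneq (blk X) (blk Y); first exact: prec_sh_same.
have zp : (z %% p < p)%N by apply: ltn_pmod.
have bX := blk_lt X; have bY := blk_lt Y.
rewrite !prec_blk // ?blk_negz -side; case: ltnP side => h side; lia.
Qed.

Lemma prec_negz_cross z X Y : (blk X < z %% p)%N != (blk Y < z %% p)%N ->
  prec (sh (negz p' z) X) (sh (negz p' z) Y) = (z %% p <= blk X)%N.
Proof.
move=> side; have zp : (z %% p < p)%N by apply: ltn_pmod.
have bX := blk_lt X; have bY := blk_lt Y.
rewrite prec_blk ?blk_negz; move: side; case: ltnP => h; case: ltnP => h' //=; lia.
Qed.

Lemma prec_cross z X Y : (blk X < z %% p)%N != (blk Y < z %% p)%N ->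
  prec X Y = (blk X < z %% p)%N.
Proof. by move=> side; rewrite prec_blk; move: side; case: ltnP => h; case: ltnP => h' //=; lia. Qed.

End ShiftedOrder.

Section GammaProducts.
Variables p' d' n : nat.
Local Notation p := p'.+1.
Local Notation d := d'.+1.
Local Notation r := (p'.+1 * d'.+1)%N.
Local Notation node := (node p' d' n).
Local Notation mpart := (mpart p' d' n).
Local Notation tableau := (tableau p' d' n).
Variables (K : fieldType) (eps q : K) (Q : 'I_d'.+1 -> K).
Hypothesis q0 : q != 0.
Hypothesis heps : p.-primitive_root eps.
Local Notation nres := (@node_res p' d' n K eps q Q).
Local Notation gf := (gfac q).

Lemma eps_neq0 : eps != 0.
Proof.
apply/eqP => e0; have := prim_expr_order heps.
by rewrite e0 expr0n => /esym/eqP; rewrite oner_eq0.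
Qed.

(** Moving by e blocks multiplies the parameter by eps ^ e, also when it wraps around,
    because eps ^ p = 1. *)
Lemma node_res_sh e (X : node) : nres (sh e X) = eps ^+ e * nres X.
Proof.
rewrite /node_res /ncol /nrow /sh /=.
rewrite /cyc_param shift_comp_mod shift_comp_blk.
rewrite (_ : eps ^+ ((X.1 %/ d + e) %% p).+1 = eps ^+ e * eps ^+ (X.1 %/ d).+1).
  by rewrite -[eps ^+ e * _ * _]mulrA mulrCA.
by rewrite !exprS prim_expr_mod // exprD [LHS]mulrA [LHS]mulrC.
Qed.

Lemma gfac_sh e (X Y : node) : gf (nres (sh e X)) (nres (sh e Y)) = gf (nres X) (nres Y).
Proof. by rewrite !node_res_sh gfacZ // expf_neq0 // eps_neq0. Qed.

Definition gg (t : tableau) (ij : 'I_n * 'I_n) : K := gf (nres (t ij.1)) (nres (t ij.2)).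

(** The product over the inversions, indexed by the entries of the tableau. *)
Definition Ginv (t : tableau) : K :=
  \prod_(ij : 'I_n * 'I_n | (ij.1 < ij.2)%N && prec (t ij.2) (t ij.1)) gg t ij.
(** The inversions of t that do not cross the boundary before block z. *)
Definition Sprod z (t : tableau) : K :=
  \prod_(ij : 'I_n * 'I_n | [&& (ij.1 < ij.2)%N, prec (t ij.2) (t ij.1)
     & (blk (t ij.2) < z %% p)%N == (blk (t ij.1) < z %% p)%N]) gg t ij.
(** The inversions of t that cross the boundary before block z: the larger entry comes
    in the earlier part. *)
Definition Cprod z (t : tableau) : K :=
  \prod_(ij : 'I_n * 'I_n | [&& (ij.1 < ij.2)%N, (blk (t ij.2) < z %% p)%N
     & (z %% p <= blk (t ij.1))%N]) gg t ij.
(** The pairs across the boundary that are not inverted; these become the inversions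
    across it after the shift by z. *)
Definition Dprod z (t : tableau) : K :=
  \prod_(ij : 'I_n * 'I_n | [&& (ij.1 < ij.2)%N, (blk (t ij.1) < z %% p)%N
     & (z %% p <= blk (t ij.2))%N]) gg t ij.
Definition Nprod z (la : mpart) : K :=
  \prod_(X in diagram la | (blk X < z %% p)%N)
    \prod_(Y in diagram la | (z %% p <= blk Y)%N) gf (nres X) (nres Y).

Lemma Ginv_SC z t : Ginv t = Sprod z t * Cprod z t.
Proof.
rewrite /Ginv (bigID (fun ij => (blk (t ij.2) < z %% p)%N == (blk (t ij.1) < z %% p)%N)) /=.
congr (_ * _); first by apply: eq_bigl => ij; rewrite andbA.
apply: eq_bigl => -[i j] /=; case: (boolP (i < j)%N) => //= _.
have [E|ne] := eqVneq (blk (t j) < z %% p)%N (blk (t i) < z %% p)%N.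
  by rewrite andbF E [(z %% p <= _)%N]leqNgt andbN.
by rewrite (prec_cross ne) andbT [(z %% p <= _)%N]leqNgt; move: ne; case: ltnP; case: ltnP.
Qed.

Lemma Ginv_shift z t : Ginv (tab_shift z t) = Sprod z t * Dprod z t.
Proof.
rewrite /Ginv (bigID (fun ij => (blk (t ij.2) < z %% p)%N == (blk (t ij.1) < z %% p)%N)) /=.
congr (_ * _); apply: eq_big.
- move=> [i j] /=; rewrite !tab_shiftE -andbA; congr (_ && _).
  have [E|ne] := eqVneq (blk (t j) < z %% p)%N (blk (t i) < z %% p)%N; last by rewrite !andbF.
  by rewrite prec_negz_same.
- by move=> [i j] _; rewrite /gg /= !tab_shiftE gfac_sh.
- move=> [i j] /=; rewrite !tab_shiftE; case: (boolP (i < j)%N) => //= _.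
  have [E|ne] := eqVneq (blk (t j) < z %% p)%N (blk (t i) < z %% p)%N.
    by rewrite andbF [(z %% p <= _)%N]leqNgt E andbN.
  rewrite prec_negz_cross // andbT.
  by move: ne; case: (ltnP (blk (t j))); case: (ltnP (blk (t i))).
by move=> [i j] _; rewrite /gg /= !tab_shiftE gfac_sh.
Qed.

Lemma prod_diagram (la : mpart) t (P : pred node) (F : node -> K) : is_std la t ->
  \prod_(X in diagram la | P X) F X = \prod_(k | P (t k)) F (t k).
Proof.
case/and4P => /injectiveP inj /eqP <- _ _.
rewrite big_imset_cond /=; last by move=> ? ? _ _; apply: inj.
by [].
Qed.

(** Inverted or not, every pair of nodes across the boundary occurs once, and gfac is
    symmetric. *)
Lemma CD_prod z (la : mpart) t : is_std la t -> Cprod z t * Dprod z t = Nprod z la.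
Proof.
move=> ht; rewrite /Nprod (prod_diagram _ _ ht).
under [in RHS]eq_bigr => i _ do rewrite (prod_diagram _ _ ht).
rewrite pair_big /= [RHS](bigID (fun ij : 'I_n * 'I_n => (ij.1 < ij.2)%N)) /= mulrC; congr (_ * _).
  by apply: eq_bigl => -[i j] /=; rewrite andbC.
rewrite /Cprod (reindex (fun ij : 'I_n * 'I_n => (ij.2, ij.1))) /=; last first.
  by exists (fun ij : 'I_n * 'I_n => (ij.2, ij.1)) => -[].
apply: eq_big => [[i j]|[i j] _] /=; last by rewrite /gg gfacC.
case: (ltngtP i j) => [h|h|/val_inj ->] /=; rewrite ?andbT ?andbF //.
by rewrite [(z %% p <= _)%N]leqNgt andbN.
Qed.

Lemma prod_invset (la : mpart) (hla : is_mpart la) (w : 'S_n) (R : rel node) :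
  \prod_(ab in invset w | R (nd la ab.1) (nd la ab.2))
     gf (rho eps q Q la ab.1) (rho eps q Q la ab.2)
  = \prod_(ij : 'I_n * 'I_n | [&& (ij.1 < ij.2)%N, prec (tab la w ij.2) (tab la w ij.1)
       & R (tab la w ij.2) (tab la w ij.1)]) gg (tab la w) ij.
Proof.
rewrite (reindex (fun ij : 'I_n * 'I_n => ((w^-1)%g ij.2, (w^-1)%g ij.1))) /=; last first.
  exists (fun ab : 'I_n * 'I_n => (w ab.2, w ab.1)) => -[i j] _ /=; by rewrite ?permK ?permKV.
apply: eq_big => [[i j]|[i j] _] /=.
  by rewrite in_invset /tab !tab_actE !permKV (prec_nd hla) -andbA andbCA.
by rewrite gfacC /gg /tab /= !tab_actE.
Qed.

Lemma Gfac_Ginv (la : mpart) (hla : is_mpart la) (w : 'S_n) :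
  Gfac eps q Q la w = Ginv (tab la w).
Proof.
have := prod_invset hla w (fun _ _ => true); rewrite /Ginv /Gfac.
under eq_bigl => ab do rewrite andbT; move=> ->.
by apply: eq_bigl => ij; rewrite andbT.
Qed.

(** The Young part of d(t) keeps the relative order on each side of the boundary and
    makes every pair across it non-inverted. *)
Lemma mid_std (la : mpart) (hla : is_mpart la) z t : is_std la t ->
  exists w, [/\ std_perm la w, mid la z t = tab la w & Gfac eps q Q la w = Sprod z t].
Proof.
move=> ht; have Et := tab_permP hla ht; set w := tab_perm la t in Et.
have hw : std_perm la w by rewrite /std_perm Et.
rewrite /mid; case: eqP => z0.
  exists w; split=> //; rewrite (Gfac_Ginv hla) /tab Et (Ginv_SC z).
  rewrite /Cprod big1 ?mulr1 // => ij; rewrite z0 ltn0 andbF //.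
set a := blocks_size la _; set x := young2_part a w.
have side (k : 'I_n) : (k < a)%N = (blk (nd la k) < z %% p)%N.
  by rewrite /a /blocks_size nd_comp_lt // /blk ltn_divLR.
have [hx _] := young2_partP a w; have /young2P xa := hx.
exists x; split=> //.
  apply/(std_permP hla) => i j ij; rewrite young2_part_lt.
    exact: (std_permP hla _ hw).
  by rewrite !side; have /andP[/eqP E _] := ij; rewrite /blk E.
rewrite -[in RHS]Et -[tab_act _ _]/(tab la w).
rewrite /Sprod -(prod_invset hla w (fun X Y => (blk X < z %% p)%N == (blk Y < z %% p)%N)).
apply: eq_bigl => -[i j]; rewrite !in_invset /= -!side.
have [E|ne] := eqVneq (i < a)%N (j < a)%N.
  by rewrite andbT young2_part_lt // E.
rewrite andbF; apply/negP => /andP[ij lt].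
have /andP[ia ja] : (i < a)%N && (a <= j)%N by move: ne; case: ltnP; case: ltnP => //=; lia.
have xi : (x i < a)%N by rewrite xa.
have xj : (a <= x j)%N by rewrite leqNgt xa -leqNgt.
by move: (leq_trans xi xj); rewrite ltnNge (ltnW lt).
Qed.

End GammaProducts.

(** * Products over index triangles *)

Section Index.
Variables (K : fieldType) (m : nat) (P : nat -> K).
Hypothesis Psym : forall k, (0 < k < m)%N -> P (m - k)%N = P k.

(** The symmetry exchanges the last l indices with the first l. *)
Lemma prod_top l : (l < m)%N -> \prod_(m - l <= j < m) P j = \prod_(1 <= j < l.+1) P j.
Proof.
elim: l => [|l IH] lm; first by rewrite subn0 !big_geq.
rewrite big_ltn; last by lia.
rewrite (_ : (m - l.+1).+1 = m - l)%N; last by lia.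
rewrite IH; last by lia.
by rewrite [RHS]big_nat_recr //= [RHS]mulrC Psym //; lia.
Qed.

(** Adding the index l multiplies the left side by the product of all P k.  On the
    right, the rectangle loses its column k = l, of product E, and gains the row
    i = l, of product C, whereas the triangle gains a row of product E.  By symmetry
    C E is the product of all P k. *)
Lemma prod_triangle l : (l <= m)%N ->
  (\prod_(1 <= k < m) P k) ^+ l
  = (\prod_(0 <= i < l) \prod_(l <= k < m) P (k - i)%N)
    * (\prod_(0 <= k < l) \prod_(0 <= i < k) P (k - i)%N) ^+ 2.
Proof.
elim: l => [|l IH] lm; first by rewrite expr0 ![\prod_(0 <= _ < 0) _]big_geq // expr1n mulr1.
rewrite exprSr IH; last exact: ltnW.
set N := \prod_(0 <= i < l) _; set A := \prod_(0 <= k < l) _.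
pose E := \prod_(0 <= i < l) P (l - i)%N.
pose B := \prod_(0 <= i < l) \prod_(l.+1 <= k < m) P (k - i)%N.
pose C := \prod_(l.+1 <= k < m) P (k - l)%N.
have NE : N = E * B.
  by rewrite /N /E /B -big_split /=; apply: eq_bigr => i _; rewrite big_ltn.
have E1 : E = \prod_(m - l <= j < m) P j.
  rewrite prod_top // big_add1 /= /E big_nat_rev /= add0n; apply: eq_big_nat => i /andP[_ il].
  by congr P; lia.
have C1 : C = \prod_(1 <= j < m - l) P j.
  by rewrite /C -[l.+1]add1n big_addn; apply: eq_bigr => j _; rewrite addnK.
have tot : \prod_(1 <= k < m) P k = C * E.
  by rewrite C1 E1 -big_cat_nat //=; lia.
rewrite [in RHS]big_nat_recr //= -/B [\prod_(0 <= k < l.+1) _]big_nat_recr //= -/A -/E -/C.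
by rewrite NE tot; ring.
Qed.

End Index.

Lemma prod_fiber (K : fieldType) (I : finType) (R : pred I) (f : I -> nat) (F : I -> K) l u :
  (l <= u)%N ->
  \prod_(i | R i && (l <= f i < u)%N) F i
  = \prod_(l <= k < u) \prod_(i | R i && (f i == k)) F i.
Proof.
elim: u => [|u IH].
  by rewrite leqn0 => /eqP ->; rewrite big_geq // big1 // => i; rewrite andbF.
rewrite leq_eqVlt => /orP[/eqP <-|lu].
  by rewrite big_geq // big1 // => i /andP[_]; lia.
rewrite big_nat_recr //= -IH // (bigID (fun i => (f i < u)%N)) /=; congr (_ * _).
  by apply: eq_bigl => i; rewrite -andbA; congr (_ && _); lia.
by apply: eq_bigl => i; rewrite -andbA; congr (_ && _); lia.
Qed.

(** Fold the square along its diagonal. *)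
Lemma prod_square (K : fieldType) n a (s : 'I_n -> 'I_n -> K) :
  (forall i j, s i j = s j i) ->
  \prod_(i < n | (i < a)%N) \prod_(j < n | (j < a)%N) s i j
  = (\prod_(i < n | (i < a)%N) s i i)
    * (\prod_(i < n | (i < a)%N) \prod_(j < n | (j < i)%N) s i j) ^+ 2.
Proof.
move=> sC.
have E : \prod_(i < n | (i < a)%N) \prod_(j < n | (j < i)%N) s i j
  = \prod_(i < n | (i < a)%N) \prod_(j < n | (i < j < a)%N) s i j.
  rewrite (exchange_big_dep (fun j : 'I_n => (j < a)%N)) /=; last by move=> i j; lia.
  apply: eq_bigr => j ja; apply: eq_big => [i|i _]; last exact: sC.
  by rewrite andbC.
rewrite expr2 {2}E -!big_split /=; apply: eq_bigr => i ia.
rewrite (bigID (fun j : 'I_n => (j < i)%N)) /= mulrCA; congr (_ * _).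
  by apply: eq_bigl => j; lia.
rewrite (bigD1 i) /=; last by rewrite ia ltnn.
congr (_ * _); apply: eq_bigl => j; rewrite -(inj_eq val_inj) /=; lia.
Qed.

(** * The square of h *)

Section MegaBlocks.
Variables p' d' n : nat.
Local Notation p := p'.+1.
Local Notation d := d'.+1.
Local Notation r := (p'.+1 * d'.+1)%N.
Local Notation node := (node p' d' n).
Local Notation mpart := (mpart p' d' n).
Local Notation tableau := (tableau p' d' n).
Variables (K : fieldType) (eps q : K) (Q : 'I_d'.+1 -> K).
Hypothesis q0 : q != 0.
Hypothesis heps : p.-primitive_root eps.
Hypothesis cyc0 : forall s : 'I_r, cyc_param eps Q s != 0.
Local Notation nres := (@node_res p' d' n K eps q Q).
Local Notation gf := (gfac q).
Variable la : mpart.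
Hypothesis hla : is_mpart la.
Local Notation o := (o_ la).
Local Notation PI := (p_ la).
Local Notation nd := (nd la).

Let o0 : (0 < o)%N. Proof. by case: (o_P la). Qed.
Let PIo : (PI * o = p)%N. Proof. exact: p_mul_o. Qed.

Lemma std_init : is_std la (init_tab la).
Proof.
have := std_perm1 hla; rewrite /std_perm.
by have -> : tab_act (init_tab la) 1%g = init_tab la by apply/ffunP => k; rewrite ffunE invg1 perm1.
Qed.

Lemma blk_mega (X : node) : (blk X %/ o < PI)%N.
Proof. by rewrite ltn_divLR // PIo blk_lt. Qed.

Lemma init_side (k : 'I_n) z : (k < blocks_size la z)%N = (blk (nd k) < z)%N.
Proof. by rewrite /blocks_size nd_comp_lt // /blk ltn_divLR. Qed.

(** The factor P_k of h_la as a product over the nodes of the first o_la blocks. *)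
Definition PF (k : nat) : K :=
  \prod_(X in diagram la | (blk X < o)%N) \prod_(Y in diagram la | (blk Y < o)%N)
     gf (nres Y) (eps ^+ (k * o) * nres X).

Lemma P_factorE k : P_factor eps q Q la k = PF k.
Proof.
rewrite /PF (prod_diagram _ _ std_init) /P_factor; apply: eq_big => [i|i _].
  exact: init_side.
rewrite (prod_diagram _ _ std_init); apply: eq_big => [j|j _]; first exact: init_side.
by rewrite !resE // /gfac mulrA.
Qed.

Lemma sh_diagram k X : (sh (k * o) X \in diagram la) = (X \in diagram la).
Proof. by rewrite -in_diagram_shift mpart_shift_mul_o. Qed.

Lemma sh_mega k (X : node) : (k < PI)%N -> (blk (sh (k * o) X) %/ o == k)%N = (blk X < o)%N.
Proof.
move=> kP; rewrite blk_sh -PIo -modn_divl divnDMl //.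
rewrite -[X in _ == X](modn_small kP) -[X in _ == X %[mod _]]add0n eqn_modDr mod0n.
by rewrite modn_small ?blk_mega // -leqn0 -ltnS ltn_divLR // mul1n.
Qed.

Lemma mega_reindex k (F : node -> K) : (k < PI)%N ->
  \prod_(X in diagram la | (blk X %/ o == k)%N) F X
  = \prod_(X in diagram la | (blk X < o)%N) F (sh (k * o) X).
Proof.
move=> kP; rewrite (reindex (sh (k * o))) /=; last first.
  exists (sh (negz p' (k * o))) => X _; [exact: sh_Knegz|exact: sh_negzK].
by apply: eq_bigl => X; rewrite sh_diagram sh_mega.
Qed.

(** By periodicity of la, the groups m and k of o_la blocks are translates of the
    first group, and only the difference of the translations matters for gfac. *)
Lemma mega_prod m k : (m <= k < PI)%N ->
  \prod_(X in diagram la | (blk X %/ o == m)%N) \prod_(Y in diagram la | (blk Y %/ o == k)%N)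
     gf (nres X) (nres Y) = PF (k - m).
Proof.
move=> /andP[mk kP]; rewrite mega_reindex; last exact: leq_ltn_trans kP.
under eq_bigr => X _ do rewrite mega_reindex //.
rewrite exchange_big /=; apply: eq_bigr => Y _; apply: eq_bigr => X _.
have Ek : (k * o = m * o + (k - m) * o)%N by rewrite -mulnDl subnKC.
rewrite !node_res_sh // Ek exprD -mulrA gfacZ //.
by rewrite expf_neq0 // (eps_neq0 heps).
Qed.

(** Exchange the two variables and use eps ^ p = 1. *)
Lemma PF_sym k : (0 < k < PI)%N -> PF (PI - k)%N = PF k.
Proof.
move=> /andP[k0 kP]; rewrite /PF exchange_big /=; apply: eq_bigr => X _; apply: eq_bigr => Y _.
have e0 : eps ^+ (k * o) != 0 by rewrite expf_neq0 // (eps_neq0 heps).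
rewrite -(gfacZ q (nres X) _ e0) mulrA -exprD -mulnDl addnC subnK ?(ltnW kP) // PIo.
by rewrite (prim_expr_order heps) mul1r gfacC.
Qed.

(** This is a square root of 1 other than 1, since eps is primitive. *)
Lemma eps_half : ~~ odd PI -> eps ^+ (PI %/ 2 * o) = -1.
Proof.
move=> ev; have PI0 : (0 < PI)%N by rewrite -(ltn_pmul2r o0) PIo mul0n.
have PE : (PI = 2 * (PI %/ 2))%N by rewrite mulnC divnK // dvdn2.
have h : (eps ^+ (PI %/ 2 * o)) ^+ 2 = 1.
  by rewrite -exprM mulnC mulnA -PE PIo (prim_expr_order heps).
have : eps ^+ (PI %/ 2 * o) != 1.
  rewrite -(prim_order_dvd heps); apply/negP => /dvdn_leq.
  have lt : (0 < PI %/ 2 < PI)%N by lia.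
  by rewrite muln_gt0 o0 andbT -PIo leq_pmul2r //; lia.
move: h => /eqP; rewrite sqrf_eq1 => /orP[->//|/eqP->//].
Qed.

(** For odd p_la the symmetry of P pairs the index k with p_la - k.  For even p_la
    the middle index is left over; there the power of eps is -1, and folding P along
    the diagonal gives the square of the remaining factors of h_la. *)
Lemma h_shape_sq : h_shape eps q Q la ^+ 2 = \prod_(1 <= k < PI) PF k.
Proof.
have PI0 : (0 < PI)%N by rewrite -(ltn_pmul2r o0) PIo mul0n.
rewrite /h_shape; case: (boolP (odd PI)) => par.
  set c := (PI.-1 %/ 2)%N; have PE : PI = (c + c).+1 by rewrite /c; lia.
  under eq_bigr => k _ do rewrite P_factorE.
  rewrite (@big_cat_nat _ _ _ c.+1 1 PI) //=; last by lia.
  have := prod_top PF_sym (l := c); rewrite expr2 (_ : PI - c = c.+1)%N; last by lia.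
  by move=> ->; last lia.
set c := (PI %/ 2)%N; have PE : PI = (c + c)%N by rewrite /c; lia.
have c0 : (0 < c)%N by lia.
have PFc : PF c = (((q + 1) ^+ blocks_size la o / 2%:R ^+ blocks_size la o)
       * \prod_(i < n | (i < blocks_size la o)%N) \prod_(j < n | (j < i)%N)
           ((q * res eps q Q (init_tab la) j + res eps q Q (init_tab la) i)
            * (res eps q Q (init_tab la) j + q * res eps q Q (init_tab la) i)
            / (res eps q Q (init_tab la) j + res eps q Q (init_tab la) i) ^+ 2)) ^+ 2.
  rewrite -P_factorE /P_factor /c eps_half //.
  set rh := res eps q Q (init_tab la); set a := blocks_size la o.
  pose s i j := (q * rh j + rh i) * (rh j + q * rh i) / (rh j + rh i) ^+ 2.
  transitivity (\prod_(i < n | (i < a)%N) \prod_(j < n | (j < a)%N) s i j).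
    by apply: eq_bigr => i _; apply: eq_bigr => j _; rewrite mulrN1 !mulNr mul1r !opprK.
  have sC i j : s i j = s j i.
    rewrite /s [rh i + rh j]addrC; congr (_ / _).
    by move: (rh i) (rh j) => x y; ring.
  rewrite prod_square // exprMn; congr (_ * _).
  rewrite (eq_bigr (fun=> ((q + 1) / 2%:R) ^+ 2)) => [|i _].
    rewrite prodr_const card_ord_lt; last first.
      by rewrite -[X in (_ <= X)%N](shape_size hla); apply: leq_sum_lt_all.
    by rewrite -!exprM -expr_div_n -exprM mulnC.
  have r0 : rh i != 0 by rewrite /rh resE //; apply: node_res_neq0.
  have -> : s i i = ((q + 1) * rh i) ^+ 2 / (2%:R * rh i) ^+ 2.
    by rewrite /s; congr (_ / _ ^+ 2); ring.
  by move: (rh i) r0 => x r0; rewrite !exprMn invfM mulrACA (divff (expf_neq0 2 r0)) mulr1 exprVn.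
under eq_bigr => k _ do rewrite P_factorE.
rewrite -mulrA exprMn -PFc.
rewrite (@big_cat_nat _ _ _ c 1 PI) //=; last by lia.
rewrite [X in _ = _ * X]big_ltn; last by lia.
have := prod_top PF_sym (l := c.-1); rewrite (_ : PI - c.-1 = c.+1)%N; last by lia.
rewrite prednK // => ->; last by lia.
by rewrite expr2; ring.
Qed.

End MegaBlocks.

(** * Ratios of structure constants *)

Section Final.
Variables p' d' n : nat.
Local Notation p := p'.+1.
Local Notation d := d'.+1.
Local Notation r := (p'.+1 * d'.+1)%N.
Local Notation node := (node p' d' n).
Local Notation mpart := (mpart p' d' n).
Local Notation tableau := (tableau p' d' n).
Hypothesis n1 : (1 < n)%N.
Variables (K : fieldType) (eps q : K) (Q : 'I_d'.+1 -> K).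
Hypothesis q0 : q != 0.
Hypothesis heps : p.-primitive_root eps.
Hypothesis cyc0 : forall s : 'I_r, cyc_param eps Q s != 0.
Local Notation nres := (@node_res p' d' n K eps q Q).
Local Notation gf := (gfac q).
Local Notation Sprod := (Sprod eps q Q).
Local Notation Cprod := (Cprod eps q Q).
Local Notation Dprod := (Dprod eps q Q).
Local Notation Nprod := (Nprod eps q Q).
Variable gamma : tableau -> K.
Hypothesis gamma0 : forall la t, is_mpart la -> is_std la t -> gamma t != 0.
Hypothesis gammaE : forall la, is_mpart la -> exists2 kappa, kappa != 0 &
  forall w, std_perm la w -> gamma (tab la w) = kappa * Gfac eps q Q la w.

(** The same constant serves all tableaux of the shape, which is what lets it cancel
    in quotients. *)
Lemma gamma_products la : is_mpart la -> exists2 kappa, kappa != 0 &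
  forall t, is_std la t -> gamma t = kappa * Ginv eps q Q t /\
  forall z, [/\ gamma t = kappa * (Sprod z t * Cprod z t), gamma (mid la z t) = kappa * Sprod z t,
        Sprod z t != 0 & Cprod z t != 0].
Proof.
move=> hla; have [kappa k0 hk] := gammaE hla; exists kappa => // t ht.
have Et : tab la (tab_perm la t) = t := tab_permP hla ht.
have E0 : gamma t = kappa * Ginv eps q Q t.
  rewrite -{1}Et hk; first by rewrite (Gfac_Ginv _ _ _ hla) Et.
  by rewrite /std_perm -/(tab la _) Et.
split=> // z.
have E1 : gamma t = kappa * (Sprod z t * Cprod z t) by rewrite -Ginv_SC.
have [w [hw Ew Gw]] := mid_std Q q0 heps hla z ht.
split=> //; first by rewrite Ew hk // Gw.
  by have := gamma0 hla ht; rewrite E1 !mulf_eq0 !negb_or => /and3P[].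
by have := gamma0 hla ht; rewrite E1 !mulf_eq0 !negb_or => /and3P[].
Qed.

Lemma gamma_shift la z : is_mpart la -> exists2 kappa, kappa != 0 &
  forall u, is_std la u -> gamma (tab_shift z u) = kappa * (Sprod z u * Dprod z u)
    /\ Dprod z u != 0.
Proof.
move=> hla; have hz := is_mpart_shift z hla.
have [kappa k0 hk] := gamma_products hz; exists kappa => // u hu.
have hzu := is_std_shift z hu.
have E : gamma (tab_shift z u) = kappa * (Sprod z u * Dprod z u).
  by have [-> _] := hk _ hzu; rewrite (Ginv_shift q Q heps).
split=> //; have := gamma0 hz hzu.
by rewrite E !mulf_eq0 !negb_or => /and3P[].
Qed.

Lemma mid_ratio la z t : is_mpart la -> is_std la t ->
  gamma (mid la z t) / gamma t = (Cprod z t)^-1.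
Proof.
move=> hla ht; have [kappa k0 hk] := gamma_products hla.
have [_ /(_ z)[-> -> S0 C0]] := hk t ht.
move: (Sprod z t) (Cprod z t) S0 C0 => S C S0 C0; field.
by rewrite k0 S0 C0.
Qed.

Section HZero.
Variable la : mpart.
Hypothesis hla : is_mpart la.
Local Notation o := (o_ la).
Local Notation PI := (p_ la).
Local Notation nd := (nd la).
Local Notation PF := (PF eps q Q la).
Let o0 : (0 < o)%N. Proof. by case: (o_P la). Qed.
Let PIo : (PI * o = p)%N. Proof. exact: p_mul_o. Qed.

Lemma mul_o_lt k : (k < PI)%N -> (k * o < p)%N.
Proof. by move=> kP; rewrite -PIo ltn_pmul2r. Qed.

(** The boundary before block l o_la separates the groups i < l from the groups k >= l. *)
Lemma Nprod_PF l : (l < PI)%N ->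
  Nprod (l * o) la = \prod_(0 <= i < l) \prod_(l <= k < PI) PF (k - i).
Proof.
move=> lP; rewrite /Nprod modn_small ?mul_o_lt //.
rewrite (eq_bigl (fun X => (X \in diagram la) && (0 <= blk X %/ o < l)%N)); last first.
  by move=> X; rewrite ltn_divLR.
rewrite (prod_fiber [in diagram la] (fun X => blk X %/ o)%N _ (leq0n l)); apply: eq_big_nat => i /andP[_ il].
transitivity (\prod_(X in diagram la | (blk X %/ o == i)%N)
   \prod_(l <= k < PI) \prod_(Y in diagram la | (blk Y %/ o == k)%N) gf (nres X) (nres Y)).
  apply: eq_bigr => X _; rewrite -(prod_fiber [in diagram la] (fun X => blk X %/ o)%N _ (ltnW lP)); apply: eq_bigl => Y.
  by rewrite -leq_divRL // blk_mega andbT.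
rewrite exchange_big /=; apply: eq_big_nat => k /andP[lk kP].
by apply: (mega_prod q Q heps); rewrite kP andbT; apply: ltnW (leq_trans il lk).
Qed.

(** The shift of the initial tableau by k groups reads the groups in the order
    k, k + 1, ..., 0, ..., k - 1 while its entries still increase along the original
    order; its inversions across the first boundary pair the group k, now in front,
    with the groups i < k. *)
Lemma Cprod_init k : (k < PI)%N -> (1 < PI)%N ->
  Cprod o (tab_shift (k * o) (init_tab la)) = \prod_(0 <= i < k) PF (k - i).
Proof.
move=> kP P1.
have op : (o < p)%N by rewrite -PIo -{1}[o]mul1n ltn_pmul2r.
have kp := mul_o_lt kP.
have k1p : (k.+1 * o <= p)%N by rewrite -PIo leq_pmul2r.
have hin := std_init hla.
transitivity (\prod_(X in diagram la | (0 <= blk X %/ o < k)%N)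
   \prod_(Y in diagram la | (blk Y %/ o == k)%N) gf (nres X) (nres Y)); last first.
  rewrite (prod_fiber [in diagram la] (fun X => blk X %/ o)%N _ (leq0n k)); apply: eq_big_nat => i /andP[_ ik].
  by apply: (mega_prod q Q heps); rewrite kP andbT ltnW.
rewrite (prod_diagram _ _ hin).
under [in RHS]eq_bigr => i _ do rewrite (prod_diagram _ _ hin).
rewrite pair_big /= /Cprod; apply: eq_big => [[i j]|[i j] _] /=; last first.
  by rewrite /gg /= !tab_shiftE (gfac_sh q Q heps).
rewrite !tab_shiftE !blk_negz (modn_small op) (modn_small kp) -!/(nd _).
have bi := blk_lt (nd i); have bj := blk_lt (nd j).
have mono : (i < j)%N -> (blk (nd i) <= blk (nd j))%N.
  by rewrite -(prec_nd hla) => pr; rewrite leqNgt; apply/negP => lt; move: pr;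
     rewrite prec_blk ?gtn_eqF // ltnNge (ltnW lt).
have mono' : (blk (nd i) < blk (nd j))%N -> (i < j)%N.
  by move=> lt; rewrite -(prec_nd hla) prec_blk // ltn_eqF.
move: mono mono' bi bj; move: (blk (nd i)) (blk (nd j)) => b c.
have -> : (c %/ o == k)%N = (k * o <= c < o + k * o)%N.
  by rewrite eqn_leq -ltnS ltn_divLR // leq_divRL // mulSn andbC.
rewrite [(b %/ o < k)%N]ltn_divLR //= mulSn in k1p *.
move: (o_ la) k1p kp op o0 => o' k1p kp op o'0; move: (k * o')%N k1p kp => ko k1p kp.
case: (ltnP b ko) => h1; case: (ltnP c ko) => h2 m1 m2 bi bj;
  clear -h1 h2 m1 m2 bi bj k1p kp op o'0; lia.
Qed.

Lemma h_zero_sq l : (l < PI)%N -> h_zero eps q Q gamma la l ^+ 2 = Nprod (l * o) la.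
Proof.
move=> lP; rewrite Nprod_PF //.
have hin := std_init hla.
have E : h_zero eps q Q gamma la l = h_shape eps q Q la ^+ l
    / \prod_(0 <= k < l) \prod_(0 <= i < k) PF (k - i).
  rewrite /h_zero; congr (_ * _); rewrite -prodfV big_mkord; apply: eq_bigr => k _.
  have us := is_std_shift (k * o) hin.
  rewrite mpart_shift_mul_o in us *; rewrite mid_ratio // Cprod_init //.
  - by apply: leq_ltn_trans lP; apply: ltnW.
  by apply: leq_ltn_trans lP; apply: leq_ltn_trans (ltn_ord k).
have A0 : \prod_(0 <= k < l) \prod_(0 <= i < k) PF (k - i) != 0.
  rewrite prodf_seq_neq0; apply/allP => k; rewrite mem_index_iota => /andP[_ kl] /=.
  have us := is_std_shift (k * o) hin; rewrite mpart_shift_mul_o in us.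
  have [kappa k0 hk] := gamma_products hla; have [_ /(_ o)[_ _ _]] := hk _ us.
  rewrite Cprod_init //; first by apply: ltn_trans lP.
  by apply: leq_ltn_trans lP; apply: leq_ltn_trans kl.
rewrite E exprMn exprAC (h_shape_sq q0 heps cyc0 hla) (prod_triangle (PF_sym q Q heps (la := la)) (ltnW lP)).
by rewrite exprVn mulfK // expf_neq0.
Qed.

End HZero.

(** The cancellation behind rep_ratio.  With the suffixes 1 and 2 for t and
    u = t<z> at the boundary x, and z for t at the boundary z, the two expressions
    for gamma_t and for gamma_u give S2 C2 / (S1 C1) = Dz / Cz. *)
Lemma rep_ratio_algebra (kappa kx h A B C gt gu hu hv S1 S2 C1 C2 D1 D2 Sz Cz Dz : K) :
  kappa != 0 -> kx != 0 -> S1 != 0 -> C1 != 0 -> D1 != 0 -> S2 != 0 -> C2 != 0 ->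
  Sz != 0 -> Cz != 0 ->
  gt = kappa * (S1 * C1) -> gt = kappa * (Sz * Cz) ->
  gu = kappa * (S2 * C2) -> gu = kappa * (Sz * Dz) ->
  A = kappa * Sz -> B = kappa * S2 -> C = kappa * S1 ->
  hu = kx * (S2 * D2) -> hv = kx * (S1 * D1) ->
  C1 * D1 = C2 * D2 -> h ^+ 2 = Cz * Dz ->
  (h * A / gt * (gt * B / (C * gu))) ^+ 2 = hu / hv.
Proof.
move=> k0 kx0 S10 C10 D10 S20 C20 Sz0 Cz0 Et1 Et3 Eu2 Eu3 -> -> -> -> -> EC hz.
have ES : S2 * C2 = Sz * Dz by apply: (mulfI k0); rewrite -Eu2 Eu3.
have ET : S1 * C1 = Sz * Cz by apply: (mulfI k0); rewrite -Et1 Et3.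
rewrite Eu2 Et3.
have -> : h * (kappa * Sz) / (kappa * (Sz * Cz))
    * (kappa * (Sz * Cz) * (kappa * S2) / (kappa * S1 * (kappa * (S2 * C2))))
    = h * Sz / (S1 * C2) by field; rewrite k0 Cz0 Sz0 S10 S20 C20.
have -> : kx * (S2 * D2) / (kx * (S1 * D1)) = S2 * (C2 * D2) / (S1 * C2 * D1).
  by field; rewrite kx0 C20 S10 D10.
rewrite -EC expr_div_n exprMn hz.
have -> : Cz * Dz * Sz ^+ 2 = (Sz * Cz) * (Sz * Dz) by ring.
by rewrite -ET -ES; field; rewrite D10 S10 C20.
Qed.

(** Apply the factorization of gamma to the four tableaux t, u = t<z>, t<x> and u<x>,
    the first two at the boundaries x and z. *)
Lemma rep_ratio la t l x : is_mpart la -> is_std la t -> (l < p_ la)%N ->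
  h_rep_shift eps q Q gamma la t l x ^+ 2
  = gamma (tab_shift (l * o_ la) (tab_shift x t)) / gamma (tab_shift x t).
Proof.
move=> hla ht lP; pose z := (l * o_ la)%N.
have Ez : mpart_shift z la = la by exact: mpart_shift_mul_o.
pose u := tab_shift z t.
have hu : is_std la u by have := is_std_shift z ht; rewrite Ez.
have [kappa k0 hk] := gamma_products hla.
have [kx kx0 hkx] := gamma_shift x hla.
have [_ hkt] := hk t ht; have [Eu0 hku] := hk u hu.
have [Et1 Em1 S1 C1] := hkt x; have [Eu1 Em2 S2 C2] := hku x.
have [Et3 Em3 Sz Cz] := hkt z.
have [Ext D1] := hkx t ht; have [Exu _] := hkx u hu.
have EC : Cprod x t * Dprod x t = Cprod x u * Dprod x u.
  by rewrite (CD_prod eps q Q x ht) (CD_prod eps q Q x hu).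
have hz := h_zero_sq hla lP; rewrite -(CD_prod eps q Q _ ht) in hz.
rewrite (Ginv_shift q Q heps) in Eu0.
rewrite /h_rep_shift /h_rep -/z Ez -/u.
have -> : tab_shift z (tab_shift x t) = tab_shift x u by rewrite !tab_shift_add addnC.
exact: (rep_ratio_algebra k0 kx0 S1 C1 D1 S2 C2 Sz Cz Et1 Et3 Eu1 Eu0 Em3 Em2 Em1 Exu Ext EC hz).
Qed.

End Final.

(** * The theorem *)

(** Shift t to the shape of its representative, and then by the multiple of o_la that
    brings the first entry into the first group of blocks; this keeps the shape. *)
Lemma rep_exists p' d' n (P : {set mpart p' d' n}) la t : (1 < n)%N -> shift_transversal P ->
  is_mpart la -> is_std la t ->
  exists y : mpart p' d' n * tableau p' d' n * 'I_p'.+1,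
    [&& y.1.1 \in P, is_std y.1.1 y.1.2, starts_early y.1.1 y.1.2
      & tab_shift y.2 y.1.2 == t].
Proof.
move=> n1 [_ hP] hla ht; have [mu [[muP [k Emu]] _]] := hP la hla.
pose t1 := tab_shift k t; have ht1 : is_std mu t1 by rewrite Emu; apply: is_std_shift.
pose k0 := Ordinal (ltnW n1); have [o0 _] := o_P mu.
pose j := (blk (t1 k0) %/ o_ mu)%N; pose z := (j * o_ mu)%N.
have zb : (z <= blk (t1 k0))%N by apply: leq_trunc_div.
have zp : (z < p'.+1)%N by apply: leq_ltn_trans zb (blk_lt _).
pose x : 'I_p'.+1 := inord (negz p' (z + k) %% p'.+1).
exists (mu, tab_shift z t1, x) => /=; apply/and4P; split=> //.
- by have := is_std_shift z ht1; rewrite mpart_shift_mul_o.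
- apply/forallP => i; apply/implyP => /eqP i0.
  have -> : i = k0 by apply: val_inj.
  rewrite -ltn_divLR // -/(blk _) tab_shiftE blk_negz (modn_small zp) [(blk (t1 k0) < z)%N]ltnNge zb /=.
  by rewrite ltn_subLR // /z -mulSnr -ltn_divLR.
apply/eqP; rewrite /t1 !tab_shift_add.
rewrite -[RHS]tab_shift0; apply: tab_shift_eqmod.
by rewrite inordK ?ltn_pmod // -?addnA modnDml addnC negzK.
Qed.

Theorem theorem1p4 (p' d' n : nat) (hn : (1 < n)%N)
  (K : fieldType) (eps q : K) (Q : 'I_d'.+1 -> K)
  (heps : p'.+1.-primitive_root eps)
  (hq0 : q != 0) (hq1 : q != 1) (hQ : forall c, Q c != 0)
  (H : algType K) (T : nat -> H)
  (hH : is_hecke_algebra p' n q Q T)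
  (hss : semisimple_ring H)
  (star : {linear H -> H}) (hstar : is_star n T star)
  (gamma : tableau p' d' n -> K)
  (hgamma : is_gamma eps q Q T star gamma)
  (Psigma : {set mpart p' d' n}) (hPsigma : shift_transversal Psigma)
  (la : mpart p' d' n) (hla : is_mpart la)
  (t : tableau p' d' n) (ht : is_std la t)
  (l : nat) (hl : (l < p_ la)%N) :
  h_tab eps q Q gamma Psigma t l \is a GRing.unit /\
  gamma (tab_shift (l * o_ la) t) / gamma t
    = h_tab eps q Q gamma Psigma t l ^+ 2.
Proof.
have cyc0 := cyc_param_neq0 heps hQ.
have hq := q_expn_neq1 hn hH hss hq1.
have hqint := qint_neq0 hn hH hss.
have hsep := parameters_separated heps hQ hn hH hss.
have gamma0 := hgamma.1.
have gammaE mu : is_mpart mu -> exists2 kappa, kappa != 0 &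
  forall w, std_perm mu w -> gamma (tab mu w) = kappa * Gfac eps q Q mu w.
  move=> hmu.
  have [Rho [Rho0 RhoT]] := sn_rep hq0 cyc0 heps hq hsep hn hH hmu.
  exact: (gamma_formula hq0 cyc0 heps hq hsep hqint hH hstar hmu Rho0 RhoT hgamma).
have gu := gamma0 _ _ (is_mpart_shift (l * o_ la) hla) (is_std_shift (l * o_ la) ht).
have gt := gamma0 _ _ hla ht.
suff E : gamma (tab_shift (l * o_ la) t) / gamma t = h_tab eps q Q gamma Psigma t l ^+ 2.
  split=> //; rewrite unitfE; apply: contraTneq isT => h0.
  have := E; rewrite h0 expr0n /= => /eqP; rewrite mulf_eq0 invr_eq0 (negPf gu) (negPf gt) //.
rewrite /h_tab; case: pickP => [[[mu s] x] /=|no]; last first.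
  by have [y hy] := rep_exists hn hPsigma hla ht; rewrite no in hy.
case/and4P=> muP hs _ /eqP Et; have hmu := hPsigma.1 _ muP.
have Ela : la = mpart_shift x mu.
  by apply: (shape_unique hla (is_mpart_shift x hmu) ht); rewrite -Et; apply: is_std_shift.
have Eo : o_ la = o_ mu by rewrite Ela o_shift.
have hl' : (l < p_ mu)%N by rewrite /p_ -Eo.
by rewrite (rep_ratio hq0 heps cyc0 gamma0 gammaE x hmu hs hl') Et Eo.
Qed.
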